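(* Let $D$ be a positive integer, let $\Gamma=\operatorname{PSL}(2,\mathbb{Z}[\sqrt{-2}])$, and let $Q=(-2,D)_{\mathbb{Q}}$ be the quaternion algebra over $\mathbb{Q}$ with standard basis $1,i,j,ij$, where $i^2=-2$, $j^2=D$, $ij=-ji$. The $\Gamma$-conjugacy classes of $F$-subgroups of $\Gamma$ whose corresponding circle has discriminant $D$ are represented by the groups of reduced norm $1$ elements (modulo $\pm1$, via suitable matrix representations of $Q$) of the following $\mathbb{Z}$-orders in $Q$: \begin{enumerate} \item $\mathcal{M}_{(1)}=\mathbb{Z}[1,i,j,ij]$, for any positive integer $D$; \item $\mathcal{M}_{(2)}=\mathbb{Z}\left[1,i,\frac{1+j}{2},\frac{i+ij}{2}\right]$, whenever $D\equiv 1 \bmod 4$; \item $\mathcal{M}_{(3)}=\mathbb{Z}\left[1,i,\frac{3i+j}{4},\frac{2+ij}{4}\right]$, whenever $D\equiv 2 \bmod 16$; \item $\mathcal{M}_{(4)}=\mathbb{Z}\left[1,i,\frac{i+j+ij}{4},\frac{2+2i+ij}{4}\right]$, whenever $D\equiv 6 \bmod 16$; \item $\mathcal{M}_{(5)}=\mathbb{Z}\left[1,i,\frac{i+j}{2},\frac{ij}{2}\right]$, whenever $D\equiv 2 \bmod 4$; \item $\mathcal{M}_{(6)}=\mathbb{Z}\left[1,i,\frac{1+j+ij}{2},\frac{i+ij}{2}\right]$, whenever $D\equiv 3 \bmod 4$. \end{enumerate} That is, every $F$-subgroup of $\Gamma$ with discriminant $D$ is $\Gamma$-conjugate to $\rho(\mathcal{M}^1)/\{\pm1\}$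 for some order $\mathcal{M}$ in this list whose congruence condition is satisfied by $D$ and some matrix representation $\rho:Q\otimes\mathbb{C}\to \operatorname{M}_2(\mathbb{C})$; and each order $\mathcal{M}$ in the list whose congruence condition is satisfied by $D$ represents in this way, for some $\rho$, a conjugacy class of $F$-subgroups with discriminant $D$.
   Context: $\operatorname{PSL}(2,\mathbb{C})$ acts on $\partial\mathbb{H}^3=\mathbb{C}\cup\{\infty\}$ by linear fractional transformations. A Fuchsian subgroup of $\Gamma$ is a subgroup preserving a circle (or line) in $\mathbb{C}\cup\{\infty\}$ and each of the two components of its complement. An $F$-subgroup of $\Gamma$ is a maximal nonelementary Fuchsian subgroup of $\Gamma$; it stabilizes a unique circle $\mathcal{C}$. The equation of $\mathcal{C}$ can be written in reduced form $$A|z|^2+B\overline{z}+\overline{B}z+C=0,\qquad A,C\in\mathbb{Z},\ B\in\mathbb{Z}[\sqrt{-2}],$$ with $\gcd(A,b_1,b_2,C)=1$, where $B=b_1+b_2\sqrt{-2}$ with $b_1,b_2\in\mathbb{Z}$. This is unique up to sign. The discriminant of the circle (and of the $F$-subgroup) is $D=B\overline{B}-AC$, a positive integer. For elements $x_1,\dots,x_4\in Q$, the notation $\mathbb{Z}[x_1,x_2,x_3,x_4]$ denotes the $\mathbb{Z}$-order with $\mathbb{Z}$-basis $x_1,x_2,x_3,x_4$. For an order $\mathcal{M}$, $\mathcal{M}^1$ denotes its group of elements of reduced norm $1$. A matrix representation $\rho:Q\otimes\mathbb{C}\to\operatorname{M}_2(\mathbb{C})$ is an isomorphism of $\mathbb{C}$-algebras.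 *)

(* Defs.v *)
From HB Require Import structures.
From mathcomp Require Import all_boot all_order all_algebra.
From mathcomp Require Import generic_quotient.
From mathcomp Require Import all_classical all_reals all_analysis.
From mathcomp Require Import complex ring.

Set Implicit Arguments.
Unset Strict Implicit.
Unset Printing Implicit Defensive.

Import Order.TTheory GRing.Theory Num.Theory.
Import numFieldNormedType.Exports.

Local Open Scope classical_set_scope.
Local Open Scope ring_scope.

(* The element c1 + ci i + cj j + ck ij of the quaternion algebra (a, b)_F,
   in which i^2 = a, j^2 = b and ij = - ji. *)
Record quat (F : comNzRingType) (a b : F) :=
  Quat { c1 : F; ci : F; cj : F; ck : F }.

Section Quaternions.
Variables (F : comNzRingType) (a b : F).
Local Notation H := (quat a b).

Definition quat_tuple (x : H) := (c1 x, ci x, cj x, ck x).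
Definition tuple_quat (t : F * F * F * F) : H :=
  let: (x, y, z, w) := t in Quat a b x y z w.

Lemma quat_tupleK : cancel quat_tuple tuple_quat.
Proof. by case. Qed.

HB.instance Definition _ := Choice.copy H (can_type quat_tupleK).

Definition addh (x y : H) : H :=
  Quat a b (c1 x + c1 y) (ci x + ci y) (cj x + cj y) (ck x + ck y).
Definition opph (x : H) : H := Quat a b (- c1 x) (- ci x) (- cj x) (- ck x).
Definition zeroh : H := Quat a b 0 0 0 0.
Definition oneh : H := Quat a b 1 0 0 0.
Definition mulh (x y : H) : H :=
  Quat a b
    (c1 x * c1 y + a * (ci x * ci y) + b * (cj x * cj y)
       - a * b * (ck x * ck y))
    (c1 x * ci y + ci x * c1 y - b * (cj x * ck y) + b * (ck x * cj y))
    (c1 x * cj y + cj x * c1 y + a * (ci x * ck y) - a * (ck x * ci y))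
    (c1 x * ck y + ck x * c1 y + ci x * cj y - cj x * ci y).
Definition scaleh (k : F) (x : H) : H :=
  Quat a b (k * c1 x) (k * ci x) (k * cj x) (k * ck x).

Local Ltac quat_ring := rewrite /addh /opph /mulh /scaleh /zeroh /oneh /=; congr Quat; ring.

Lemma addhA : associative addh. Proof. by move=> x y z; quat_ring. Qed.
Lemma addhC : commutative addh. Proof. by move=> x y; quat_ring. Qed.
Lemma add0h : left_id zeroh addh. Proof. by case=> *; quat_ring. Qed.
Lemma addNh : left_inverse zeroh opph addh. Proof. by move=> x; quat_ring. Qed.

HB.instance Definition _ := GRing.isZmodule.Build H addhA addhC add0h addNh.

Lemma mulhA : associative mulh. Proof. by move=> x y z; quat_ring. Qed.
Lemma mul1h : left_id oneh mulh. Proof. by case=> *; quat_ring. Qed.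
Lemma mulh1 : right_id oneh mulh. Proof. by case=> *; quat_ring. Qed.
Lemma mulhDl : left_distributive mulh addh.
Proof. by move=> x y z; quat_ring. Qed.
Lemma mulhDr : right_distributive mulh addh.
Proof. by move=> x y z; quat_ring. Qed.
Lemma oneh_neq0 : oneh != zeroh.
Proof. by apply/eqP => -[] /eqP; rewrite oner_eq0. Qed.

HB.instance Definition _ :=
  GRing.Zmodule_isNzRing.Build H mulhA mul1h mulh1 mulhDl mulhDr oneh_neq0.

Lemma scalehA k l x : scaleh k (scaleh l x) = scaleh (k * l) x.
Proof. by quat_ring. Qed.
Lemma scale1h : left_id 1 scaleh. Proof. by case=> *; quat_ring. Qed.
Lemma scalehDr : right_distributive scaleh addh.
Proof. by move=> k x y; quat_ring. Qed.
Lemma scalehDl x : {morph scaleh^~ x : k l / k + l >-> addh k l}.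
Proof. by move=> k l; quat_ring. Qed.

HB.instance Definition _ :=
  GRing.Zmodule_isLmodule.Build F H scalehA scale1h scalehDr scalehDl.

Lemma scalehAl (k : F) (x y : H) : k *: (x * y) = (k *: x) * y.
Proof. by change (scaleh k (mulh x y) = mulh (scaleh k x) y); quat_ring. Qed.
Lemma scalehAr (k : F) (x y : H) : k *: (x * y) = x * (k *: y).
Proof. by change (scaleh k (mulh x y) = mulh x (scaleh k y)); quat_ring. Qed.

HB.instance Definition _ := GRing.Lmodule_isLalgebra.Build F H scalehAl.
HB.instance Definition _ := GRing.Lalgebra_isAlgebra.Build F H scalehAr.

Definition qi : H := Quat a b 0 1 0 0.
Definition qj : H := Quat a b 0 0 1 0.

Definition nrd (x : H) : F :=
  c1 x ^+ 2 - a * ci x ^+ 2 - b * cj x ^+ 2 + a * b * ck x ^+ 2.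

Lemma qi_sqr : qi * qi = a%:A.
Proof. by change (mulh qi qi = scaleh a oneh); rewrite /qi; quat_ring. Qed.
Lemma qj_sqr : qj * qj = b%:A.
Proof. by change (mulh qj qj = scaleh b oneh); rewrite /qj; quat_ring. Qed.
Lemma qiqj : qi * qj = - (qj * qi).
Proof.
by change (mulh qi qj = opph (mulh qj qi)); rewrite /qi /qj; quat_ring.
Qed.
Lemma quatE (x : H) :
  x = c1 x *: 1 + ci x *: qi + cj x *: qj + ck x *: (qi * qj).
Proof.
case: x => x y z w; rewrite /qi /qj.
change (Quat a b x y z w = addh (addh (addh (scaleh x oneh)
  (scaleh y (Quat a b 0 1 0 0))) (scaleh z (Quat a b 0 0 1 0)))
  (scaleh w (mulh (Quat a b 0 1 0 0) (Quat a b 0 0 1 0)))).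
by quat_ring.
Qed.

End Quaternions.

(* For a field extension f : F -> K, the algebra (a, b)_F tensored with K is
   (f a, f b)_K; this is the canonical map x |-> x (x) 1 into it. *)
Definition quat_ext (F K : comNzRingType) (f : {rmorphism F -> K}) (a b : F)
    (x : quat a b) : quat (f a) (f b) :=
  Quat (f a) (f b) (f (c1 x)) (f (ci x)) (f (cj x)) (f (ck x)).

Lemma quat_ext1 (F K : comNzRingType) (f : {rmorphism F -> K}) (a b : F) :
  quat_ext f (1 : quat a b) = 1.
Proof.
by change (quat_ext f (oneh a b) = oneh (f a) (f b));
  congr Quat; rewrite ?rmorph0 ?rmorph1.
Qed.

Lemma quat_extD (F K : comNzRingType) (f : {rmorphism F -> K}) (a b : F) :
  {morph quat_ext f (a := a) (b := b) : x y / x + y}.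
Proof.
move=> x y; change (quat_ext f (addh x y) = addh (quat_ext f x) (quat_ext f y)).
by congr Quat; rewrite /= rmorphD.
Qed.

Lemma quat_extM (F K : comNzRingType) (f : {rmorphism F -> K}) (a b : F) :
  {morph quat_ext f (a := a) (b := b) : x y / x * y}.
Proof.
move=> x y; change (quat_ext f (mulh x y) = mulh (quat_ext f x) (quat_ext f y)).
by congr Quat; rewrite /= ?(rmorphB, rmorphD, rmorphM).
Qed.

Section Orders.
Variables (a b : rat).
Local Notation Q := (quat a b).

Definition zspan (x1 x2 x3 x4 : Q) : set Q :=
  [set x | exists n1 n2 n3 n4 : int,
     x = x1 *~ n1 + x2 *~ n2 + x3 *~ n3 + x4 *~ n4].

Definition qfree (x1 x2 x3 x4 : Q) : Prop :=
  forall r1 r2 r3 r4 : rat,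
    r1 *: x1 + r2 *: x2 + r3 *: x3 + r4 *: x4 = 0 ->
    [/\ r1 = 0, r2 = 0, r3 = 0 & r4 = 0].

Definition is_Zorder (M : set Q) : Prop :=
  [/\ M 1,
      forall x y, M x -> M y -> M (x * y)
    & exists x1 x2 x3 x4, qfree x1 x2 x3 x4 /\ M = zspan x1 x2 x3 x4].

End Orders.

Definition Qalg (D : nat) := quat (-2 : rat) (D%:R : rat).

Section ListedOrders.
Variable D : nat.
Let i : Qalg D := qi _ _.
Let j : Qalg D := qj _ _.
Let half : rat := 2^-1.
Let quarter : rat := 4^-1.

Definition order1 : set (Qalg D) := zspan 1 i j (i * j).
Definition order2 : set (Qalg D) :=
  zspan 1 i (half *: (1 + j)) (half *: (i + i * j)).
Definition order3 : set (Qalg D) :=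
  zspan 1 i (quarter *: (i *+ 3 + j)) (quarter *: (2 + i * j)).
Definition order4 : set (Qalg D) :=
  zspan 1 i (quarter *: (i + j + i * j)) (quarter *: (2 + i *+ 2 + i * j)).
Definition order5 : set (Qalg D) :=
  zspan 1 i (half *: (i + j)) (half *: (i * j)).
Definition order6 : set (Qalg D) :=
  zspan 1 i (half *: (1 + j + i * j)) (half *: (i + i * j)).

Inductive listed_order : set (Qalg D) -> Prop :=
| Listed1 : listed_order order1
| Listed2 : D = 1 %[mod 4] -> listed_order order2
| Listed3 : D = 2 %[mod 16] -> listed_order order3
| Listed4 : D = 6 %[mod 16] -> listed_order order4
| Listed5 : D = 2 %[mod 4] -> listed_order order5
| Listed6 : D = 3 %[mod 4] -> listed_order order6.

End ListedOrders.

Record SL2 (K : fieldType) := MkSL2 { SLmx :> 'M[K]_2; _ : \det SLmx == 1 }.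

HB.instance Definition _ (K : fieldType) := [isSub for @SLmx K].
HB.instance Definition _ (K : fieldType) := [Choice of SL2 K by <:].

Section SpecialLinear.
Variable K : fieldType.
Implicit Types A B : SL2 K.

Lemma SL2_det A : \det A = 1. Proof. by case: A => A /= /eqP. Qed.
Lemma SL2_unit A : (A : 'M[K]_2) \in unitmx.
Proof. by rewrite unitmxE SL2_det unitr1. Qed.

Lemma SL2_one_subproof : \det (1%:M : 'M[K]_2) == 1. Proof. by rewrite det1. Qed.
Lemma SL2_mul_subproof A B : \det ((A : 'M[K]_2) *m B) == 1.
Proof. by rewrite det_mulmx !SL2_det mulr1. Qed.
Lemma SL2_inv_subproof A : \det (invmx (A : 'M[K]_2)) == 1.
Proof. by rewrite det_inv SL2_det invr1. Qed.

Definition SL2_one := MkSL2 SL2_one_subproof.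
Definition SL2_mul A B := MkSL2 (SL2_mul_subproof A B).
Definition SL2_inv A := MkSL2 (SL2_inv_subproof A).

Lemma SL2_mulA : associative SL2_mul.
Proof. by move=> A B C; apply: val_inj; rewrite /= mulmxA. Qed.
Lemma SL2_mul1g : left_id SL2_one SL2_mul.
Proof. by move=> A; apply: val_inj; rewrite /= mul1mx. Qed.
Lemma SL2_mulg1 : right_id SL2_one SL2_mul.
Proof. by move=> A; apply: val_inj; rewrite /= mulmx1. Qed.
Lemma SL2_mulVg : left_inverse SL2_one SL2_inv SL2_mul.
Proof. by move=> A; apply: val_inj; rewrite /= mulVmx ?SL2_unit. Qed.
Lemma SL2_mulgV : right_inverse SL2_one SL2_inv SL2_mul.
Proof. by move=> A; apply: val_inj; rewrite /= mulmxV ?SL2_unit. Qed.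

HB.instance Definition _ := isGroup.Build (SL2 K)
  SL2_mulA SL2_mul1g SL2_mulg1 SL2_mulVg SL2_mulgV.

Definition eq_pm A B : bool :=
  (SLmx A == SLmx B) || (SLmx A == - SLmx B).

Lemma eq_pm_refl : reflexive eq_pm.
Proof. by move=> A; rewrite /eq_pm eqxx. Qed.
Lemma eq_pm_sym : symmetric eq_pm.
Proof.
by move=> A B; rewrite /eq_pm eq_sym [X in _ || X]eq_sym eqr_oppLR.
Qed.
Lemma eq_pm_trans : transitive eq_pm.
Proof.
move=> B A C; rewrite /eq_pm.
by case/orP=> /eqP->; case/orP=> /eqP->; rewrite ?opprK eqxx ?orbT.
Qed.

Canonical eq_pm_equiv := EquivRel eq_pm eq_pm_refl eq_pm_sym eq_pm_trans.

End SpecialLinear.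

Definition PSL2 (K : fieldType) := {eq_quot (@eq_pm_equiv K)}%qT.

HB.instance Definition _ (K : fieldType) := Choice.on (PSL2 K).
HB.instance Definition _ (K : fieldType) := EqQuotient.on (PSL2 K).

Section ProjectiveSpecialLinear.
Variable K : fieldType.
Local Open Scope quotient_scope.
Implicit Types (A B : SL2 K) (g h : PSL2 K).

Definition pcl A : PSL2 K := \pi_(PSL2 K) A.

Lemma pcl_eq A B : pcl A = pcl B <-> eq_pm A B.
Proof. by split=> [/eqmodP//|AB]; apply/eqmodP. Qed.

Lemma pcl_repr g : pcl (repr g) = g. Proof. exact: reprK. Qed.

Lemma repr_pcl A : eq_pm (repr (pcl A)) A.
Proof. by apply/pcl_eq; rewrite pcl_repr. Qed.

Definition PSL2_one : PSL2 K := pcl 1%g.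
Definition PSL2_mul g h : PSL2 K := pcl (repr g * repr h)%g.
Definition PSL2_inv g : PSL2 K := pcl (repr g)^-1%g.

Lemma PSL2_mul_pcl A B : PSL2_mul (pcl A) (pcl B) = pcl (A * B)%g.
Proof.
apply/pcl_eq; rewrite /eq_pm /=.
case/orP: (repr_pcl A) => /eqP->; case/orP: (repr_pcl B) => /eqP->;
  by rewrite ?mulNmx ?mulmxN ?opprK eqxx ?orbT.
Qed.

Lemma invmxN (A : 'M[K]_2) : A \in unitmx -> invmx (- A) = - invmx A.
Proof. by move=> uA; rewrite -!scaleN1r invmxZ ?unitmxZ ?unitrN1 // invrN1. Qed.

Lemma PSL2_inv_pcl A : PSL2_inv (pcl A) = pcl A^-1%g.
Proof.
apply/pcl_eq; rewrite /eq_pm /=.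
by case/orP: (repr_pcl A) => /eqP->; rewrite ?invmxN ?SL2_unit // eqxx ?orbT.
Qed.

Lemma PSL2_mulA : associative PSL2_mul.
Proof.
move=> x y z; rewrite -(pcl_repr x) -(pcl_repr y) -(pcl_repr z).
by rewrite !PSL2_mul_pcl mulgA.
Qed.
Lemma PSL2_mul1g : left_id PSL2_one PSL2_mul.
Proof. by move=> x; rewrite -(pcl_repr x) PSL2_mul_pcl mul1g. Qed.
Lemma PSL2_mulg1 : right_id PSL2_one PSL2_mul.
Proof. by move=> x; rewrite -(pcl_repr x) PSL2_mul_pcl mulg1. Qed.
Lemma PSL2_mulVg : left_inverse PSL2_one PSL2_inv PSL2_mul.
Proof. by move=> x; rewrite -(pcl_repr x) PSL2_inv_pcl PSL2_mul_pcl mulVg. Qed.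
Lemma PSL2_mulgV : right_inverse PSL2_one PSL2_inv PSL2_mul.
Proof. by move=> x; rewrite -(pcl_repr x) PSL2_inv_pcl PSL2_mul_pcl mulgV. Qed.

HB.instance Definition _ := isGroup.Build (PSL2 K)
  PSL2_mulA PSL2_mul1g PSL2_mulg1 PSL2_mulVg PSL2_mulgV.

End ProjectiveSpecialLinear.

Definition is_subgroup (gT : groupType) (G : set gT) : Prop :=
  G 1%g /\ forall x y, G x -> G y -> G (x / y)%g.

Section Hyperbolic.
Variable R : realType.
Local Notation C := (R[i]).
Local Open Scope complex_scope.

(* None is the point at infinity; C^o carries the norm topology of C. *)
Definition sphere := one_point_compactification C^o.

Definition mobius (A : 'M[C]_2) (p : sphere) : sphere :=
  match p with
  | Some z => if A 1 0 * z + A 1 1 == 0 then None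
              else Some ((A 0 0 * z + A 0 1) / (A 1 0 * z + A 1 1))
  | None => if A 1 0 == 0 then None else Some (A 0 0 / A 1 0)
  end.

Definition act (g : PSL2 C) : sphere -> sphere := mobius (repr g).

Definition sqnorm (z : C) : R := complex.Re z ^+ 2 + complex.Im z ^+ 2.

(* Poincare extension to the upper half-space of the pairs (z, t), t > 0. *)
Definition poincare (A : 'M[C]_2) (p : C * R) : C * R :=
  let: (z, t) := p in
  let n := sqnorm (A 1 0 * z + A 1 1) + sqnorm (A 1 0) * t ^+ 2 in
  (((A 0 0 * z + A 0 1) * Num.conj (A 1 0 * z + A 1 1)
      + A 0 0 * Num.conj (A 1 0) * (t ^+ 2)%:C) / n%:C,
   t / n).

Definition act_H3 (g : PSL2 C) : C * R -> C * R := poincare (repr g).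

Lemma act_pcl (A : SL2 C) : act (pcl A) = mobius A.
Proof.
rewrite /act funeqE => p; case/orP: (repr_pcl A) => /eqP-> //.
case: p => [z|] /=; rewrite !mxE ?mulNr -?opprD ?oppr_eq0 ?invrN ?mulrNN //.
by rewrite mulrN opprK.
Qed.

Lemma act_H3_pcl (A : SL2 C) : act_H3 (pcl A) = poincare A.
Proof.
have sqnormN z : sqnorm (- z) = sqnorm z.
  by case: z => x y; rewrite /sqnorm /= !sqrrN.
rewrite /act_H3 funeqE => -[z t]; case/orP: (repr_pcl A) => /eqP-> //=.
rewrite !mxE ?mulNr -?opprD !sqnormN.
have conjN (w : C) : Num.conj (- w) = - Num.conj w by exact: rmorphN.
by rewrite !conjN mulrNN mulrN mulNr opprK.
Qed.

(* Finite orbits are allowed both on the boundary sphere and inside H^3. *)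
Definition elementary (G : set (PSL2 C)) : Prop :=
  (exists p : sphere, finite_set [set act g p | g in G]) \/
  (exists2 p : C * R, 0 < p.2 & finite_set [set act_H3 g p | g in G]).

Definition is_circle (S : set sphere) : Prop :=
  (exists (z0 : C) (r : R), 0 < r /\
     S = [set p | exists2 z : C, `|z - z0| = r%:C & p = Some z]) \/
  (exists z0 v : C, v != 0 /\
     S = [set p | p = None \/ exists t : R, p = Some (z0 + t%:C * v)]).

Definition is_component (U K : set sphere) : Prop :=
  exists2 p, U p & K = connected_component U p.

Definition preserves_circle (G : set (PSL2 C)) (S : set sphere) : Prop :=
  forall g, G g ->
    [set act g p | p in S] = S /\
    forall K, is_component (~` S) K -> [set act g p | p in K] = K.

Definition sqrtm2 : C := (Num.sqrt 2)*i.

Definition zsqrtm2 (m n : int) : C := m%:~R + n%:~R * sqrtm2.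

Definition Bianchi2 : set (PSL2 C) :=
  [set g | exists2 A : SL2 C, g = pcl A &
     forall k l, exists m n : int, A k l = zsqrtm2 m n].

Definition Fuchsian (Gamma G : set (PSL2 C)) : Prop :=
  [/\ is_subgroup G, G `<=` Gamma &
      exists2 S, is_circle S & preserves_circle G S].

Definition F_subgroup (Gamma G : set (PSL2 C)) : Prop :=
  [/\ Fuchsian Gamma G, ~ elementary G &
      forall G', Fuchsian Gamma G' -> ~ elementary G' -> G `<=` G' -> G' = G].

(* None lies on the locus exactly when the circle is a line. *)
Definition circle_locus (A : int) (B : C) (E : int) : set sphere :=
  [set p | match p with
           | Some z => A%:~R * (z * Num.conj z) + B * Num.conj z + Num.conj B * z
                         + E%:~R = 0
           | None => A = 0
           end].

Definition circle_disc (S : set sphere) (D : int) : Prop :=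
  exists A b1 b2 E : int,
    [/\ gcdz (gcdz (gcdz A b1) b2) E = 1,
        S = circle_locus A (zsqrtm2 b1 b2) E &
        D = b1 ^+ 2 + 2 * b2 ^+ 2 - A * E].

Definition F_disc (G : set (PSL2 C)) (D : int) : Prop :=
  exists S, [/\ is_circle S, preserves_circle G S & circle_disc S D].

Definition conj_in (Gamma G G' : set (PSL2 C)) : Prop :=
  exists2 g, Gamma g & G' = [set conjg x g | x in G].

(* Q tensored with C, see quat_ext. *)
Definition QalgC (D : nat) :=
  quat (ratr (-2 : rat) : C) (ratr (D%:R : rat)).

Definition Qalg_ext (D : nat) : Qalg D -> QalgC D :=
  quat_ext (@ratr C) (a := -2) (b := D%:R).

(* The image of M^1 in PSL(2, C), where rho has determinant nrd. *)
Definition norm1_group (D : nat) (M : set (Qalg D))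
    (rho : QalgC D -> 'M[C]_2) : set (PSL2 C) :=
  [set g | exists (x : Qalg D) (A : SL2 C),
     [/\ M x, nrd x = 1, SLmx A = rho (Qalg_ext x) & g = pcl A]].

Definition represented_by (D : nat) (F : set (PSL2 C)) (M : set (Qalg D)) :
    Prop :=
  exists rho : {lrmorphism QalgC D -> 'M[C]_2},
    bijective rho /\ conj_in Bianchi2 F (norm1_group M rho).

End Hyperbolic.

(* Main.v *)
(* Write O for Z[sqrt(-2)].  A circle of discriminant D is the null locus of a
   primitive binary Hermitian form H = [A, B, C] over O with |B|^2 - AC = D,
   unique up to sign, and the subgroup preserving the circle and its two sides
   is the image of {g in SL2(O) : g^* H g = H}.  For a form [a, b, c] with
   (a, b) one of (1, 0), (2, 1), (4, -s), (4, 2 - s), (2, s), (2, 1 + s), where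
   s = sqrt(-2), this is the norm one group of the listed order
   {m + b conj(y)/a + (y/a) j : m, y in O}.

   Every primitive form is SL2(O)-equivalent, up to the signs of H and a, to
   such a form.  A change of basis gives H = [an, B, C] with n prime to 2D.
   Legendre's descent yields an isotropic vector of H + <-a>, which is corrected
   at the primes dividing 2D and then made primitive, so that H takes
   primitively a value a|z|^2 with z prime to 2D.  The factor |z|^2 is removed
   one prime p = |pi|^2 at a time: in place of strong approximation, an element
   of norm p of the order is multiplied by units t + s y j, where
   t^2 - D|y|^2 s^2 = 1, so that it maps a given vector into p O^2.

   The same Pell units, for two y independent over R and with s unbounded, show
   that the groups are not elementary and that no other circle is preserved,
   hence that they are maximal. *)

From HB Require Import structures.
Require Import Defs.
From mathcomp Require Import all_boot all_order all_algebra.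
From mathcomp Require Import all_classical all_reals all_analysis.
From mathcomp Require Import complex zify ring lra.

Set Implicit Arguments.
Unset Strict Implicit.
Unset Printing Implicit Defensive.

Import Order.TTheory GRing.Theory Num.Theory.
Import numFieldNormedType.Exports.
Local Open Scope ring_scope.

(** * The ring Z[sqrt(-2)] *)

(** The number a is the highest power of 2 dividing all values of H, and primitivity bounds it by 4.
    The odd cofactor n has to be a 2-adic norm, that is, congruent to 1 or 3 modulo 8, and this
    decides between H and - H. The descent meets no congruence obstruction because every residue
    modulo a prime is a norm. All six orders are treated at once through two divisibilities: a
    divides the last coefficient of the form, and kp = 2 sqrt(-2) b / a lies in O. The second makes
    the matrix of an element w + y j integral; together they make the set of all m + b conj(y)/a +
    (y/a) j closed under products. Once the leading coefficient is a, translation leaves only B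
    modulo a, and passing to - H turns - b into b at the price of replacing a by - a. If D is a
    square, t^2 - D s^2 = 1 has only trivial solutions; since 2 D is then not a square, the units
    are taken with y a multiple of sqrt(-2). *)

Record zs := ZS { zre : int; zim : int }.

Definition zs_pair (x : zs) := (zre x, zim x).
Definition pair_zs (t : int * int) := ZS t.1 t.2.
Lemma zs_pairK : cancel zs_pair pair_zs. Proof. by case. Qed.

HB.instance Definition _ := Choice.copy zs (can_type zs_pairK).

Lemma zs_eqP (x y : zs) : zre x = zre y -> zim x = zim y -> x = y.
Proof. by case: x y => [a b] [c d] /= -> ->. Qed.

Definition zs_add x y := ZS (zre x + zre y) (zim x + zim y).
Definition zs_opp x := ZS (- zre x) (- zim x).
Definition zs_mul x y :=
  ZS (zre x * zre y - 2 * (zim x * zim y)) (zre x * zim y + zim x * zre y).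

Local Ltac zs_ring := apply: zs_eqP => /=; ring.

Lemma zs_addA : associative zs_add. Proof. by move=> x y z; zs_ring. Qed.
Lemma zs_addC : commutative zs_add. Proof. by move=> x y; zs_ring. Qed.
Lemma zs_add0 : left_id (ZS 0 0) zs_add. Proof. by move=> x; zs_ring. Qed.
Lemma zs_addN : left_inverse (ZS 0 0) zs_opp zs_add.
Proof. by move=> x; zs_ring. Qed.

HB.instance Definition _ := GRing.isZmodule.Build zs zs_addA zs_addC zs_add0 zs_addN.

Lemma zs_mulA : associative zs_mul. Proof. by move=> x y z; zs_ring. Qed.
Lemma zs_mulC : commutative zs_mul. Proof. by move=> x y; zs_ring. Qed.
Lemma zs_mul1 : left_id (ZS 1 0) zs_mul. Proof. by move=> x; zs_ring. Qed.
Lemma zs_mulDl : left_distributive zs_mul zs_add.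
Proof. by move=> x y z; zs_ring. Qed.
Lemma zs_oner_neq0 : ZS 1 0 != ZS 0 0. Proof. by []. Qed.

HB.instance Definition _ := GRing.Zmodule_isComNzRing.Build zs
  zs_mulA zs_mulC zs_mul1 zs_mulDl zs_oner_neq0.

Lemma zreD x y : zre (x + y) = zre x + zre y. Proof. by []. Qed.
Lemma zimD x y : zim (x + y) = zim x + zim y. Proof. by []. Qed.
Lemma zreN x : zre (- x) = - zre x. Proof. by []. Qed.
Lemma zimN x : zim (- x) = - zim x. Proof. by []. Qed.
Lemma zreM x y : zre (x * y) = zre x * zre y - 2 * (zim x * zim y).
Proof. by []. Qed.
Lemma zimM x y : zim (x * y) = zre x * zim y + zim x * zre y.
Proof. by []. Qed.
Lemma zsnat n : n%:R = ZS n%:Z 0 :> zs.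
Proof. by elim: n => // n IH; rewrite mulrS IH; apply: zs_eqP => /=; lia. Qed.
Lemma zsint (n : int) : n%:~R = ZS n 0 :> zs.
Proof.
case: n => n; first exact: zsnat.
by rewrite NegzE mulrNz -pmulrn zsnat; apply: zs_eqP.
Qed.
Lemma zreZ (n : int) : zre n%:~R = n. Proof. by rewrite zsint. Qed.
Lemma zimZ (n : int) : zim n%:~R = 0. Proof. by rewrite zsint. Qed.
Lemma zre0 : zre 0 = 0. Proof. by []. Qed.
Lemma zim0 : zim 0 = 0. Proof. by []. Qed.
Lemma zre1 : zre 1 = 1. Proof. by []. Qed.
Lemma zim1 : zim 1 = 0. Proof. by []. Qed.

Lemma zs_intr_inj (m n : int) : m%:~R = n%:~R :> zs -> m = n.
Proof. by rewrite !zsint => -[]. Qed.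

Definition cz (x : zs) := ZS (zre x) (- zim x).
Lemma cz_is_zmod_morphism : zmod_morphism cz.
Proof. by move=> x y; apply: zs_eqP => /=; ring. Qed.
Lemma cz_is_monoid_morphism : monoid_morphism cz.
Proof. by split=> [|x y]; apply: zs_eqP => /=; ring. Qed.
HB.instance Definition _ := GRing.isZmodMorphism.Build zs zs cz cz_is_zmod_morphism.
HB.instance Definition _ := GRing.isMonoidMorphism.Build zs zs cz cz_is_monoid_morphism.

Lemma czK : involutive cz.
Proof. by move=> x; apply: zs_eqP => //=; rewrite opprK. Qed.
Lemma cz_int (n : int) : cz n%:~R = n%:~R. Proof. exact: rmorph_int. Qed.
Lemma zre_cz x : zre (cz x) = zre x. Proof. by []. Qed.
Lemma zim_cz x : zim (cz x) = - zim x. Proof. by []. Qed.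

Definition sqm2 : zs := ZS 0 1.
Lemma sqm2_sqr : sqm2 * sqm2 = -2. Proof. by apply: zs_eqP. Qed.
Lemma cz_sqm2 : cz sqm2 = - sqm2. Proof. by apply: zs_eqP. Qed.
Lemma zre_sqm2 : zre sqm2 = 0. Proof. by []. Qed.
Lemma zim_sqm2 : zim sqm2 = 1. Proof. by []. Qed.

Definition zsE := (zreD, zimD, zreN, zimN, zreM, zimM, zreZ, zimZ, zre0, zim0,
  zre1, zim1, zre_cz, zim_cz, zre_sqm2, zim_sqm2).

Lemma zs_decomp x : x = (zre x)%:~R + (zim x)%:~R * sqm2.
Proof. by apply: zs_eqP; rewrite !zsE /=; ring. Qed.

Definition nz (x : zs) : int := zre x ^+ 2 + 2 * zim x ^+ 2.

Lemma nzE x : (nz x)%:~R = x * cz x.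
Proof. by apply: zs_eqP; rewrite !zsE /nz /=; ring. Qed.
Lemma nzM x y : nz (x * y) = nz x * nz y.
Proof. by rewrite /nz !zsE; ring. Qed.
Lemma nz_cz x : nz (cz x) = nz x.
Proof. by rewrite /nz !zsE; ring. Qed.
Lemma nz_int n : nz n%:~R = n ^+ 2. Proof. by rewrite /nz !zsE; ring. Qed.
Lemma nzN x : nz (- x) = nz x. Proof. by rewrite /nz !zsE; ring. Qed.
Lemma nz_sqm2 : nz sqm2 = 2. Proof. by []. Qed.
Lemma nz1 : nz 1 = 1. Proof. by []. Qed.
Lemma nz0 : nz 0 = 0. Proof. by []. Qed.
Lemma nz_ge0 x : 0 <= nz x. Proof. by rewrite /nz; nia. Qed.
Lemma nz_eq0 x : (nz x == 0) = (x == 0).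
Proof.
apply/eqP/eqP => [|->//]; rewrite /nz => h.
by apply: zs_eqP => /=; nia.
Qed.
Lemma nz_gt0 x : x != 0 -> 0 < nz x.
Proof. by move=> x0; rewrite lt_def nz_ge0 nz_eq0 x0. Qed.
Lemma zs_mulf_eq0 (x y : zs) : (x * y == 0) = (x == 0) || (y == 0).
Proof. by rewrite -!nz_eq0 nzM mulf_eq0. Qed.
Lemma zs_mulfI (x : zs) : x != 0 -> injective ( *%R x).
Proof.
move=> x0 y z /eqP; rewrite -subr_eq0 -mulrBr zs_mulf_eq0 (negbTE x0) /=.
by rewrite subr_eq0 => /eqP.
Qed.
Lemma zs_intr_eq0 (n : int) : (n%:~R == 0 :> zs) = (n == 0).
Proof. by rewrite -nz_eq0 nz_int sqrf_eq0. Qed.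

(** * Divisibility and Bezout relations *)

Definition zdvd (x y : zs) := exists k, y = k * x.

Lemma zdvd_refl x : zdvd x x. Proof. by exists 1; rewrite mul1r. Qed.
Lemma zdvdD x y z : zdvd x y -> zdvd x z -> zdvd x (y + z).
Proof. by move=> [k ->] [l ->]; exists (k + l); rewrite mulrDl. Qed.
Lemma zdvdN x y : zdvd x y -> zdvd x (- y).
Proof. by move=> [k ->]; exists (- k); rewrite mulNr. Qed.
Lemma zdvdB x y z : zdvd x y -> zdvd x z -> zdvd x (y - z).
Proof. by move=> xy xz; apply: zdvdD xy (zdvdN xz). Qed.
Lemma zdvd_mull x y z : zdvd x y -> zdvd x (z * y).
Proof. by move=> [k ->]; exists (z * k); rewrite mulrA. Qed.
Lemma zdvd_mulr x y z : zdvd x y -> zdvd x (y * z).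
Proof. by rewrite mulrC; apply: zdvd_mull. Qed.
Lemma zdvd_trans y x z : zdvd x y -> zdvd y z -> zdvd x z.
Proof. by move=> [k ->] [l ->]; exists (l * k); rewrite mulrA. Qed.
Lemma zdvd_cz x y : zdvd x y -> zdvd (cz x) (cz y).
Proof. by move=> [k ->]; exists (cz k); rewrite rmorphM. Qed.
Lemma zdvd_nz x y : zdvd x y -> (nz x %| nz y)%Z.
Proof. by move=> [k ->]; rewrite nzM; apply: dvdz_mull. Qed.
Lemma zdvd_intP (n : int) x :
  zdvd n%:~R x <-> (n %| zre x)%Z /\ (n %| zim x)%Z.
Proof.
split=> [[k ->]|[/dvdzP[u hu] /dvdzP[v hv]]].
  rewrite !zsE; split; apply/dvdzP; [exists (zre k)|exists (zim k)]; ring.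
by exists (ZS u v); apply: zs_eqP; rewrite !zsE /= ?hu ?hv; ring.
Qed.
Lemma zdvd_int (m n : int) : (m %| n)%Z -> zdvd m%:~R n%:~R.
Proof. by move=> /dvdzP[k ->]; exists k%:~R; rewrite intrM. Qed.

(** Rounding both coordinates of x/y to the nearest integer leaves an error of norm at most 1/4 +
    2/4, so the ring is Euclidean. *)
Lemma zs_edivn (x y : zs) : y != 0 -> exists q, 4 * nz (x - q * y) <= 3 * nz y.
Proof.
move=> y0; have n0 : 0 < nz y by exact: nz_gt0.
pose w := x * cz y.
have round (u : int) : exists q, - nz y <= 2 * (u - q * nz y) <= nz y.
  exists ((2 * u + nz y) %/ (2 * nz y))%Z.
  have h := divz_eq (2 * u + nz y) (2 * nz y).
  have h1 : (0 <= (2 * u + nz y) %% (2 * nz y))%Z by apply: modz_ge0; lia.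
  have h2 : ((2 * u + nz y) %% (2 * nz y) < 2 * nz y)%Z by apply: ltz_pmod; lia.
  set q := ((2 * u + nz y) %/ (2 * nz y))%Z in h *.
  move: h h1 h2; set r := modz _ _ => h h1 h2; apply/andP; split; lia.
have [q1 h1] := round (zre w); have [q2 h2] := round (zim w).
exists (ZS q1 q2).
have e : nz (x - ZS q1 q2 * y) * nz y =
    (zre w - q1 * nz y) ^+ 2 + 2 * (zim w - q2 * nz y) ^+ 2.
  rewrite -[X in _ * X]nz_cz -nzM mulrBl -mulrA -nzE -/w /nz !zsE /=; ring.
rewrite -(ler_pM2r n0) -mulrA e; nia.
Qed.

Lemma zs_bezout (x y : zs) : exists g u v x' y',
  [/\ g = u * x + v * y, x = x' * g & y = y' * g].
Proof.
move: {2}(absz (nz y)).+1 (ltnSn (absz (nz y))) => m.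
elim: m x y => // m IH x y le_m.
have [->|y0] := eqVneq y 0; first by exists x, 1, 0, 1, 0; split; ring.
have [q hq] := zs_edivn x y0.
have hn := nz_gt0 y0; have hr := nz_ge0 (x - q * y).
case: (IH y (x - q * y)); first lia.
move=> g [u [v [x' [y' [hg hx hy]]]]].
exists g, v, (u - v * q), (y' + q * x'), x'; split=> //.
  by rewrite hg; ring.
have -> : x = (x - q * y) + q * y by ring.
by rewrite hy {1}hx; ring.
Qed.

Definition zcoprime (x y : zs) := exists u v, u * x + v * y = 1.

Lemma zcoprime_dvd x y z : zcoprime x y -> zdvd x (y * z) -> zdvd x z.
Proof.
move=> [u [v h]] [k hk]; exists (u * z + v * k).
have e : z = u * z * x + v * (y * z) by rewrite -[LHS]mul1r -h; ring.
by rewrite {1}e hk; ring.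
Qed.

Lemma nz_eq1_unit x : nz x = 1 -> x * cz x = 1.
Proof. by move=> h; rewrite -nzE h. Qed.

Lemma zcoprime_gcd1 x y g u v : g = u * x + v * y -> nz g = 1 -> zcoprime x y.
Proof.
move=> -> /nz_eq1_unit h; exists (cz (u * x + v * y) * u), (cz (u * x + v * y) * v).
by rewrite -h; ring.
Qed.

(** The gcd of x and y has norm dividing the prime nz x: norm 1 makes the two coprime, norm nz x
    makes the gcd an associate of x. *)
Lemma zs_prime_or (x y : zs) : prime (absz (nz x)) -> zdvd x y \/ zcoprime x y.
Proof.
move=> px; have [g [u [v [x' [y' [hg hx hy]]]]]] := zs_bezout x y.
have hn : nz x = nz x' * nz g by rewrite -nzM -hx.
have : (absz (nz g) %| absz (nz x))%N by rewrite hn abszM dvdn_mull.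
case/primeP: (px) => _ H /H{H} /orP[/eqP h|/eqP h].
  by right; apply: (zcoprime_gcd1 hg); have := nz_ge0 g; lia.
left; have x0 : (0 < absz (nz x))%N by exact: prime_gt0.
have h1 : nz x' = 1.
  have := nz_ge0 x'; have := nz_ge0 g; move: hn h x0; nia.
have e := nz_eq1_unit h1.
have -> : y = y' * cz x' * (x' * g) by rewrite hy -[g in LHS]mul1r -e; ring.
by exists (y' * cz x'); rewrite -hx.
Qed.

Lemma zs_primeM (x y z : zs) : prime (absz (nz x)) -> zdvd x (y * z) ->
  zdvd x y \/ zdvd x z.
Proof.
move=> px h; have [|cp] := zs_prime_or y px; first by left.
by right; apply: zcoprime_dvd cp h.
Qed.

Lemma zdvd_intN (x : zs) (n : int) : prime (absz (nz x)) -> zdvd x n%:~R ->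
  (nz x %| n)%Z.
Proof.
by move=> px /zdvd_nz; rewrite nz_int dvdzE abszX Euclid_dvdX //= andbT dvdzE.
Qed.

(** * Elementary number theory *)

(** Chinese remaindering for properties instead of congruences: each [P r] is only assumed invariant
    under translation by multiples of r^K. An arbitrary abelian group V lets several coordinates be
    chosen at once. *)
Lemma crt_choose (V : zmodType) (K N : nat) (P : nat -> V -> Prop) :
  (0 < N)%N ->
  (forall r, prime r -> (r %| N)%N -> exists x, P r x) ->
  (forall r x w, P r x -> P r (x + w *~ (r ^ K)%N)) ->
  exists x, forall r, prime r -> (r %| N)%N -> P r x.
Proof.
move=> N0 ex per.
suff [x hx] : exists x, forall r, r \in primes N -> P r x.
  by exists x => r pr rN; apply: hx; rewrite mem_primes pr N0 rN.
have {ex} : forall r, r \in primes N -> prime r /\ exists x, P r x.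
  by move=> r; rewrite mem_primes => /and3P[pr _ rN]; split=> //; apply: ex.
elim: (primes N) (primes_uniq N) => [|p s IH] /=; first by exists 0.
case/andP=> pNs us ex.
have [x0 hx0] : exists x, forall r, r \in s -> P r x.
  by apply: IH => // r rs; apply: ex; rewrite inE rs orbT.
have [pp [y hy]] := ex p (mem_head _ _).
pose M := (\prod_(r <- s) r ^ K)%N.
have cop : coprime (p ^ K) M.
  rewrite coprimeXl // /M coprime_sym.
  have : forall r, r \in s -> prime r.
    by move=> r rs; case: (ex r); rewrite // inE rs orbT.
  elim: (s) pNs => [|r t IHt] /=; first by rewrite big_nil coprime1n.
  rewrite inE negb_or => /andP[pr pt] prs; rewrite big_cons coprimeMl.
  rewrite coprimeXl ?IHt //.
    by move=> q qt; apply: prs; rewrite inE qt orbT.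
  by rewrite prime_coprime ?prs ?mem_head // dvdn_prime2 // ?prs ?mem_head // eq_sym.
have [u [v huv]] := Bezoutz (p ^ K)%N M.
have huv1 : u * (p ^ K)%N + v * M = 1.
  by rewrite huv /gcdz /=; move: cop; rewrite /coprime => /eqP ->.
(* As v M is 1 modulo p^K and 0 modulo the other r^K, this point agrees with y at p and with x0 at
   the primes already treated. *)
exists (x0 + (y - x0) *~ (v * M)) => r; rewrite inE => /orP[/eqP->|rs].
  have -> : v * M = 1 - u * (p ^ K)%N by rewrite -huv1 addrAC subrr add0r.
  have -> : x0 + (y - x0) *~ (1 - u * (p ^ K)%N) =
            y + (- ((y - x0) *~ u)) *~ (p ^ K)%N.
    by rewrite mulrzBr mulr1z mulNrz mulrzA addrA subrKC.
  exact: per.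
have /dvdnP[k hk] : (r ^ K %| M)%N.
  by rewrite /M (big_rem r rs) /= dvdn_mulr.
have -> : (y - x0) *~ (v * M) = ((y - x0) *~ (v * k)) *~ (r ^ K)%N.
  by rewrite hk PoszM mulrA mulrzA.
by apply: per; apply: hx0.
Qed.

Lemma dvdz_add (d m n : int) : (d %| m)%Z -> (d %| n)%Z -> (d %| m + n)%Z.
Proof. by move=> /dvdzP[k ->] /dvdzP[l ->]; rewrite -mulrDl dvdz_mull. Qed.
Lemma dvdz_opp (d m : int) : (d %| m)%Z -> (d %| - m)%Z.
Proof. by rewrite !dvdzE abszN. Qed.
Lemma dvdz_sub (d m n : int) : (d %| m)%Z -> (d %| n)%Z -> (d %| m - n)%Z.
Proof. by move=> h1 h2; apply: dvdz_add h1 (dvdz_opp h2). Qed.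
Lemma Euclid_dvdz (p : nat) (m n : int) : prime p ->
  (p %| m * n)%Z = (p %| m)%Z || (p %| n)%Z.
Proof. by move=> pp; rewrite !dvdzE abszM Euclid_dvdM. Qed.

Lemma dvdz_Fp (q : nat) (z : int) : prime q -> (q %| z)%Z = (z%:~R == 0 :> 'F_q).
Proof. by move=> pq; rewrite (dvdz_pcharf (pchar_Fp pq)). Qed.

Lemma dvdz_small (q z : int) : (q %| z)%Z -> `|z| < q -> z = 0.
Proof.
move=> /dvdzP[k ->] h; have [->|k0] := eqVneq k 0; first by rewrite mul0r.
have : 1 <= `|k| by lia.
move: h; rewrite normrM; nia.
Qed.

(** For odd q, the (q + 1)/2 squares of F_q and the (q + 1)/2 values c - 2 y^2 must meet. *)
Lemma nz_mod_prime (q : nat) (c : int) : prime q ->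
  exists x : zs, (q %| nz x - c)%Z.
Proof.
move=> pq; case: (even_prime pq) => [->|oq].
  exists (ZS (c %% 2)%Z 0); rewrite /nz /=.
  have := divz_eq c 2; have := modz_ge0 c (_ : 2 != 0 :> int).
  have := ltz_pmod c (_ : 0 < 2 :> int); move: (modz c 2) (divz c 2) => r k.
  move=> /(_ isT) h1 /(_ isT) h2 ->; apply/dvdzP; have [->|->] : r = 0 \/ r = 1 by lia.
    by exists (- k); ring.
  by exists (- k); ring.
have q3 : (2 < q)%N by case: q pq oq => [|[|[|]]].
pose m := q./2.+1.
pose f (x : 'I_m) : 'F_q := x%:R ^+ 2.
pose g (x : 'I_m) : 'F_q := c%:~R - 2 * x%:R ^+ 2.
have sq_inj (x y : 'I_m) : x%:R ^+ 2 = y%:R ^+ 2 :> 'F_q -> x = y.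
  move=> /eqP; rewrite eqf_sqr => /orP[]; rewrite -subr_eq0 ?opprK => e.
    have : (q %| x%:Z - y%:Z)%Z by rewrite (dvdz_Fp _ pq) intrB.
    have := ltn_ord x; have := ltn_ord y; rewrite /m; move: q3.
    have := odd_double_half q; rewrite oq => h0 h1 h2 h3 /dvdz_small h.
    by apply: val_inj => /=; lia.
  have : (q %| x%:Z + y%:Z)%Z by rewrite (dvdz_Fp _ pq) intrD.
  have := ltn_ord x; have := ltn_ord y; rewrite /m; move: q3.
  have := odd_double_half q; rewrite oq => h0 h1 h2 h3 /dvdz_small h.
  by apply: val_inj => /=; lia.
have two0 : (2 : 'F_q) != 0.
  rewrite -[2]/((2%:Z)%:~R) -dvdz_Fp //.
  by apply/negP => /dvdz_small; lia.
have [/existsP[x /existsP[y /eqP e]]|] := boolP [exists x, exists y, f x == g y].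
  exists (ZS x y); rewrite (dvdz_Fp _ pq) /nz /= intrB intrD intrM !rmorphXn /=.
  by move: e; rewrite /f /g => ->; apply/eqP; ring.
rewrite negb_exists => /forallP nex.
pose h (u : 'I_m + 'I_m) := match u with inl x => f x | inr y => g y end.
have hinj : injective h.
  case=> [x|x] [y|y] /= e.
  - by congr inl; apply: sq_inj.
  - by have := nex x; rewrite negb_exists => /forallP/(_ y); rewrite e eqxx.
  - by have := nex y; rewrite negb_exists => /forallP/(_ x); rewrite e eqxx.
  - congr inr; apply: sq_inj; apply: (mulfI two0); move: e; rewrite /g.
    by move/addrI/oppr_inj.
have := leq_card h hinj; rewrite card_sum !card_ord Fp_cast // /m.
have := odd_double_half q; rewrite oq; lia.
Qed.

Lemma nz_add_mul (x y : zs) (n : int) :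
  nz (x + y * n%:~R) = nz x + n * (2 * zre (cz x * y) + n * nz y).
Proof. by rewrite /nz !zsE; ring. Qed.

Lemma nz_shift (x y : zs) (n c : int) :
  nz (x + y * n%:~R) - c = nz x - c + n * (2 * zre (cz x * y) + n * nz y).
Proof. by rewrite nz_add_mul; ring. Qed.

Lemma zs_mulrz (x : zs) (n : int) : x *~ n = x * n%:~R.
Proof. by rewrite mulrzr. Qed.

Lemma squarefree_dvd (m x : nat) : (0 < m)%N ->
  (forall r, prime r -> ~~ (r ^ 2 %| m)%N) ->
  (forall r, prime r -> (r %| m)%N -> (r %| x)%N) -> (m %| x)%N.
Proof.
move=> m0 sf h; apply/dvdn_partP => // p; rewrite mem_primes => /and3P[pp _ pm].
rewrite p_part; have -> : logn p m = 1%N; last by rewrite expn1; apply: h.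
apply/eqP; rewrite eqn_leq -pfactor_dvdn // expn1 pm andbT leqNgt.
by rewrite -pfactor_dvdn // sf.
Qed.

(** A zero of a Hermitian form of rank 3 is sought, that is, of a quadratic form in six variables,
    so the signs are the only obstruction. The descent replaces the larger coefficient E by E' = (nz
    c - D)/E, where c is a reduced solution of nz c = D modulo E; for squarefree E such a c exists
    because every residue modulo a prime is a norm. *)
Lemma legendre (D E : int) : D != 0 -> E != 0 -> (0 < D) || (0 < E) ->
  exists X Y Z : zs, nz X = D * nz Y + E * nz Z /\ (Y != 0) || (Z != 0).
Proof.
move: {2}(absz D + absz E).+1 (ltnSn (absz D + absz E)) => m.
elim: m D E => // m IH D E.
wlog leDE : D E / (absz D <= absz E)%N.
  move=> H le D0 E0 pos; case: (leqP (absz D) (absz E)) => [h|/ltnW h].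
    exact: H.
  case: (H E D h) => //; first lia; first by rewrite orbC.
  by move=> X [Y [Z [e nt]]]; exists X, Z, Y; rewrite orbC addrC.
move=> le D0 E0 pos.
(* The descent yields |E'| <= 3|E|/4 + 1, which is less than |E| only when |E| > 4; the remaining
   positive coefficients 1, 2, 3, 4 are norms themselves. *)
have [le4|gt4] := leqP (absz E) 4.
  have norm4 (n : int) : 0 < n -> (absz n <= 4)%N -> exists x, nz x = n.
    move=> n0 n4; have [->|[->|[->|->]]] : n = 1 \/ n = 2 \/ n = 3 \/ n = 4 by lia.
    - by exists 1.
    - by exists sqm2.
    - by exists (1 + sqm2).
    - by exists 2.
  case/orP: pos => [pos|pos].
    have [||x hx] := norm4 D => //; first lia.
    by exists x, 1, 0; rewrite hx nz1 nz0 mulr1 mulr0 addr0.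
  have [||x hx] := norm4 E => //.
  by exists x, 0, 1; rewrite hx nz1 nz0 mulr1 mulr0 add0r orbT.
have [[r [pr /dvdnP[k hk]]]|sf] :
    (exists r, prime r /\ (r ^ 2 %| absz E)%N) \/
    (forall r, prime r -> ~~ (r ^ 2 %| absz E)%N).
- have [/hasP[r]|/hasPn nsf] := boolP (has (fun r => r ^ 2 %| absz E)%N (primes (absz E))).
    by rewrite mem_primes => /and3P[pr _ _] h; left; exists r.
  right=> r pr; apply/negP => h; have := nsf r; rewrite mem_primes pr h.
  by rewrite absz_gt0 E0 (dvdn_trans _ h) ?dvdn_mulr // => /(_ isT).
- have r1 := prime_gt1 pr.
  pose E' := sgz E * k%:Z; have hE : E = r%:Z ^+ 2 * E'.
    by rewrite /E' {1}(intEsg E) hk PoszM; move: (sgz E) => s; rewrite -mulnn PoszM; ring.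
  have k0 : (0 < k)%N by case: (posnP k) hk gt4 => // ->; rewrite mul0n => ->.
  case: (IH D E') => //.
  + have : (absz E' < absz E)%N by rewrite hE abszM abszX; nia.
    lia.
  + by apply: contraNneq E0 => e; rewrite hE e mulr0.
  + by move: pos; rewrite [in 0 < E]hE pmulr_rgt0 // exprn_gt0 //; lia.
  move=> X [Y [Z [e nt]]]; exists (r%:Z%:~R * X), (r%:Z%:~R * Y), Z; split.
    by rewrite !nzM e hE nz_int; ring.
  by rewrite zs_mulf_eq0 zs_intr_eq0 negb_or eqz_nat -lt0n (ltnW r1).
have [b hb] : exists b, (E %| nz b - D)%Z.
  have [|||b hb] := @crt_choose zs 1 (absz E) (fun r x => (r %| nz x - D)%Z).
  - by rewrite absz_gt0.
  - by move=> r pr _; apply: nz_mod_prime.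
  - move=> r x w; rewrite zs_mulrz expn1 nz_shift => h.
    by rewrite dvdz_add ?dvdz_mulr ?dvdzz.
  exists b; rewrite dvdzE; apply: squarefree_dvd => //; first by rewrite absz_gt0.
have E0' : E%:~R != 0 :> zs by rewrite zs_intr_eq0.
have [q hq] := zs_edivn b E0'.
pose c := b + (- q) * E%:~R.
have {hq} hc : 4 * nz c <= 3 * E ^+ 2.
  by move: hq; rewrite nz_int /c mulNr.
have /dvdzP[E' hE'] : (E %| nz c - D)%Z.
  by rewrite /c nz_shift dvdz_add ?dvdz_mulr ?dvdzz.
have {}hE' : nz c = D + E' * E by rewrite -hE'; ring.
have [E'0|E'0] := eqVneq E' 0.
  by exists c, 1, 0; split=> [|//]; rewrite hE' E'0 nz1 nz0; ring.
have nc := nz_ge0 c.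
case: (IH D E') => //.
- suff : (absz E')%:Z < (absz E)%:Z by lia.
  have absE : (absz E)%:Z ^+ 2 = E ^+ 2 by rewrite abszE real_normK ?num_real.
  have E4 : 4 < (absz E)%:Z by lia.
  have : `|E' * E| * 4 <= 3 * (absz E)%:Z ^+ 2 + 4 * (absz E)%:Z.
    rewrite absE; lia.
  rewrite normrM -!abszE; nia.
- move: pos; have [//|Dneg] := ltP 0 D; rewrite /= => Epos.
  have : D < 0 by rewrite lt_def eq_sym D0.
  nia.
move=> X [Y [Z [e nt]]].
have [Z0|Z0] := eqVneq Z 0.
  exists X, Y, 0; move: e nt; rewrite Z0 nz0 eqxx orbF => -> ->.
  by split=> //; ring.
exists (c * X + D%:~R * cz Y), (c * Y + cz X), (E'%:~R * Z); split; last first.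
  by rewrite zs_mulf_eq0 negb_or zs_intr_eq0 E'0 Z0 orbT.
(* Multiplicativity of the norm nz x - D nz y of the quaternion algebra, for the product (c + j)(X +
   Y j). *)
have e1 : nz (c * X + D%:~R * cz Y) =
    D * nz (c * Y + cz X) + (nz c - D) * (nz X - D * nz Y).
  by rewrite /nz !zsE; ring.
by rewrite e1 hE' e nzM nz_int; ring.
Qed.

(** * Pell's equation *)

Lemma inord_inj (n a b : nat) : (a <= n)%N -> (b <= n)%N ->
  inord a = inord b :> 'I_n.+1 -> a = b.
Proof. by move=> an bn /(congr1 val); rewrite /= !inordK. Qed.

Lemma pigeonhole_map (A : Type) (T : finType) (f : A -> T) (s : seq A) :
  (#|T| < size s)%N -> ~~ uniq (map f s).
Proof.
move=> h; apply/negP => /card_uniqP; rewrite size_map => e.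
by have := max_card (mem (map f s)); rewrite e leqNgt h.
Qed.

Section Pell.
Variables (R : archiRcfType) (E : nat).
Hypothesis E_nsq : forall k : nat, (k ^ 2)%N <> E.

Let al : R := Num.sqrt E%:R.

Let al2 : al ^+ 2 = E%:R. Proof. by rewrite sqr_sqrtr ?ler0n. Qed.

Let al_ge0 : 0 <= al. Proof. exact: sqrtr_ge0. Qed.

Let norm (p : int * int) : int := p.1 ^+ 2 - E%:Z * p.2 ^+ 2.
Let err (p : int * int) : R := `|p.1%:~R - p.2%:~R * al|.

Let norm_neq0 p : 0 < p.2 -> norm p != 0.
Proof.
case: p => x y /= y0; apply/negP; rewrite /norm /= subr_eq0 => /eqP e.
have : (y ^+ 2 %| x ^+ 2)%Z by rewrite e dvdz_mull.
rewrite dvdz_pexp2r // => /dvdzP[k hk].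
have {}e : y ^+ 2 * (k ^+ 2 - E%:Z) = 0 by rewrite mulrBr [_ * E%:Z]mulrC -e hk; ring.
move/eqP: e; rewrite mulf_eq0 expf_eq0 /= (gt_eqF y0) /= subr_eq0 => /eqP e.
by apply: (E_nsq (k := absz k)); apply/eqP; rewrite -eqz_nat -e -abszX; apply/eqP; nia.
Qed.

Let normE p : (norm p)%:~R = (p.1%:~R - p.2%:~R * al) * (p.1%:~R + p.2%:~R * al).
Proof. by rewrite /norm intrB intrM !rmorphXn /= -[_%:~R in X in _ - X * _]/(E%:R) -al2; ring. Qed.

Let err_gt0 p : 0 < p.2 -> 0 < err p.
Proof.
move=> p2; rewrite /err normr_gt0; apply: contraTneq (norm_neq0 p2) => e.
by rewrite negbK -(intr_eq0 R) normE e mul0r.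
Qed.

(** Dirichlet's box principle for the N + 1 fractional parts of s sqrt E, 0 <= s <= N. *)
Let approx (N : nat) : (0 < N)%N ->
  exists p : int * int, [/\ 0 < p.2, p.2 <= N%:Z & err p * N%:R < 1].
Proof.
move=> N0; pose fr (s : nat) : R := s%:R * al - (Num.floor (s%:R * al))%:~R.
have frP s : 0 <= fr s < 1.
  rewrite /fr subr_ge0 floor_le //= ltrBlDr -[1]/(1%:~R) -intrD addrC.
  exact: floorD1_gt.
have ex (s : 'I_N.+1) : (absz (Num.floor (fr s * N%:R)) < N)%N.
  have /andP[h0 h1] := frP s.
  have N0' : 0 < N%:R :> R by rewrite ltr0n.
  have f0 : 0 <= Num.floor (fr s * N%:R) by rewrite floor_ge0 mulr_ge0 ?ler0n.
  have : Num.floor (fr s * N%:R) < N%:Z.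
    rewrite floor_lt_int -[_%:~R]/(N%:R); nra.
  by lia.
pose f s := Ordinal (ex s).
have [/injectiveP inj|/injectivePn[s [t st fst]]] := boolP (injectiveb f).
  by have := leq_card f inj; rewrite !card_ord ltnn.
have main (u v : 'I_N.+1) : (u < v)%N -> f u = f v ->
    exists p : int * int, [/\ 0 < p.2, p.2 <= N%:Z & err p * N%:R < 1].
  move=> uv fuv; exists (Num.floor (v%:R * al) - Num.floor (u%:R * al), v%:Z - u%:Z).
  have := ltn_ord v => vN; split=> /=; [lia|lia|].
  have fl : Num.floor (fr u * N%:R) = Num.floor (fr v * N%:R).
    have h w : 0 <= Num.floor (fr w * N%:R).
      by rewrite floor_ge0 mulr_ge0 ?ler0n //; case/andP: (frP w).
    have := congr1 val fuv; rewrite /= => e; have := h u; have := h v; lia.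
  have : `|(fr v - fr u) * N%:R| < 1.
    have a1 := floor_le (fr u * N%:R); have a2 := floorD1_gt (fr u * N%:R).
    have a3 := floor_le (fr v * N%:R); have a4 := floorD1_gt (fr v * N%:R).
    rewrite fl in a1 a2; rewrite intrD in a2 a4.
    rewrite ltr_norml; apply/andP; split; lra.
  rewrite normrM [`|N%:R|]ger0_norm ?ler0n // /err /= distrC; congr (`|_| * _ < _).
  by rewrite /fr !intrB -![_%:~R in X in _ = _ - X]/(_%:R); ring.
case: (ltngtP s t) => [lt|lt|e]; [exact: (main s t)|exact: (main t s)|].
by move: st; rewrite (ord_inj e) eqxx.
Qed.

(** An approximation with err < 1 and err y <= 1 has |norm| <= err (err + 2 y sqrt E) <= 1 + 2 sqrt
    E <= 1 + 2 E. *)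
Let bound := (2 * E + 1)%N.

Let better (d : R) : 0 < d ->
  exists p : int * int, [/\ 0 < p.2, err p < d & (absz (norm p) <= bound)%N].
Proof.
move=> d0; pose N := (Num.truncn d^-1).+1.
have hN : d^-1 < N%:R by exact: truncnS_gt.
have [//|[x y] /= [y0 yN he]] := @approx N.
exists (x, y); split=> //=.
  have N0 : 0 < N%:R :> R by rewrite ltr0n.
  rewrite -(ltr_pM2r N0) (lt_trans he) // -ltr_pdivrMl // mulr1 //.
have N1 : 1 <= N%:R :> R by rewrite ler1n.
have yN' : y%:~R <= N%:R :> R by rewrite -[N%:R]/((N%:Z)%:~R) ler_int.
have y1 : 0 < y%:~R :> R by rewrite ltr0z.
have e1 : err (x, y) < 1.
  have := normr_ge0 (x%:~R - y%:~R * al); move: he; rewrite /err /=; nra.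
have alE : al <= E%:R.
  rewrite -al2; have := al2; case: (posnP E) => [E0|Epos] h.
    have -> : al = 0 by move/eqP: h; rewrite E0 expf_eq0 => /andP[_ /eqP].
    by rewrite expr0n.
  have : 1 <= al ^+ 2 by rewrite h ler1n.
  by nra.
have : `|(norm (x, y))%:~R| < (2 * E%:R + 1 + 1 : R).
  rewrite normE /= normrM.
  have h2 : `|x%:~R + y%:~R * al| <= err (x, y) + 2 * (y%:~R * al).
    have -> : x%:~R + y%:~R * al = (x%:~R - y%:~R * al) + 2 * (y%:~R * al) by ring.
    by rewrite (le_trans (ler_normD _ _)) // lerD2l ger0_norm // mulr_ge0 // mulr_ge0 // ltW.
  have e0 : 0 <= err (x, y) by exact: normr_ge0.
  have h3 : err (x, y) * y%:~R <= 1.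
    by rewrite (le_trans _ (ltW he)) // ler_wpM2l.
  rewrite -/(err (x, y)).
  apply: le_lt_trans (_ : err (x, y) * (err (x, y) + 2 * (y%:~R * al)) < _).
    by rewrite ler_wpM2l.
  have : err (x, y) * y%:~R * al <= E%:R.
    by rewrite (le_trans _ alE) // ler_piMl.
  have : err (x, y) * err (x, y) < 1 by nra.
  lra.
have -> : (2 * E%:R + 1 + 1 : R) = (bound.+1%:Z)%:~R.
  have -> : bound.+1 = (E + E + 1 + 1)%N by rewrite /bound; lia.
  by rewrite -[RHS]/((_ + _)%:R) !natrD; ring.
rewrite -intr_norm ltr_int; lia.
Qed.

Let decreasing n : exists s : seq (int * int),
  [/\ size s = n, {in s, forall p, 0 < p.2 /\ (absz (norm p) <= bound)%N}
    & sorted (fun p q => err p < err q) s].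
Proof.
elim: n => [|n [s [ss hs so]]]; first by exists [::].
have [d d0 hd] : exists2 d : R, 0 < d & forall p, d <= err (head p s) \/ s = [::].
  case: (s) hs => [|p t] hs; first by exists 1; [exact: ltr01|right].
  by exists (err p); [apply: err_gt0; case: (hs p (mem_head _ _))|left].
have [p [p2 pd pn]] := better d0.
exists (p :: s); split=> /=; first by rewrite ss.
  by move=> q; rewrite inE => /orP[/eqP->|/hs].
case: (s) so hd => //= q t -> /(_ p) [hd|//].
by rewrite (lt_le_trans pd hd).
Qed.

(** Two approximations with the same norm N and the same residues modulo N have a quotient in
    Z[sqrt E] of norm 1. Its second coordinate is nonzero because the errors along the sequence
    strictly decrease. *)
Lemma pell : exists t s : int, s != 0 /\ t ^+ 2 - E%:Z * s ^+ 2 = 1.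
Proof.
pose T : finType := ('I_(bound + bound).+1 * 'I_bound.+1 * 'I_bound.+1)%type.
pose kap (p : int * int) : T := (inord (absz (norm p + bound%:Z)),
  inord (absz (p.1 %% norm p)%Z), inord (absz (p.2 %% norm p)%Z)).
have [s [/eqP + hs so]] := decreasing #|T|.+1; rewrite eqn_leq => /andP[_ /pigeonhole_map].
move=> /(_ kap) nu.
have so' : pairwise (fun p q => err p < err q) s.
  by move: so; rewrite sorted_pairwise // => p q r; apply: lt_trans.
have /(uniqPn (kap (0, 0))) [i [j [ij]]] := nu.
rewrite size_map => js; have is_ := ltn_trans ij js.
rewrite !(nth_map (0, 0)) //; set p := nth _ s i; set q := nth _ s j => e.
have [p2 pn] := hs p (mem_nth _ is_); have [q2 qn] := hs q (mem_nth _ js).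
have epq : err p < err q by have /(pairwiseP (0 : int, 0 : int)) := so'; apply.
have np := norm_neq0 p2; have nq := norm_neq0 q2.
have bnd (r : int * int) (x : int) : (absz (norm r) <= bound)%N -> norm r != 0 ->
    (absz (x %% norm r)%Z <= bound)%N.
  by move: (norm r) bound => c d h h0; have := ltz_mod x h0; have := modz_ge0 x h0; lia.
have modeq (c x y : int) : c != 0 -> absz (x %% c)%Z = absz (y %% c)%Z ->
    (c %| x - y)%Z.
  move=> c0 h; rewrite -eqz_mod_dvd; apply/eqP.
  have := modz_ge0 x c0; have := modz_ge0 y c0; lia.
have [e1 e2 e3] := e.
have en : norm p = norm q.
  suff: absz (norm p + bound%:Z) = absz (norm q + bound%:Z).
    by move: (norm p) (norm q) bound pn qn => ? ? ? ? ?; lia.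
  by apply: inord_inj e1; move: (norm p) (norm q) bound pn qn => ? ? ? ? ?; lia.
have m1 : (norm p %| p.1 - q.1)%Z.
  by apply: modeq => //; rewrite [in RHS]en; apply: inord_inj e2; apply: bnd.
have m2 : (norm p %| p.2 - q.2)%Z.
  by apply: modeq => //; rewrite [in RHS]en; apply: inord_inj e3; apply: bnd.
have /dvdzP[t ht] : (norm p %| p.1 * q.1 - E%:Z * (p.2 * q.2))%Z.
  have -> : p.1 * q.1 - E%:Z * (p.2 * q.2) =
      norm p - (p.1 * (p.1 - q.1) - E%:Z * (p.2 * (p.2 - q.2))).
    by rewrite /norm; ring.
  by rewrite dvdz_sub ?dvdzz // dvdz_sub // !dvdz_mull.
have /dvdzP[u hu] : (norm p %| p.1 * q.2 - q.1 * p.2)%Z.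
  have -> : p.1 * q.2 - q.1 * p.2 = (p.1 - q.1) * p.2 - p.1 * (p.2 - q.2).
    by ring.
  by apply: dvdz_sub; [exact: dvdz_mulr|exact: dvdz_mull].
exists t, u; split; last first.
  apply: (mulfI (mulf_neq0 np np)).
  transitivity ((t * norm p) ^+ 2 - E%:Z * (u * norm p) ^+ 2); first by ring.
  by rewrite -ht -hu mulr1 [X in _ = _ * X]en /norm; ring.
apply/eqP => u0; have h : p.1 * q.2 = q.1 * p.2.
  by apply/eqP; rewrite -subr_eq0 hu u0 mul0r.
have h1 : norm p * q.2 ^+ 2 = norm p * p.2 ^+ 2.
  rewrite [X in _ = X * _]en /norm.
  transitivity ((p.1 * q.2) ^+ 2 - E%:Z * (p.2 * q.2) ^+ 2); first by ring.
  by rewrite h; ring.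
have h2 : q.2 = p.2.
  move/(mulfI np)/eqP: h1; rewrite eqf_sqr => /orP[/eqP-> //|/eqP e'].
  by move: q2; rewrite e' oppr_gt0 => /(lt_trans p2); rewrite ltxx.
have h3 : p.1 = q.1 by apply: (mulIf (lt0r_neq0 p2)); rewrite -h h2.
by move: epq; rewrite /err h2 h3 ltxx.
Qed.

End Pell.

Lemma nsq_mul_sq (E m : nat) : (0 < m)%N -> (forall k, (k ^ 2)%N <> E) ->
  forall k, (k ^ 2)%N <> (E * m ^ 2)%N.
Proof.
move=> m0 nsq k e.
have : (m ^ 2 %| k ^ 2)%N by rewrite e dvdn_mull.
rewrite dvdn_pexp2r // => /dvdnP[l hl]; apply: (nsq l).
by apply/eqP; rewrite -(eqn_pmul2r (_ : 0 < m ^ 2)%N) ?expn_gt0 ?m0 // -e hl expnMn.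
Qed.

(** D may be a square, but then 2 D is not, and the norm 2 of sqrt(-2) takes the place of the norm
    1. Putting m^2 into the coefficient of the equation yields solutions whose second coordinate is
    divisible by any prescribed m. *)
Lemma pell_family (R : archiRcfType) (D : nat) : (0 < D)%N ->
  exists2 th : zs, th = 1 \/ th = sqm2 & forall m : nat, (0 < m)%N ->
    exists t s : int, s != 0 /\ t ^+ 2 - D%:Z * nz th * m%:Z ^+ 2 * s ^+ 2 = 1.
Proof.
move=> D0.
have fam (th : zs) (n : nat) : nz th = n%:Z -> (forall k, (k ^ 2)%N <> (D * n)%N) ->
    forall m : nat, (0 < m)%N ->
    exists t s : int, s != 0 /\ t ^+ 2 - D%:Z * nz th * m%:Z ^+ 2 * s ^+ 2 = 1.
  move=> hn nsq m m0; have [t [s [s0 e]]] := pell R (nsq_mul_sq m0 nsq).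
  have eM : (D * n * m ^ 2)%N%:Z = D%:Z * n%:Z * m%:Z ^+ 2.
    by rewrite -mulnn !PoszM expr2.
  by exists t, s; split=> //; rewrite hn -eM.
have [/existsP[x /eqP hx]|] := boolP [exists x : 'I_D.+1, (x ^ 2 == D)%N].
  exists sqm2; first by right.
  apply: (fam _ 2%N) => // k e.
  have x0 : (0 < x)%N by case: (posnP x) hx => // ->; lia.
  have k0 : (0 < k)%N by case: (posnP k) e => // ->; lia.
  move: e; rewrite -hx => /(congr1 (logn 2)).
  by rewrite lognM ?expn_gt0 ?x0 // !lognX (pfactorK 1) //; lia.
rewrite negb_exists => /forallP nex.
exists 1; first by left.
apply: (fam _ 1%N) => // k; rewrite muln1 => e.
have kD : (k < D.+1)%N by nia.
by have := nex (Ordinal kD); rewrite /= e eqxx.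
Qed.

(** * Integral binary Hermitian forms *)

Record hform := HForm { fA : int; fB : zs; fC : int }.

Definition hs (H : hform) (u1 u2 v1 v2 : zs) : zs :=
  (fA H)%:~R * (cz u1 * v1) + fB H * (cz u1 * v2) +
  cz (fB H) * (cz u2 * v1) + (fC H)%:~R * (cz u2 * v2).
Definition hq (H : hform) (u1 u2 : zs) : int :=
  fA H * nz u1 + 2 * zre (fB H * (cz u1 * u2)) + fC H * nz u2.
Definition hdisc (H : hform) : int := nz (fB H) - fA H * fC H.
(** The form in the basis of columns (p, r) and (q, s), whatever the determinant of this matrix. *)
Definition hact (H : hform) (p q r s : zs) : hform :=
  HForm (hq H p r) (hs H p r q s) (hq H q s).
Definition hequiv (H H' : hform) :=
  exists p q r s, p * s - q * r = 1 /\ H' = hact H p q r s.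

Lemma zre2 x : (2 * zre x)%:~R = x + cz x.
Proof. by apply: zs_eqP; rewrite !zsE /=; ring. Qed.

Lemma hqE H u1 u2 : (hq H u1 u2)%:~R = hs H u1 u2 u1 u2.
Proof.
rewrite /hq /hs !intrD !(intrM _ (fA H)) (intrM _ (fC H)) zre2 !nzE !rmorphM /= czK.
ring.
Qed.

Lemma hs_sym H u1 u2 v1 v2 : cz (hs H u1 u2 v1 v2) = hs H v1 v2 u1 u2.
Proof. by rewrite /hs !rmorphD !rmorphM /= !rmorph_int !czK; ring. Qed.

Lemma hs_lin H u1 u2 v1 v2 p q r s :
  hs (hact H p q r s) u1 u2 v1 v2 =
  hs H (p * u1 + q * u2) (r * u1 + s * u2) (p * v1 + q * v2) (r * v1 + s * v2).
Proof.
rewrite [LHS]/hs /= !hqE hs_sym /hs !rmorphD !rmorphM /=.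
ring.
Qed.

Lemma hform_eq (H H' : hform) :
  (forall u1 u2 v1 v2, hs H u1 u2 v1 v2 = hs H' u1 u2 v1 v2) -> H = H'.
Proof.
case: H H' => [A B C] [A' B' C'] h.
have := h 1 0 1 0; have := h 1 0 0 1; have := h 0 1 0 1.
rewrite /hs /= !rmorph0 !rmorph1 !(mulr0, mul0r, mulr1, add0r, addr0).
by move=> /zs_intr_inj -> -> /zs_intr_inj ->.
Qed.

Lemma hs_congr H u1 u2 v1 v2 u1' u2' v1' v2' :
  u1 = u1' -> u2 = u2' -> v1 = v1' -> v2 = v2' ->
  hs H u1 u2 v1 v2 = hs H u1' u2' v1' v2'.
Proof. by move=> -> -> -> ->. Qed.

Lemma hact_congr H u1 u2 v1 v2 u1' u2' v1' v2' :
  u1 = u1' -> u2 = u2' -> v1 = v1' -> v2 = v2' ->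
  hact H u1 u2 v1 v2 = hact H u1' u2' v1' v2'.
Proof. by move=> -> -> -> ->. Qed.

Lemma hact_comp H p q r s p' q' r' s' :
  hact (hact H p q r s) p' q' r' s' =
  hact H (p * p' + q * r') (p * q' + q * s') (r * p' + s * r') (r * q' + s * s').
Proof.
apply: hform_eq => u1 u2 v1 v2; rewrite [LHS]hs_lin [LHS]hs_lin [RHS]hs_lin.
apply: hs_congr; ring.
Qed.

Lemma hact1 H : hact H 1 0 0 1 = H.
Proof.
apply: hform_eq => u1 u2 v1 v2; rewrite [LHS]hs_lin.
apply: hs_congr; ring.
Qed.

Lemma hequiv_trans H2 H1 H3 : hequiv H1 H2 -> hequiv H2 H3 -> hequiv H1 H3.
Proof.
move=> [p [q [r [s [d ->]]]]] [p' [q' [r' [s' [d' ->]]]]].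
exists (p * p' + q * r'), (p * q' + q * s'), (r * p' + s * r'), (r * q' + s * s').
split; last by rewrite hact_comp.
transitivity ((p * s - q * r) * (p' * s' - q' * r')); first by ring.
by rewrite d d' mulr1.
Qed.

Lemma hequiv_sym H H' : hequiv H H' -> hequiv H' H.
Proof.
move=> [p [q [r [s [d ->]]]]]; exists s, (- q), (- r), p; split.
  by rewrite -d; ring.
rewrite hact_comp -[LHS]hact1 -d; apply: hact_congr; ring.
Qed.

Lemma hequiv_refl H : hequiv H H.
Proof. by exists 1, 0, 0, 1; rewrite hact1; split=> //; ring. Qed.

Lemma hdiscE H : (hdisc H)%:~R = fB H * cz (fB H) - (fA H)%:~R * (fC H)%:~R.
Proof. by rewrite /hdisc intrB intrM nzE. Qed.

Lemma hdisc_act H p q r s :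
  hdisc (hact H p q r s) = hdisc H * nz (p * s - q * r).
Proof.
apply: zs_intr_inj; rewrite intrM !hdiscE nzE /= !hqE hs_sym /hs.
rewrite !rmorphB !rmorphM /=; ring.
Qed.

Lemma hdisc_equiv H H' : hequiv H H' -> hdisc H' = hdisc H.
Proof. by move=> [p [q [r [s [d ->]]]]]; rewrite hdisc_act d nz1 mulr1. Qed.

Lemma hequiv_value H v1 v2 : zcoprime v1 v2 ->
  exists B C, hequiv H (HForm (hq H v1 v2) B C).
Proof.
move=> [s [q e]]; exists (hs H v1 v2 (- q) s), (hq H (- q) s).
by exists v1, (- q), v2, s; split=> //; rewrite -e; ring.
Qed.

Definition hneg (H : hform) := HForm (- fA H) (- fB H) (- fC H).

Lemma hnegK H : hneg (hneg H) = H.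
Proof. by case: H => A B C; rewrite /hneg /= !opprK. Qed.
Lemma hs_neg H u1 u2 v1 v2 : hs (hneg H) u1 u2 v1 v2 = - hs H u1 u2 v1 v2.
Proof. by rewrite /hs /= !rmorphN /=; ring. Qed.
Lemma hq_neg H u1 u2 : hq (hneg H) u1 u2 = - hq H u1 u2.
Proof. by apply: zs_intr_inj; rewrite rmorphN /= !hqE hs_neg. Qed.
Lemma hdisc_neg H : hdisc (hneg H) = hdisc H.
Proof. by rewrite /hdisc /= nzN; ring. Qed.
Lemma hequiv_neg H H' : hequiv H H' -> hequiv (hneg H) (hneg H').
Proof.
move=> [p [q [r [s [d ->]]]]]; exists p, q, r, s; split=> //.
by apply: hform_eq => *; rewrite [LHS]hs_neg [in LHS]hs_lin [RHS]hs_lin [RHS]hs_neg.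
Qed.

Lemma absz_sqr (x : int) : (absz x)%:Z ^+ 2 = x ^+ 2.
Proof. by rewrite abszE real_normK ?num_real. Qed.

Lemma prime_not_sqr (p : nat) (x : int) : prime p -> p%:Z <> x ^+ 2.
Proof.
move=> pp; rewrite -absz_sqr => h.
have {}h : p = (absz x * absz x)%N by move: h; rewrite expr2; lia.
case/primeP: (pp) => p1 /(_ (absz x)); rewrite {1}h dvdn_mulr // => /(_ isT).
by case/orP => /eqP h2; nia.
Qed.

(** The residue ring of pi is F_p: p does not divide zim pi, as p would otherwise be a square, so
    modulo pi the element sqrt(-2) equals the integer class - zre pi / zim pi. *)
Lemma zs_mod_int (p : nat) (pi w : zs) : prime p -> nz pi = p ->
  exists n : int, zdvd pi (w - n%:~R).
Proof.
move=> pp hp.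
have cop : coprimez (zim pi) p.
  rewrite coprimez_sym coprimezE /= prime_coprime //; apply/negP => /dvdnP[k hk].
  have p1 := prime_gt1 pp.
  have h1 : zre pi ^+ 2 + 2 * zim pi ^+ 2 = p by exact: hp.
  have k0 : k = 0%N.
    by have := absz_sqr (zim pi); rewrite hk PoszM; nia.
  have im0 : zim pi = 0 by lia.
  apply: (prime_not_sqr pp (x := zre pi)).
  by move: h1; rewrite im0; lia.
have /coprimezP[[k l] /= hkl] := cop.
exists (zre w - zim w * k * zre pi).
exists ((zim w)%:~R * (k%:~R + l%:~R * sqm2 * cz pi)).
have e1 : p%:Z%:~R = pi * cz pi by rewrite -nzE hp.
have e2 : (k * zim pi + l * p%:Z)%:~R * sqm2 = sqm2 by rewrite hkl mul1r.
have e3 : (zim pi)%:~R * sqm2 = pi - (zre pi)%:~R.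
  by apply: zs_eqP; rewrite !zsE; ring.
have e4 : sqm2 = k%:~R * (pi - (zre pi)%:~R) + l%:~R * sqm2 * (pi * cz pi).
  by rewrite -e3 -e1 -{1}e2 intrD !intrM; ring.
have e5 : w - (zre w - zim w * k * zre pi)%:~R =
    (zim w)%:~R * (sqm2 + k%:~R * (zre pi)%:~R).
  by apply: zs_eqP; rewrite !zsE; ring.
by rewrite e5 {1}e4; ring.
Qed.

(** The multiplier n is a natural number because it serves as the exponent of a unit. *)
Lemma zs_solve_mod (p : nat) (pi x u : zs) : prime p -> nz pi = p ->
  ~ zdvd pi u -> exists n : nat, zdvd pi (x + n%:R * u).
Proof.
move=> pp hp nu.
have [//|[a [b hab]]] : zdvd pi u \/ zcoprime pi u by apply: zs_prime_or; rewrite hp.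
have [m [c hm]] := zs_mod_int (- x * b) pp hp.
have p0 : (p : int) != 0 by rewrite eqz_nat -lt0n prime_gt0.
pose q := (m %/ p)%Z.
exists (absz (m %% p)%Z), (x * a - c * u - q%:~R * cz pi * u).
have hn : (absz (m %% p)%Z)%:R = m%:~R - q%:~R * p%:Z%:~R :> zs.
  rewrite -intrM -intrB {2}(divz_eq m p) addrAC subrr add0r.
  by rewrite -[LHS]/((absz _)%:Z%:~R) gez0_abs ?modz_ge0.
have e1 : p%:Z%:~R = pi * cz pi by rewrite -nzE hp.
have hm' : m%:~R = - x * b - c * pi by rewrite -hm; ring.
have hx : x = x * (a * pi + b * u) by rewrite hab mulr1.
by rewrite hn e1 hm' {1}hx; ring.
Qed.

Lemma zs_dvd_prime_int (p : nat) (pi : zs) (n : int) : prime p -> nz pi = p ->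
  zdvd pi n%:~R -> (p %| n)%Z.
Proof. by move=> pp hp /zdvd_intN; rewrite hp; apply. Qed.

(** The only units are 1 and -1, so if pi and its conjugate were associates, pi would be an integer
    or an integer multiple of sqrt(-2), and p a square or even. *)
Lemma zs_not_dvd_cz (p : nat) (pi : zs) : prime p -> odd p -> nz pi = p ->
  ~ zdvd (cz pi) pi.
Proof.
move=> pp op hp [k hk]; have p1 := prime_gt1 pp.
have hn : nz k = 1.
  have := congr1 nz hk; rewrite nzM nz_cz hp; nia.
have [k1 k2] : zim k = 0 /\ (zre k = 1 \/ zre k = -1).
  by move: hn; rewrite /nz => h; split; nia.
have : zre pi = 0 \/ zim pi = 0.
  have h1 := congr1 zre hk; have h2 := congr1 zim hk.
  by move: h1 h2; rewrite !zsE k1; case: k2 => ->; lia.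
case=> h; move: hp; rewrite /nz h.
  rewrite expr0n add0r -absz_sqr => h1.
  have : (2 %| p)%N by apply/dvdnP; exists (absz (zim pi) ^ 2)%N; rewrite -mulnn; nia.
  by rewrite dvdn2 op.
rewrite expr0n mulr0 addr0 => /esym; exact: prime_not_sqr.
Qed.

(** * Neighbouring forms *)

Section Neighbour.
Variables (D : nat) (a c : int) (b kp : zs).
Hypotheses (D0 : (0 < D)%N) (hD : nz b - a * c = D) (a0 : a != 0).
Hypothesis hkp : kp * a%:~R = 2 * sqm2 * b.
Let H0 := HForm a b c.

(* The matrix of w + y j acting on O^2 and scaling H0 by its reduced norm. *)
Definition X11 (w y : zs) := w - b * cz y.
Definition X12 (w y : zs) := kp * (zim w + zim (cz b * y))%:~R - c%:~R * y.
Definition X21 (y : zs) := a%:~R * cz y.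
Definition X22 (w y : zs) := cz w + b * cz y.

Let hDz : b * cz b - a%:~R * c%:~R = D%:Z%:~R.
Proof. by rewrite -hD intrB intrM nzE. Qed.

Lemma zim2 x : 2 * sqm2 * (zim x)%:~R = x - cz x.
Proof. by apply: zs_eqP; rewrite !zsE /=; ring. Qed.

(** The difference of w + conj(b) y and its conjugate is 2 sqrt(-2) times an integer, so [hkp] makes
    its product with b divisible by a. This is the reason for [kp]: it makes the entry [X12]
    integral. *)
Lemma aX12 w y : a%:~R * X12 w y =
  b * (w - cz w + cz b * y - b * cz y) - a%:~R * c%:~R * y.
Proof.
have -> : w - cz w + cz b * y - b * cz y = 2 * sqm2 * (zim w + zim (cz b * y))%:~R.
  by rewrite intrD mulrDr !zim2 rmorphM /= czK; ring.
have -> : b * (2 * sqm2 * (zim w + zim (cz b * y))%:~R) =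
   (2 * sqm2 * b) * (zim w + zim (cz b * y))%:~R by ring.
by rewrite -hkp /X12; ring.
Qed.

(** Completing the square: a H0(u) = |linf u|^2 - D |u2|^2. In the coordinates (linf u, u2), the
    element w + y j acts by the matrix [[w, D y], [conj(y), conj(w)]]. *)
Definition linf (u1 u2 : zs) := a%:~R * u1 + b * u2.

Lemma lin_X w y u1 u2 :
  linf (X11 w y * u1 + X12 w y * u2) (X21 y * u1 + X22 w y * u2) =
  w * linf u1 u2 + D%:Z%:~R * y * u2.
Proof.
rewrite /linf mulrDr [a%:~R * (X12 w y * u2)]mulrA aX12 -hDz /X11 /X21 /X22; ring.
Qed.

Lemma snd_X w y u1 u2 :
  X21 y * u1 + X22 w y * u2 = cz y * linf u1 u2 + cz w * u2.
Proof. by rewrite /X21 /X22 /linf; ring. Qed.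

Lemma hs_lin0 u1 u2 v1 v2 : a%:~R * hs H0 u1 u2 v1 v2 =
  cz (linf u1 u2) * linf v1 v2 - D%:Z%:~R * (cz u2 * v2).
Proof. by rewrite /linf /hs /= -hDz !rmorphD !rmorphM /= rmorph_int; ring. Qed.

Lemma hs_X w y u1 u2 v1 v2 :
  hs H0 (X11 w y * u1 + X12 w y * u2) (X21 y * u1 + X22 w y * u2)
        (X11 w y * v1 + X12 w y * v2) (X21 y * v1 + X22 w y * v2) =
  (nz w - D%:Z * nz y)%:~R * hs H0 u1 u2 v1 v2.
Proof.
have a0' : a%:~R != 0 :> zs by rewrite zs_intr_eq0.
apply: (zs_mulfI a0'); rewrite hs_lin0 !lin_X !snd_X.
rewrite [RHS]mulrCA hs_lin0; move: (linf u1 u2) (linf v1 v2) => x x'.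
by rewrite intrB intrM !nzE !rmorphD !rmorphM /= !czK rmorph_int; ring.
Qed.

Lemma det_X w y : X11 w y * X22 w y - X12 w y * X21 y = (nz w - D%:Z * nz y)%:~R.
Proof.
have -> : X12 w y * X21 y = a%:~R * X12 w y * cz y by rewrite /X21; ring.
by rewrite aX12 intrB intrM !nzE -hDz /X11 /X22; ring.
Qed.

End Neighbour.

(** The square of y0 j is D nz y0, which is 0 modulo p, so (t + y0 j)^n is congruent to 1 + n y0 j:
    the powers of the unit form an additive family modulo p. *)
Lemma unit_power (D p : nat) (t : int) (y0 : zs) :
  t ^+ 2 - D%:Z * nz y0 = 1 -> (p %| t - 1)%Z -> (p %| nz y0)%Z ->
  forall n : nat, exists w y, [/\ nz w - D%:Z * nz y = 1,
    zdvd p%:Z%:~R (w - 1) & zdvd p%:Z%:~R (y - n%:R * y0)].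
Proof.
move=> e tp yp; elim=> [|n [w [y [e1 [k hk] [l hl]]]]].
  by exists 1, 0; rewrite nz1 nz0 mulr0 subr0; split=> //; [exists 0|exists 0]; ring.
have [k1 ht] := zdvd_int tp; have [k2 hy] := zdvd_int yp.
exists (w * t%:~R + D%:Z%:~R * y * cz y0), (w * y0 + y * t%:~R); split.
- rewrite -[RHS](mulr1 1) -[in X in _ = X * _]e1 -e.
  by rewrite /nz !zsE; ring.
- exists (k * t%:~R + k1 + D%:Z%:~R * (l * cz y0 + n%:R * k2)).
  have hw : w = 1 + k * p%:Z%:~R by rewrite -hk; ring.
  have hY : y = n%:R * y0 + l * p%:Z%:~R by rewrite -hl; ring.
  have hT : t%:~R = 1 + k1 * p%:Z%:~R :> zs by rewrite -ht intrB; ring.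
  rewrite nzE in hy.
  rewrite {1}hw hY hT.
  have -> : D%:Z%:~R * (n%:R * y0 + l * p%:Z%:~R) * cz y0 =
     D%:Z%:~R * n%:R * (y0 * cz y0) + D%:Z%:~R * l * cz y0 * p%:Z%:~R by ring.
  by rewrite hy; ring.
- exists (k * y0 + l * t%:~R + n%:R * y0 * k1).
  have hw : w = 1 + k * p%:Z%:~R by rewrite -hk; ring.
  have hY : y = n%:R * y0 + l * p%:Z%:~R by rewrite -hl; ring.
  have hT : t%:~R = 1 + k1 * p%:Z%:~R :> zs by rewrite -ht intrB; ring.
  by rewrite hw hY hT -natr1; ring.
Qed.

(** Modulo p the element y0 j has to be nilpotent and yet nonzero, in a way visible at conj(pi). A
    Pell solution with y0 an integer multiple of p would be trivial there; distributing the prime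
    factors unevenly between pi and conj(pi) avoids this. *)
Lemma pell_unit_mod (R : archiRcfType) (D p : nat) (pi : zs) :
  (0 < D)%N -> prime p -> odd p -> nz pi = p ->
  exists t y0, [/\ t ^+ 2 - D%:Z * nz y0 = 1, (p %| t - 1)%Z, (p %| nz y0)%Z
    & ~ zdvd (cz pi) y0].
Proof.
move=> D0 pp op hp; have p0 := prime_gt0 pp.
have hpc : nz (cz pi) = p by rewrite nz_cz.
have [th hth fam] := pell_family R D0.
have [t [s [s0 e]]] := fam p p0.
have [r [e1 [r0 hs]]] : exists r e1, ~~ (p %| r)%Z /\ p%:Z * s = r * p%:Z ^+ e1.+1.
  pose n := absz s; have n0 : (0 < n)%N by rewrite absz_gt0.
  have [k ck hk] := pfactor_coprime pp n0.
  move: (logn p n) hk => e1 hk; exists (sgz s * k%:Z), e1; split; last first.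
    by rewrite {1}(intEsg s) -/n hk PoszM exprS -[Posz (p ^ _)]natz natrX natz; ring.
  by rewrite dvdzE abszM absz_sg s0 mul1n -prime_coprime.
(* Trading each factor conj(pi) of p ^ e1.+1 for pi keeps the norm of th (p s), hence the Pell
   equation, and removes conj(pi) from y0. *)
pose y0 := th * r%:~R * pi ^+ (2 * e1.+1).
have ny0 : nz y0 = nz th * p%:Z ^+ 2 * s ^+ 2.
  have nX n : nz (pi ^+ n) = p%:Z ^+ n by elim: n => // n IH; rewrite !exprS nzM IH hp.
  transitivity (nz th * (p%:Z * s) ^+ 2); last by ring.
  by rewrite hs /y0 !nzM nX nz_int mulnC exprM; ring.
have e' : t ^+ 2 - D%:Z * nz y0 = 1 by rewrite ny0 -[RHS]e; ring.
have py0 : (p %| nz y0)%Z by rewrite ny0 expr2 dvdz_mulr // !dvdz_mull // dvdzz.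
have ny : ~ zdvd (cz pi) y0.
  have ppc : prime (absz (nz (cz pi))) by rewrite hpc.
  have npow n : ~ zdvd (cz pi) (pi ^+ n).
    elim: n => [|n IH].
      by move=> h; have := zs_dvd_prime_int (n := 1) pp hpc h; rewrite dvdzE dvdn1 => /eqP; case: (p) pp => // [[|]].
    by rewrite exprS => /(zs_primeM ppc)[/(zs_not_dvd_cz pp op hp)|].
  move=> /(zs_primeM ppc)[/(zs_primeM ppc)[h|h]|/npow//].
    have : (p %| nz th)%Z by rewrite -[p%:Z]hpc; apply: zdvd_nz.
    have p3 : (2 < p)%N by case: (p) pp op => [|[|[|]]].
    by case: hth => ->; rewrite ?nz1 ?nz_sqm2 dvdzE /= => /dvdn_leq => /(_ isT); lia.
  by move/negP: r0; apply; apply: zs_dvd_prime_int pp hpc h.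
have : (p %| (t - 1) * (t + 1))%Z.
  have -> : (t - 1) * (t + 1) = D%:Z * nz y0.
    by transitivity (t ^+ 2 - (t ^+ 2 - D%:Z * nz y0)); [rewrite e'|]; ring.
  by rewrite dvdz_mull.
(* As t^2 = 1 modulo p, either t or - t is congruent to 1. *)
rewrite Euclid_dvdz // => /orP[h|h]; first by exists t, y0.
exists (- t), y0; split=> //; first by rewrite sqrrN.
by rewrite -opprD dvdz_opp.
Qed.

Section Key.
Variables (R : archiRcfType) (D : nat) (a c : int) (b kp : zs).
Hypotheses (D0 : (0 < D)%N) (hD : nz b - a * c = D) (a0 : a != 0).
Hypothesis hkp : kp * a%:~R = 2 * sqm2 * b.
Let H0 := HForm a b c.
Variables (p : nat) (pi : zs).
Hypotheses (pp : prime p) (op : odd p) (hp : nz pi = p).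
Hypotheses (pD : ~~ (p %| D)%N) (pa : coprime p (absz a)).

Let lin := linf a b.

Lemma zcoprime_int (m n : int) : coprimez m n -> zcoprime m%:~R n%:~R.
Proof.
move=> /coprimezP[[u v] /= h]; exists u%:~R, v%:~R.
by rewrite -!intrM -intrD h.
Qed.

Let a_dvd x : zdvd p%:Z%:~R (a%:~R * x) -> zdvd p%:Z%:~R x.
Proof. by apply: zcoprime_dvd; apply: zcoprime_int. Qed.

Lemma hq_lin v1 v2 : a * hq H0 v1 v2 = nz (lin v1 v2) - D%:Z * nz v2.
Proof.
apply: zs_intr_inj; rewrite intrM hqE (hs_lin0 hD) intrB intrM !nzE.
by rewrite mulrC [cz v2 * _]mulrC.
Qed.

(** In the coordinates (x, v2), left multiplication by pi acts as (pi, conj(pi)). It produces a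
    vector divisible by p as soon as conj(pi) divides the first entry and pi the second, and a power
    of the unit of [pell_unit_mod] moves the vector into that position. *)
Lemma neighbour_aux v1 v2 : zcoprime v1 v2 -> (p %| hq H0 v1 v2)%Z ->
  exists w y, [/\ nz w - D%:Z * nz y = p,
    zdvd p%:Z%:~R (w * lin v1 v2 + D%:Z%:~R * y * v2)
  & zdvd p%:Z%:~R (cz y * lin v1 v2 + cz w * v2)].
Proof.
move=> cop pq; set x := lin v1 v2.
have px : (p %| nz x - D%:Z * nz v2)%Z by rewrite -hq_lin dvdz_mull.
have hpc : nz (cz pi) = p by rewrite nz_cz.
have prpi : prime (absz (nz pi)) by rewrite hp.
have prpc : prime (absz (nz (cz pi))) by rewrite hpc.
have pE : p%:Z%:~R = pi * cz pi by rewrite -nzE hp.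
have split_nz z : (p %| nz z)%Z -> zdvd pi z \/ zdvd (cz pi) z.
  move=> /zdvd_int; rewrite nzE => h.
  have : zdvd pi (z * cz z).
    by apply: zdvd_trans h; rewrite pE; exists (cz pi); rewrite mulrC.
  by move=> /(zs_primeM prpi)[|/zdvd_cz]; rewrite ?czK; [left|right].
have nz_dvd z : zdvd (cz pi) z -> (p %| nz z)%Z by move=> /zdvd_nz; rewrite hpc.
(* If conj(pi) divides v2, then pi divides x: otherwise conj(pi) would divide x, hence a, because v
   is primitive. Multiplication by conj(pi) is then enough. *)
have [[k hk]|cop2] := zs_prime_or v2 prpc.
  have pix : zdvd pi x.
    have : (p %| nz x)%Z.
      rewrite -[nz x](subrK (D%:Z * nz v2)) dvdz_add // dvdz_mull // nz_dvd //.
      by exists k.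
    case/split_nz => // -[l hl].
    have [u [v huv]] := cop.
    have : zdvd (cz pi) a%:~R.
      exists (u * l - u * b * k + v * a%:~R * k).
      have hx : a%:~R * v1 = l * cz pi - b * (k * cz pi).
        by rewrite -hl -hk /x /lin /linf; ring.
      transitivity (u * (a%:~R * v1) + v * a%:~R * v2).
        by rewrite -[LHS]mulr1 -huv; ring.
      by rewrite hx hk; ring.
    move/(zs_dvd_prime_int pp hpc); rewrite dvdzE /=.
    by move: pa; rewrite prime_coprime // => /negbTE ->.
  have [l hl] := pix.
  exists (cz pi), 0; rewrite nz0 mulr0 subr0 hpc czK rmorph0; split=> //.
    by exists l; rewrite hl pE; ring.
  by exists k; rewrite hk pE; ring.
have nv2 : ~ zdvd (cz pi) v2.
  move=> h2; have [u [v huv]] := cop2.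
  have : zdvd (cz pi) 1%:~R by rewrite -huv; apply: zdvdD; apply: zdvd_mull => //; apply: zdvd_refl.
  move/(zs_dvd_prime_int pp hpc); rewrite dvdzE dvdn1.
  by case: (p) pp => [|[|]].
have [t [y0 [ht tp yp ny]]] := pell_unit_mod R D0 pp op hp.
have nu : ~ zdvd (cz pi) (D%:Z%:~R * y0 * v2).
  move/(zs_primeM prpc) => [/(zs_primeM prpc)[|]|] //.
  by move/(zs_dvd_prime_int pp hpc); rewrite dvdzE /= (negbTE pD).
(* Modulo p the n-th power of the unit turns x into x + n D y0 v2, and n makes this divisible by
   conj(pi). *)
have [n [m hm]] := zs_solve_mod x pp hpc nu.
have [w [y [e1 [k hk] [l hl]]]] := unit_power ht tp yp n.
have hw : w = 1 + k * p%:Z%:~R by rewrite -hk; ring.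
have hY : y = n%:R * y0 + l * p%:Z%:~R by rewrite -hl; ring.
pose x1 := w * x + D%:Z%:~R * y * v2.
pose z1 := cz y * x + cz w * v2.
have e1' : w * cz w - D%:Z%:~R * (y * cz y) = 1.
  by rewrite -!nzE -intrM -intrB e1.
have x1d : zdvd (cz pi) x1.
  exists (m + k * pi * x + D%:Z%:~R * l * pi * v2).
  have -> : x1 = x + n%:R * (D%:Z%:~R * y0 * v2) + k * x * p%:Z%:~R
       + D%:Z%:~R * l * v2 * p%:Z%:~R by rewrite /x1 hw hY; ring.
  by rewrite hm pE; ring.
(* The unit preserves nz x - D nz v2, so p divides D nz z1. If conj(pi) divided z1, inverting the
   unit would make it divide v2. *)
have z1d : zdvd pi z1.
  have e2g x' : D%:Z * nz (cz y * x' + cz w * v2) = nz (w * x' + D%:Z%:~R * y * v2)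
      - (nz w - D%:Z * nz y) * (nz x' - D%:Z * nz v2) by rewrite /nz !zsE; ring.
  have e2 : D%:Z * nz z1 = nz x1 - (nz x - D%:Z * nz v2).
    by rewrite /z1 e2g e1 mul1r.
  have : (p %| D%:Z * nz z1)%Z by rewrite e2 dvdz_sub // nz_dvd.
  rewrite Euclid_dvdz // dvdzE /= (negbTE pD) /= => /split_nz[] // z1d.
  case: nv2; have -> : v2 = w * z1 - cz y * x1.
    by rewrite -[LHS]mul1r -e1' /x1 /z1; ring.
  by apply: zdvdB; apply: zdvd_mull.
have [m1 hm1] := x1d; have [m2 hm2] := z1d.
exists (pi * w), (pi * y); split.
- rewrite !nzM hp -[RHS]mulr1 -e1; ring.
- exists m1; transitivity (pi * x1); first by rewrite /x1; ring.
  by rewrite hm1 pE; ring.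
- exists m2; transitivity (cz pi * z1); first by rewrite /z1 !rmorphM /=; ring.
  by rewrite hm2 pE; ring.
Qed.

Lemma neighbour_key v1 v2 : zcoprime v1 v2 -> (p %| hq H0 v1 v2)%Z ->
  exists w y, [/\ nz w - D%:Z * nz y = p,
    zdvd p%:Z%:~R (X11 b w y * v1 + X12 c b kp w y * v2)
  & zdvd p%:Z%:~R (X21 a y * v1 + X22 b w y * v2)].
Proof.
move=> cop pq; have [w [y [e h1 h2]]] := neighbour_aux cop pq.
exists w, y.
have h3 : zdvd p%:Z%:~R (X21 a y * v1 + X22 b w y * v2) by rewrite (snd_X a b).
split=> //; apply: a_dvd.
move: h1; rewrite -(lin_X hD hkp) /linf => h1.
have -> : a%:~R * (X11 b w y * v1 + X12 c b kp w y * v2) =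
  (a%:~R * (X11 b w y * v1 + X12 c b kp w y * v2) + b * (X21 a y * v1 + X22 b w y * v2))
  - b * (X21 a y * v1 + X22 b w y * v2) by ring.
by apply: zdvdB h1 _; apply: zdvd_mull.
Qed.

(** The matrix X of norm p has determinant p, multiplies [H0] by p and maps the column v of value p
    C into p O^2. Replacing the columns g, v by X g and X v / p keeps the determinant 1 and moves p
    from the last coefficient to the first. *)
Lemma neighbour_step n B C :
  hdisc (HForm (a * (p%:Z * n)) B C) = D ->
  hequiv (HForm (a * n) B (p%:Z * C)) H0 ->
  hequiv (HForm (a * (p%:Z * n)) B C) H0.
Proof.
move=> hd /hequiv_sym[g1 [v1 [g2 [v2 [dg]]]]] /= [eA eB eC].
have cop : zcoprime v1 v2 by exists (- g2), g1; rewrite -dg; ring.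
have pq : (p %| hq H0 v1 v2)%Z by rewrite -eC dvdz_mulr ?dvdzz.
have [w [y [ew [k1 h1] [k2 h2]]]] := neighbour_key cop pq.
apply: hequiv_sym.
pose g1' := X11 b w y * g1 + X12 c b kp w y * g2.
pose g2' := X21 a y * g1 + X22 b w y * g2.
have p0 : p%:Z%:~R != 0 :> zs by rewrite zs_intr_eq0 eqz_nat -lt0n prime_gt0.
have hsX := hs_X hD a0 hkp w y; rewrite ew in hsX.
have pz : (p%:Z)%:~R = cz p%:Z%:~R by rewrite rmorph_int.
exists g1', k1, g2', k2; split.
  apply: (zs_mulfI p0).
  transitivity (g1' * (k2 * p%:Z%:~R) - (k1 * p%:Z%:~R) * g2'); first by ring.
  rewrite -h1 -h2 /g1' /g2' mulr1.
  transitivity ((X11 b w y * X22 b w y - X12 c b kp w y * X21 a y) * (g1 * v2 - v1 * g2)).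
    by ring.
  by rewrite dg mulr1 (det_X hD hkp) ew.
rewrite /hact; congr HForm.
- apply: zs_intr_inj; rewrite hqE hsX -hqE -eA -!intrM; congr _%:~R; ring.
- apply: (zs_mulfI p0); have -> : p%:Z%:~R * hs H0 g1' g2' k1 k2 =
    hs H0 g1' g2' (k1 * p%:Z%:~R) (k2 * p%:Z%:~R) by rewrite /hs; ring.
  by rewrite -h1 -h2 hsX -eB.
- apply: zs_intr_inj; apply: (zs_mulfI p0); apply: (zs_mulfI p0).
  rewrite hqE; have -> : p%:Z%:~R * (p%:Z%:~R * hs H0 k1 k2 k1 k2) =
    hs H0 (k1 * p%:Z%:~R) (k2 * p%:Z%:~R) (k1 * p%:Z%:~R) (k2 * p%:Z%:~R).
    by rewrite /hs !rmorphM /= -pz; ring.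
  by rewrite -h1 -h2 hsX -hqE -eC intrM.
Qed.

End Key.

(** B and the product of the outer coefficients do not change when a prime is moved across, so one
    [kp] serves for all steps. *)
Lemma neighbour_chain (R : archiRcfType) (D n : nat) (a C : int) (B kp : zs) :
  (0 < D)%N -> a != 0 -> kp * a%:~R = 2 * sqm2 * B -> (0 < n)%N ->
  (forall p, prime p -> (p %| n)%N -> [/\ odd p, ~~ (p %| D)%N,
     coprime p (absz a) & exists pi, nz pi = p]) ->
  hdisc (HForm (a * n%:Z) B C) = D ->
  hequiv (HForm (a * n%:Z) B C) (HForm a B (n%:Z * C)).
Proof.
move=> D0 a0 hkp; elim/ltn_ind: n C => n IH C n0 hn hd.
have [n1|n1] := leqP n 1.
  have -> : n = 1%N by lia.
  by rewrite mulr1 mul1r; apply: hequiv_refl.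
have /dvdnP[n' hn'] := pdiv_dvd n; set p := pdiv n in hn'.
have pp : prime p by exact: pdiv_prime.
have p1 := prime_gt1 pp.
have [op pD pa [pi hp]] := hn p pp (pdiv_dvd n).
have n'0 : (0 < n')%N by case: (posnP n') hn' n0 => // ->; rewrite mul0n => ->.
have hdE : nz B - a * (n%:Z * C) = D by rewrite -hd /hdisc /=; ring.
rewrite {1}hn' mulnC PoszM.
apply: (neighbour_step R D0 hdE a0 hkp pp op hp pD pa).
  by rewrite -PoszM mulnC -hn'.
have -> : n%:Z * C = n'%:Z * (p%:Z * C) by rewrite hn' PoszM; ring.
apply: IH => //; first by rewrite hn'; nia.
  by move=> q pq qn; apply: hn => //; rewrite hn' dvdn_mulr.
by rewrite -hd /hdisc /= hn' PoszM; ring.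
Qed.


(** * Norms modulo prime powers *)

Lemma absz_nz x : (absz (nz x))%:Z = nz x.
Proof. by rewrite gez0_abs // nz_ge0. Qed.

(** Newton's step: if n - nz x = k P with P a power of r, and u inverts 2 nz x modulo r, then x (1 +
    k u P) gains a factor r. *)
Lemma hensel (r : nat) (n : int) K : prime r -> odd r -> ~~ (r %| n)%Z ->
  exists x, ((r ^ K)%N %| n - nz x)%Z.
Proof.
move=> pr ord rn; case: K => [|K]; first by exists 0; apply/dvdzP; eexists; rewrite mulr1.
elim: K => [|K [x /dvdzP[k hk]]].
  have [x hx] := nz_mod_prime n pr; exists x; rewrite expn1 -opprB dvdz_opp //.
have rx : ~~ (r %| nz x)%Z.
  apply: contra rn => h; rewrite -(subrK (nz x) n) dvdz_add // hk.
  by rewrite dvdz_mull // dvdzE /= expnS dvdn_mulr.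
have : coprimez (2 * nz x) r.
  rewrite coprimez_sym coprimezMr !coprimezE !prime_coprime // rx andbT.
  apply/negP => /dvdn_leq => /(_ isT) /= h2.
  by case: (r) pr ord h2 => [|[|[|]]].
case/coprimezP => -[u v] /= huv.
pose P := (r ^ K.+1)%N%:Z.
exists (x + x * (k * u * P)%:~R); rewrite nz_add_mul.
have -> : zre (cz x * x) = nz x by rewrite /nz !zsE; ring.
have hP : P = r%:Z * (r ^ K)%N%:Z by rewrite /P expnS PoszM.
have hP2 : (r ^ K.+2)%N%:Z = r%:Z * P by rewrite /P -PoszM -expnS.
rewrite -/P in hk; rewrite hP2; move: P hP hk {hP2} => P hP hk.
have {}huv : 2 * nz x * u = 1 - v * r%:Z.
  by transitivity (u * (2 * nz x) + v * r%:Z - v * r%:Z); [ring|rewrite huv].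
apply/dvdzP; exists (k * v - (k * u) ^+ 2 * nz x * (r ^ K)%N%:Z).
transitivity (n - nz x - k * P * (2 * nz x * u) - (k * u) ^+ 2 * nz x * P ^+ 2).
  by ring.
have -> : P ^+ 2 = P * (r%:Z * (r ^ K)%N%:Z) by rewrite -hP expr2.
by rewrite huv hk; ring.
Qed.

(** Modulo 8 the norms of 1 and 1 + sqrt(-2) are 1 and 3. Multiplying x of odd norm by 1 + 2^(K+2)
    changes its norm by 2^(K+3) modulo 2^(K+4), which corrects an odd error coefficient k. *)
Lemma hensel2 (n : int) K : (8 %| n - 1)%Z || (8 %| n - 3)%Z ->
  exists x, ((2 ^ K)%N %| n - nz x)%Z.
Proof.
move=> n13; suff [x [_ h]] : exists x, ~~ (2 %| nz x)%Z /\ ((2 ^ (K + 3))%N %| n - nz x)%Z.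
  by exists x; apply: dvdz_trans h; rewrite dvdzE /= dvdn_exp2l // leq_addr.
elim: K => [|K [x [ox /dvdzP[k hk]]]].
  by case/orP: n13 => h; [exists 1|exists (1 + sqm2)].
have [l [hl|hl]] : exists l, k = 2 * l \/ k = 2 * l + nz x.
  have h (m : int) : exists l, m = 2 * l \/ m = 2 * l + 1.
    exists (m %/ 2)%Z; have := divz_eq m 2; have := modz_ge0 m (_ : 2 != 0 :> int) => /(_ isT).
    by have := ltz_pmod m (_ : 0 < 2 :> int) => /(_ isT); lia.
  have [l1 h1] := h k; have [l2 h2] := h (nz x).
  case: h2 => h2; first by move: ox; rewrite h2 dvdz_mulr.
  case: h1 => h1; first by exists l1; left.
  by exists (l1 - l2); right; lia.
  exists x; split=> //; rewrite hk hl; apply/dvdzP; exists l.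
  by rewrite addSn expnS PoszM; ring.
exists (x * (1 + 2 ^+ (K + 2))); split.
  rewrite nzM -[1 + _]/(1%:~R + (2%:~R) ^+ _) -rmorphXn -intrD nz_int.
  rewrite (@Euclid_dvdz 2) // negb_or ox /= expr2 (@Euclid_dvdz 2) // orbb.
  by rewrite addn2 exprS; apply/negP => /dvdzP[t ht]; move: (2 ^+ K.+1) ht => w; lia.
rewrite nzM -[1 + _]/(1%:~R + (2%:~R) ^+ _) -rmorphXn -intrD nz_int.
have -> : n - nz x * (1 + 2 ^+ (K + 2)) ^+ 2 = (n - nz x) - nz x * (2 ^+ (K + 3) + 2 ^+ (K + 2) ^+ 2).
  by rewrite !exprD; ring.
rewrite hk hl.
have e1 : (2 ^ (K + 3))%N%:Z = 2 ^+ (K + 3) by rewrite -natz natrX.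
have e2 : (2 ^ (K.+1 + 3))%N%:Z = 2 * 2 ^+ (K + 3) by rewrite -natz natrX addSn exprS.
rewrite e1 e2; apply/dvdzP; exists (l - nz x * 2 ^+ K).
by rewrite !exprD; ring.
Qed.

(** * Isotropic vectors of H + <-a> *)

Definition ts (H : hform) (a : int) (u1 u2 z v1 v2 w : zs) : zs :=
  hs H u1 u2 v1 v2 - a%:~R * (cz z * w).

(** For v = (v1, v2, z) isotropic in H + <-a> and g = (g1, g2, gz), the expression assumed to vanish
    is the value of that form at al v + ga g. *)
Lemma isotropic_comb (H : hform) (a : int) (v1 v2 z g1 g2 gz al ga : zs) :
  hq H v1 v2 = a * nz z ->
  let tau := ts H a v1 v2 z g1 g2 gz in
  cz al * ga * tau + al * cz ga * cz tau
    + ga * cz ga * (hq H g1 g2 - a * nz gz)%:~R = 0 ->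
  hq H (al * v1 + ga * g1) (al * v2 + ga * g2) = a * nz (al * z + ga * gz).
Proof.
move=> he /= e0; apply: zs_intr_inj; rewrite intrM hqE nzE.
have {}he : hs H v1 v2 v1 v2 = a%:~R * (z * cz z) by rewrite -hqE he intrM nzE.
apply/eqP; rewrite -subr_eq0; apply/eqP; rewrite -[RHS]e0.
rewrite intrB intrM hqE nzE /ts rmorphB !rmorphM /= rmorph_int czK hs_sym.
have -> : hs H (al * v1 + ga * g1) (al * v2 + ga * g2) (al * v1 + ga * g1) (al * v2 + ga * g2)
  = al * cz al * hs H v1 v2 v1 v2 + cz al * ga * hs H v1 v2 g1 g2
   + al * cz ga * hs H g1 g2 v1 v2 + ga * cz ga * hs H g1 g2 g1 g2.
  by rewrite /hs !rmorphD !rmorphM /=; ring.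
by rewrite he !rmorphD !rmorphM /=; ring.
Qed.

Section LocalFix.
Variables (a n : int) (B : zs) (C : int) (N : nat).
Let H := HForm (a * n) B C.
Hypotheses (a0 : 0 < a) (N0 : (0 < N)%N) (N2 : (2 %| N)%N).
Hypothesis nN : forall r, prime r -> (r %| N)%N -> ~~ (r %| n)%Z.
Hypothesis n13 : (8 %| n - 1)%Z || (8 %| n - 3)%Z.
Variables (v1 v2 z : zs).
Hypotheses (hv : hq H v1 v2 = a * nz z) (z0 : z != 0).

(** Chosen so that r^(K-1) exceeds 16 a r sqrt(nz z) for every r > 1, see [hK]; this bound excludes
    that all the candidates tried in [P_ex] fail. *)
Let K := (16 * absz a * absz (nz z) + 3)%N.
(** The real part of the pairing of (v1, v2, z) with (x.1, 0, x.2); the value of H + <-a> at the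
    latter vector is a [qq x]. *)
Let be (x : int * zs) : int := x.1 * zre (hs H v1 v2 1 0) - a * zre (cz z * x.2).
Let qq (x : int * zs) : int := n * x.1 ^+ 2 - nz x.2.

Let P (r : nat) (x : int * zs) := [/\ ((r ^ K)%N %| qq x)%Z,
  ~~ ((r ^ K.-1)%N %| 2 * be x)%Z & ~~ (r %| nz x.2)%Z].

Let K0 : (0 < K)%N. Proof. by rewrite /K addn3. Qed.

Let P_periodic r x w : P r x -> P r (x + w *~ (r ^ K)%N).
Proof.
case: x w => [m ze] [w1 w2] [h1 h2 h3].
have -> : (m, ze) + (w1, w2) *~ (r ^ K)%N = (m + w1 * (r ^ K)%N%:Z, ze + w2 * (r ^ K)%N%:Z%:~R).
  have -> : (w1, w2) *~ (r ^ K)%N = (w1 *~ (r ^ K)%N, w2 *~ (r ^ K)%N).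
    by rewrite -!pmulrn; elim: (r ^ K)%N => // k IH; rewrite !mulrS IH.
  by rewrite zs_mulrz -[w1 *~ _]mulrzr intz.
move: h1 h2 h3; rewrite /P /qq /be /=; set Q := ((r ^ K)%N%:Z) => h1 h2 h3.
have rQ : (r %| Q)%Z by rewrite dvdzE /= dvdn_exp.
have Q1 : ((r ^ K.-1)%N %| Q)%Z by rewrite dvdzE /= dvdn_exp2l // leq_pred.
split.
- rewrite nz_add_mul; have -> : n * (m + w1 * Q) ^+ 2 - (nz ze + Q * (2 * zre (cz ze * w2) + Q * nz w2)) =
    n * m ^+ 2 - nz ze + Q * (2 * n * m * w1 + n * w1 ^+ 2 * Q - (2 * zre (cz ze * w2) + Q * nz w2)).
    by ring.
  by rewrite dvdz_add // dvdz_mulr ?dvdzz.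
- apply: contra h2 => h.
  set th := zre (hs H v1 v2 1 0) in h *.
  have -> : 2 * (m * th - a * zre (cz z * ze)) =
     2 * ((m + w1 * Q) * th - a * zre (cz z * (ze + w2 * Q%:~R))) -
     Q * (2 * (w1 * th - a * zre (cz z * w2))) by rewrite !zsE; ring.
  by rewrite dvdz_sub // dvdz_mulr.
- apply: contra h3; rewrite nz_add_mul => h.
  rewrite -(addrK (Q * (2 * zre (cz ze * w2) + Q * nz w2)) (nz ze)).
  by rewrite dvdz_sub // dvdz_mulr.
Qed.

Let hK (r : nat) : (1 < r)%N ->
  (16 * a * r%:Z) ^+ 2 * nz z < ((r ^ K.-1)%N%:Z) ^+ 2.
Proof.
move=> r1; have hz := nz_gt0 z0.
have hKr : K.-1 = (16 * absz a * absz (nz z) + 1).+1 by rewrite /K addn3 addn1.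
rewrite hKr expnS PoszM; have : (16 * absz a * absz (nz z) + 1 < r ^ (16 * absz a * absz (nz z) + 1))%N.
  exact: ltn_expl.
move: (r ^ _)%N => w hw; have {}hw : 16 * a * nz z + 1 < w%:Z by nia.
have {hKr} hw2 : (16 * a) ^+ 2 * nz z < w%:Z ^+ 2.
  move: hw a0 hz; move: (nz z) w%:Z => nu W hw a0' hz.
  have h1 : 0 < a * nu by rewrite mulr_gt0.
  have h2 : (16 * a * nu) ^+ 2 < W ^+ 2 by nia.
  apply: le_lt_trans h2; have : 1 <= nu by lia.
  rewrite [(16 * a * nu) ^+ 2]exprMn => h3; rewrite ler_wpM2l ?sqr_ge0 // expr2; nia.
have -> : (16 * a * r%:Z) ^+ 2 * nz z = r%:Z ^+ 2 * ((16 * a) ^+ 2 * nz z) by ring.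
by rewrite [X in _ < X]exprMn ltr_pM2l // exprn_gt0 //; lia.
Qed.

(** There are four candidates (m, ze): the multipliers m = 1 and m = M, each with both signs of ze.
    If all of them failed, differences would make 16 a r conj(z) ze divisible by r^(K-1), so that
    r^(2(K-1)) would divide (16 a r)^2 nz z, against [hK]. *)
Let P_ex r : prime r -> (r %| N)%N -> exists x, P r x.
Proof.
move=> pr rN; have rn := nN pr rN; have r1 := prime_gt1 pr.
have [ze hze] : exists x, ((r ^ K)%N %| n - nz x)%Z.
  case: (even_prime pr) => [->|ord]; first exact: hensel2.
  exact: hensel.
have rQ : (r %| (r ^ K)%N%:Z)%Z by rewrite dvdzE /= dvdn_exp.
have rze : ~~ (r %| nz ze)%Z.
  apply: contra rn => h; rewrite -(subrK (nz ze) n) dvdz_add //.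
  exact: dvdz_trans hze.
(* The norm M of u is prime to r and u^2 is not real, so replacing (1, ze) by (M, u^2 ze) preserves
   n m^2 = nz ze modulo r^K and tests another linear combination of the coordinates of conj(z)
   ze. *)
pose u := 1 + r%:Z%:~R * sqm2; pose M := 1 + 2 * r%:Z ^+ 2.
have hu : nz u = M by rewrite /u /nz !zsE /M; ring.
have rM : ~~ (r %| M)%Z.
  apply/negP => h; have : (r %| M - r%:Z * (2 * r%:Z))%Z.
    by rewrite dvdz_sub // dvdz_mulr ?dvdzz.
  have -> : M - r%:Z * (2 * r%:Z) = 1 by rewrite /M; ring.
  by rewrite dvdzE /= dvdn1; case: (r) r1 => [|[|]].
have P1 (s : int) : s ^+ 2 = 1 -> ~~ ((r ^ K.-1)%N %| 2 * be (1, s%:~R * ze))%Z ->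
    P r (1, s%:~R * ze).
  by move=> s1 h; split; rewrite /qq /= ?nzM ?nz_int ?s1 ?mul1r // expr1n mulr1.
have P2 (s : int) : s ^+ 2 = 1 -> ~~ ((r ^ K.-1)%N %| 2 * be (M, s%:~R * ze * u ^+ 2))%Z ->
    P r (M, s%:~R * ze * u ^+ 2).
  move=> s1 h; split => //; rewrite /qq /= !nzM nz_int s1 mul1r hu.
    have -> : n * M ^+ 2 - nz ze * (M * M) = M ^+ 2 * (n - nz ze) by ring.
    exact: dvdz_mull.
  by rewrite !Euclid_dvdz // !negb_or rze rM.
have [h1|nh1] := boolP ((r ^ K.-1)%N %| 2 * be (1, 1%:~R * ze))%Z; last by eexists; apply: (P1 _ _ nh1).
have [h2|nh2] := boolP ((r ^ K.-1)%N %| 2 * be (1, (-1)%:~R * ze))%Z; last by eexists; apply: (P1 _ _ nh2).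
have [h3|nh3] := boolP ((r ^ K.-1)%N %| 2 * be (M, 1%:~R * ze * u ^+ 2))%Z; last by eexists; apply: (P2 _ _ nh3).
have [h4|nh4] := boolP ((r ^ K.-1)%N %| 2 * be (M, (-1)%:~R * ze * u ^+ 2))%Z; last by eexists; apply: (P2 _ _ nh4).
exfalso; pose w := cz z * ze; pose L := (r ^ K.-1)%N%:Z.
have k1 : (L %| 4 * a * zre w)%Z.
  have -> : 4 * a * zre w = 2 * be (1, (-1)%:~R * ze) - 2 * be (1, 1%:~R * ze).
    by rewrite /be /w /= !zsE; ring.
  exact: dvdz_sub.
have k2 : (L %| 4 * a * ((1 - 2 * r%:Z ^+ 2) * zre w - 4 * r%:Z * zim w))%Z.
  have -> : 4 * a * ((1 - 2 * r%:Z ^+ 2) * zre w - 4 * r%:Z * zim w) =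
     2 * be (M, (-1)%:~R * ze * u ^+ 2) - 2 * be (M, 1%:~R * ze * u ^+ 2).
    by rewrite /be /w /u expr2 /= !zsE; ring.
  exact: dvdz_sub.
have k3 : (L %| 16 * a * r%:Z * zim w)%Z.
  have -> : 16 * a * r%:Z * zim w = (1 - 2 * r%:Z ^+ 2) * (4 * a * zre w) -
     4 * a * ((1 - 2 * r%:Z ^+ 2) * zre w - 4 * r%:Z * zim w) by ring.
  by rewrite dvdz_sub // dvdz_mull.
have {}k1 : (L %| 16 * a * r%:Z * zre w)%Z.
  have -> : 16 * a * r%:Z * zre w = 4 * r%:Z * (4 * a * zre w) by ring.
  exact: dvdz_mull.
have : (L ^+ 2 %| (16 * a * r%:Z) ^+ 2 * nz z * nz ze)%Z.
  have -> : (16 * a * r%:Z) ^+ 2 * nz z * nz ze =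
     (16 * a * r%:Z * zre w) ^+ 2 + 2 * (16 * a * r%:Z * zim w) ^+ 2.
    by rewrite -mulrA -[nz z]nz_cz -nzM -/w /nz; ring.
  by apply: dvdz_add; [|apply: dvdz_mull]; apply: dvdz_exp2r.
rewrite Gauss_dvdzl; last first.
  rewrite coprimezXl // coprimezE /L /= coprimeXl //.
  by rewrite prime_coprime.
have pos : 0 < (16 * a * r%:Z) ^+ 2 * nz z.
  by rewrite mulr_gt0 ?nz_gt0 // exprn_gt0 // !mulr_gt0 // ltz_nat ltnW.
move=> /dvdz_small; rewrite gtr0_norm // => /(_ (hK r1)) e.
by move: pos; rewrite e ltxx.
Qed.

(** With q the value at g = (m, 0, ze) and s twice the real part of the pairing with v, the vector q
    v - s g is, up to scaling, the reflection of v in g, hence isotropic. At each r dividing N, q is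
    divisible by a higher power of r than s; dividing by the part of s supported on N leaves z'
    congruent to - s' ze, which is prime to r. *)
Lemma local_fix : exists w1 w2 z', hq H w1 w2 = a * nz z' /\ forall r, prime r -> (r %| N)%N -> ~~ (r %| nz z')%Z.
Proof.
have [[m ze] hx] := @crt_choose _ K N P N0 P_ex P_periodic.
set s := 2 * be (m, ze); set q := a * qq (m, ze).
pose pi : nat_pred := \pi(N).
have s0 : s != 0.
  have [_ h _] := hx 2%N isT N2; apply: contra h => /eqP h.
  by rewrite -/s h dvdz0.
pose sN := ((absz s)`_pi)%N; pose s' := sgz s * ((absz s)`_pi^')%N%:Z.
have s0n : (0 < absz s)%N by rewrite absz_gt0.
have hs' : s = sN%:Z * s'.
  by rewrite {1}(intEsg s) -{1}(partnC pi s0n) PoszM /s' /sN; ring.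
have sN0 : (0 < sN)%N by rewrite part_gt0.
have rs' r : prime r -> (r %| N)%N -> ~~ (r %| s')%Z.
  move=> pr rN; rewrite dvdzE abszM absz_sg s0 mul1n /=; apply/negP => h.
  have := part_pnat pi^' (absz s) => /pnatP; rewrite part_gt0 => /(_ isT r pr h).
  by rewrite inE /= mem_primes pr N0 rN.
have log_lt r : prime r -> (r %| N)%N -> (logn r sN < K.-1)%N.
  move=> pr rN; have [_ h _] := hx r pr rN.
  rewrite ltnNge; apply: contra h => h.
  rewrite -/s dvdzE /=; apply: dvdn_trans (_ : sN %| _)%N; last by rewrite dvdn_part.
  by rewrite pfactor_dvdn.
(* A prime p dividing N occurs in s to an order below K - 1 and in q to an order at least K, which
   leaves room for one further factor r. *)
have rsNq r : prime r -> (r %| N)%N -> (sN * r %| absz q)%N.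
  move=> pr rN; have r0 := prime_gt0 pr.
  apply/dvdn_partP; first by rewrite muln_gt0 sN0.
  move=> p; rewrite mem_primes => /and3P[pp _ pd]; rewrite p_part.
  have pN : (p %| N)%N.
    move: pd; rewrite Euclid_dvdM // => /orP[h|]; last by rewrite dvdn_prime2 // => /eqP ->.
    have := part_pnat pi (absz s) => /pnatP; rewrite part_gt0 => /(_ isT p pp h).
    by rewrite mem_primes => /and3P[].
  have [h _ _] := hx p pp pN.
  apply: dvdn_trans (_ : p ^ K %| _)%N; last first.
    by rewrite -[X in (_ %| X)%N]/(absz q) -[(_ %| _)%N]/(((p ^ K)%N %| q)%Z) dvdz_mull.
  rewrite dvdn_exp2l // lognM //; have := log_lt p pp pN.
  have l1 : (logn p r <= 1)%N by rewrite logn_prime //; case: (_ == _).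
  by move=> /ltnW l2; rewrite (leq_trans (leq_add l2 l1)) // addn1 prednK.
have /dvdnP[q1 hq1] : (sN %| absz q)%N.
  by apply: dvdn_trans (rsNq 2%N isT N2); rewrite dvdn_mulr.
pose q' := sgz q * q1%:Z.
have hq' : q = sN%:Z * q' by rewrite {1}(intEsg q) hq1 PoszM /q'; ring.
have rq' r : prime r -> (r %| N)%N -> (r %| q')%Z.
  move=> pr rN; have := rsNq r pr rN; rewrite hq1 mulnC dvdn_pmul2r // => h.
  by rewrite dvdz_mull // dvdzE.
have key : hq H (q%:~R * v1 + (- s)%:~R * m%:~R) (q%:~R * v2 + (- s)%:~R * 0)
   = a * nz (q%:~R * z + (- s)%:~R * ze).
  apply: isotropic_comb => //=.
  set tau := ts _ _ _ _ _ _ _ _.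
  have htau : tau + cz tau = s%:~R.
    rewrite -zre2; congr _%:~R; rewrite /s /be [(_, _).1]/= [(_, _).2]/= /tau /ts.
    have -> : hs H v1 v2 m%:~R 0 = m%:~R * hs H v1 v2 1 0 by rewrite /hs; ring.
    by rewrite !zsE; ring.
  have hg : hq H m%:~R 0 - a * nz ze = q.
    by rewrite /hq /= mulr0 nz_int mulr0 nz0 /q /qq /=; ring.
  rewrite hg !rmorph_int.
  transitivity (q%:~R * (- s)%:~R * (tau + cz tau - s%:~R)); last by rewrite htau; ring.
  by rewrite rmorphN /=; ring.
pose w1 := q'%:~R * v1 - s'%:~R * m%:~R; pose w2 := q'%:~R * v2.
pose z' := q'%:~R * z - s'%:~R * ze.
exists w1, w2, z'; split.
  have sNz : sN%:Z ^+ 2 != 0 by rewrite expf_neq0 // eqz_nat -lt0n.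
  apply: (mulfI sNz).
  have hsc : hq H (sN%:Z%:~R * w1) (sN%:Z%:~R * w2) = sN%:Z ^+ 2 * hq H w1 w2.
    apply: zs_intr_inj; rewrite intrM !hqE rmorphXn /= /hs !rmorphM /= rmorph_int.
    by ring.
  rewrite -hsc [RHS]mulrCA -[sN%:Z ^+ 2]nz_int -nzM.
  have -> : sN%:Z%:~R * w1 = q%:~R * v1 + (- s)%:~R * m%:~R.
    by rewrite /w1 hq' hs' rmorphN /= !intrM; ring.
  have -> : sN%:Z%:~R * w2 = q%:~R * v2 + (- s)%:~R * 0.
    by rewrite /w2 hq' !intrM; ring.
  by rewrite key /z' hq' hs' rmorphN /= !intrM; congr (_ * nz _); ring.
move=> r pr rN; have [_ _ h] := hx r pr rN.
have /dvdzP[k hk] := rq' r pr rN.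
have -> : z' = - (s'%:~R * ze) + (k%:~R * z) * r%:Z%:~R.
  by rewrite /z' hk intrM; ring.
rewrite nz_add_mul nzN nzM nz_int; apply/negP => h'.
have : (r %| s' ^+ 2 * nz ze)%Z.
  set t := r%:Z * _ in h'; rewrite -(addrK t (s' ^+ 2 * nz ze)) dvdz_sub //.
  by rewrite /t dvdz_mulr ?dvdzz.
by rewrite Euclid_dvdz // (negbTE h) orbF expr2 Euclid_dvdz // orbb; apply/negP; apply: rs'.
Qed.

End LocalFix.

(** * Primitive isotropic vectors *)

Lemma prime_norm (p : nat) (z : zs) : prime p -> (p %| nz z)%Z ->
  ~ zdvd p%:Z%:~R z -> exists pi, nz pi = p.
Proof.
move=> pp pz nz_z.
have [g [u [v [x [y [hg hx hy]]]]]] := zs_bezout p%:Z%:~R z.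
have hn : p%:Z ^+ 2 = nz x * nz g by rewrite -nzM -hx nz_int.
have : (absz (nz g) %| p ^ 2)%N.
  by have -> : (p ^ 2)%N = absz (p%:Z ^+ 2); [rewrite abszX|rewrite hn abszM dvdn_mull].
case/(dvdn_pfactor _ _ pp) => i i2 hm.
(* The gcd g of p and z has norm 1, p or p^2. Norm 1 would make p divide conj(z), and norm p^2 would
   make p an associate of g, a divisor of z; only norm p remains. *)
have {hm} : nz g = (p ^ i)%N%:Z by rewrite -absz_nz hm.
case: i i2 => [|[|[|//]]] _ hm.
- have cop := zcoprime_gcd1 hg hm.
  case: nz_z; rewrite -[z]czK; rewrite -[p%:Z%:~R]czK cz_int; apply: zdvd_cz.
  rewrite -[p%:Z%:~R]cz_int cz_int.
  by apply: zcoprime_dvd cop _; rewrite -nzE; apply: zdvd_int.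
- by exists g; rewrite hm expn1.
have p0 : p%:Z != 0 by rewrite eqz_nat -lt0n prime_gt0.
have /nz_eq1_unit x1 : nz x = 1.
  by move: hn; rewrite hm -mulnn PoszM; nia.
case: nz_z; exists (y * cz x); rewrite hx hy -[in LHS](mul1r g) -x1; ring.
Qed.

(** After division by the gcd, g1 is prime to z1 and divides nz z1, hence divides conj(z1); the
    quotient has norm h. *)
Lemma norm_quot (g z : zs) (h : int) : nz g * h = nz z -> g != 0 ->
  exists w, h = nz w.
Proof.
move=> e g0; have [d [u [v [g1 [z1 [hd hg hz]]]]]] := zs_bezout g z.
have d0 : d != 0 by apply: contraNneq g0 => d0; rewrite hg d0 mulr0.
have g10 : g1 != 0 by apply: contraNneq g0 => d1; rewrite hg d1 mul0r.
have cop : zcoprime g1 z1.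
  exists u, v; apply: (zs_mulfI d0); rewrite mulr1 [in RHS]hd hg hz; ring.
have e1 : nz g1 * h = nz z1.
  have := nz_gt0 d0; move: e; rewrite hg hz !nzM => e n0.
  apply: (mulIf (lt0r_neq0 n0)); rewrite -e; ring.
have [w hw] : zdvd g1 (cz z1).
  apply: zcoprime_dvd cop _; exists (cz g1 * h%:~R).
  rewrite -nzE -e1 intrM nzE; ring.
exists w; apply: (mulfI (lt0r_neq0 (nz_gt0 g10))).
by rewrite e1 mulrC -nzM -hw nz_cz.
Qed.

Definition adiv (a : int) (H : hform) := forall u1 u2, (a %| hq H u1 u2)%Z.

Lemma hq_scale H g u1 u2 : hq H (u1 * g) (u2 * g) = nz g * hq H u1 u2.
Proof.
apply: zs_intr_inj; rewrite intrM !hqE nzE /hs !rmorphM /=; ring.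
Qed.

Lemma zs_coprime_part u1 u2 : (u1 != 0) || (u2 != 0) ->
  exists g u1' u2', [/\ g != 0, u1 = u1' * g, u2 = u2' * g & zcoprime u1' u2'].
Proof.
move=> nt; have [g [u [v [x [y [hg hx hy]]]]]] := zs_bezout u1 u2.
have g0 : g != 0.
  by apply: contraTneq nt => g0; rewrite hx hy g0 !mulr0 eqxx.
exists g, x, y; split=> //; exists u, v.
by apply: (zs_mulfI g0); rewrite mulr1 [in RHS]hg hx hy; ring.
Qed.

Lemma hq00 H : hq H 0 0 = 0.
Proof. by apply: zs_intr_inj; rewrite hqE /hs rmorph0; ring. Qed.

(** The gcd g of the first two coordinates may fail to divide z, but the value left after dividing
    by it is a nz z / nz g, which [norm_quot] shows to be a times a norm again. *)
Lemma coprime_iso (H : hform) (a : int) (v1 v2 z : zs) : 0 < a -> adiv a H ->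
  hq H v1 v2 = a * nz z -> z != 0 ->
  exists w1 w2 w, [/\ zcoprime w1 w2, hq H w1 w2 = a * nz w & (nz w %| nz z)%Z].
Proof.
move=> a0 ad e z0.
have nt : (v1 != 0) || (v2 != 0).
  apply/negPn; rewrite negb_or !negbK; apply/negP => /andP[/eqP h1 /eqP h2].
  move: e; rewrite h1 h2 hq00 => /esym/eqP.
  by rewrite mulf_eq0 (gt_eqF a0) nz_eq0 (negbTE z0).
have [g [w1 [w2 [g0 h1 h2 cop]]]] := zs_coprime_part nt.
have /dvdzP[h hh] := ad w1 w2.
have e1 : nz g * h = nz z.
  apply: (mulfI (lt0r_neq0 a0)); rewrite -e h1 h2 hq_scale hh; ring.
have [w hw] := norm_quot e1 g0.
exists w1, w2, w; split=> //; first by rewrite hh hw mulrC.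
by rewrite -e1 hw dvdz_mull ?dvdzz.
Qed.

(** A family of isotropic vectors in the plane of v and g, with free real parameters l and m: the
    terms in m cancel because ga tau is purely imaginary, and the term in q of al offsets the value
    q at g. *)
Lemma plane_comb (l m q tau : zs) : cz l = l -> cz m = m -> cz q = q ->
  let al := m - l * sqm2 * q in let ga := 2 * l * sqm2 * cz tau in
  cz al * ga * tau + al * cz ga * cz tau + ga * cz ga * q = 0.
Proof.
move=> hl hm hq /=.
by rewrite rmorphB !rmorphM /= !czK hl hm hq cz_sqm2 rmorph_nat; ring.
Qed.

Section Primitive.
Variables (D : nat) (a : int) (H : hform).
Hypotheses (D0 : (0 < D)%N) (hD : hdisc H = D) (a0 : 0 < a) (ad : adiv a H).
Variables (v1 v2 z : zs).
Hypotheses (cop : zcoprime v1 v2) (hv : hq H v1 v2 = a * nz z).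
Hypothesis hz : forall r, prime r -> (r %| 2 * D)%N -> ~~ (r %| nz z)%Z.

Let z0 : z != 0.
Proof.
by have := hz (r := 2) isT (dvdn_mulr _ (dvdnn 2)); apply: contraNneq => ->.
Qed.

(* d generates the ideal of values of h(v, -), which contains D since v is primitive. *)
Let functional : exists d g1 g2, hs H v1 v2 g1 g2 = d /\
  forall r, prime r -> ~~ (r %| 2 * D)%N -> ~ zdvd r%:Z%:~R d.
Proof.
pose e1 := hs H v1 v2 1 0; pose e2 := hs H v1 v2 0 1.
have [d [u [w [x [y [hd hx hy]]]]]] := zs_bezout e1 e2.
exists d, u, w; split.
  by rewrite hd /e1 /e2 /hs; ring.
move=> r pr rD rd.
have h1 : zdvd r%:Z%:~R (cz e1).
  by rewrite hx rmorphM; apply: zdvd_mull; rewrite -[r%:Z%:~R]cz_int; apply: zdvd_cz.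
have h2 : zdvd r%:Z%:~R (cz e2).
  by rewrite hy rmorphM; apply: zdvd_mull; rewrite -[r%:Z%:~R]cz_int; apply: zdvd_cz.
have hDz : D%:Z%:~R = fB H * cz (fB H) - (fA H)%:~R * (fC H)%:~R by rewrite -hD hdiscE.
have k1 : zdvd r%:Z%:~R (D%:Z%:~R * v1).
  have -> : D%:Z%:~R * v1 = fB H * cz e2 - (fC H)%:~R * cz e1.
    by rewrite hDz /e1 /e2 !hs_sym /hs !rmorph0 !rmorph1; ring.
  by apply: zdvdB; apply: zdvd_mull.
have k2 : zdvd r%:Z%:~R (D%:Z%:~R * v2).
  have -> : D%:Z%:~R * v2 = cz (fB H) * cz e1 - (fA H)%:~R * cz e2.
    by rewrite hDz /e1 /e2 !hs_sym /hs !rmorph0 !rmorph1; ring.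
  by apply: zdvdB; apply: zdvd_mull.
have [s [t hst]] := cop.
have : zdvd r%:Z%:~R D%:Z%:~R.
  have -> : D%:Z%:~R = s * (D%:Z%:~R * v1) + t * (D%:Z%:~R * v2).
    by rewrite -[LHS]mulr1 -hst; ring.
  by apply: zdvdD; apply: zdvd_mull.
move/zdvd_intP => []; rewrite zreZ dvdzE /= => rD' _.
by move: rD; rewrite Euclid_dvdM // rD' orbT.
Qed.

Lemma dvdz_prod_mem (s : seq nat) (r : nat) : prime r -> (forall q, q \in s -> prime q) ->
  (r %| \prod_(q <- s) q)%N = (r \in s).
Proof.
move=> pr hs; elim: s hs => [|q s IH] hs.
  by rewrite big_nil dvdn1 in_nil; case: r pr => [|[|]].
have pq : prime q by apply: hs; apply: mem_head.
have ps : forall t, t \in s -> prime t by move=> t ts; apply: hs; rewrite inE ts orbT.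
by rewrite big_cons Euclid_dvdM // dvdn_prime2 // IH // inE.
Qed.

(** With l = 2 D in [plane_comb], the last coordinate is z' = m z + 2 D om. At primes dividing 2 D
    it reduces to m z. Moreover Im(conj(z) z') = 2 D kap does not depend on m, so other rational
    primes dividing z' must divide kap; m is the product of those among them that do not divide om.
    A prime that divides nz z' without dividing z' is a norm. *)
Lemma primitive_value : exists w1 w2 (n : nat), [/\ zcoprime w1 w2,
  hq H w1 w2 = a * n%:Z, (0 < n)%N &
  forall p, prime p -> (p %| n)%N -> ~~ (p %| 2 * D)%N /\ exists pi, nz pi = p].
Proof.
have [d [g1 [g2 [hd hdr]]]] := functional.
pose S := hq H g1 g2; pose nu := nz z; pose rho := zre (d * z).
pose kap (k : int) := 2 * k * rho - (S + a * k ^+ 2) * nu.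
have nu0 : 0 < nu by exact: nz_gt0.
(* If kap vanishes at both 1 and -1, then rho = 0 and S = - a, and kap 2 is -3 a nu. *)
have [k k2 kap0] : exists2 k : int, k = 1 \/ k = -1 \/ k = 2 & kap k != 0.
  have [h1|h1] := eqVneq (kap 1) 0; last by exists 1; [left|].
  have [h2|h2] := eqVneq (kap (-1)) 0; last by exists (-1); [right; left|].
  exists 2; first by right; right.
  have h3 : rho = 0 by move: h1 h2; rewrite /kap; lia.
  have h4 : (S + a) * nu = 0 by move: h1; rewrite /kap h3; lia.
  have {}h4 : S = - a.
    by move/eqP: h4; rewrite mulf_eq0 (gt_eqF nu0) orbF => /eqP; lia.
  have -> : kap 2 = - (3 * a * nu) by rewrite /kap h3 h4; ring.
  by rewrite oppr_eq0 !mulf_neq0 // gt_eqF.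
pose om := sqm2 * (2 * k%:~R * cz d - (S + a * k ^+ 2)%:~R * z).
pose bad := [seq r <- primes (absz (kap k)) |
  ~~ (r %| 2 * D)%N && ~~ ((r %| zre om)%Z && (r %| zim om)%Z)].
pose m := (\prod_(r <- bad) r)%N.
have mbad r : prime r -> (r %| m)%N = [&& (r %| absz (kap k))%N, ~~ (r %| 2 * D)%N &
    ~~ ((r %| zre om)%Z && (r %| zim om)%Z)].
  move=> pr; rewrite /m dvdz_prod_mem //; last first.
    by move=> q; rewrite mem_filter mem_primes => /andP[_ /and3P[]].
  by rewrite mem_filter mem_primes pr absz_gt0 kap0 /= andbC.
pose z' := m%:Z%:~R * z + (2 * D)%N%:Z%:~R * om.
pose tau := ts H a v1 v2 z g1 g2 k%:~R.
pose q := hq H g1 g2 - a * nz k%:~R.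
have [l hlE hl] : exists2 l : zs, l = (2 * D)%N%:Z%:~R & cz l = l.
  by exists (2 * D)%N%:Z%:~R; rewrite ?cz_int.
pose al := m%:Z%:~R - l * sqm2 * q%:~R.
pose ga := 2 * l * sqm2 * cz tau.
have key : hq H (al * v1 + ga * g1) (al * v2 + ga * g2) = a * nz (al * z + ga * k%:~R).
  by apply: isotropic_comb => //=; apply: plane_comb; rewrite ?cz_int.
have hz' : al * z + ga * k%:~R = z'.
  have htau : cz tau = cz d - a%:~R * (z * k%:~R).
    by rewrite /tau /ts hd rmorphB !rmorphM /= czK !rmorph_int.
  rewrite /al /ga /z' htau -hlE /om.
  have -> : q%:~R = S%:~R - a%:~R * k%:~R ^+ 2 :> zs by rewrite /q nz_int intrB intrM rmorphXn.
  have -> : (S + a * k ^+ 2)%:~R = S%:~R + a%:~R * k%:~R ^+ 2 :> zs by rewrite intrD intrM rmorphXn.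
  by ring.
rewrite hz' in key.
have good r : prime r -> (r %| 2 * D)%N -> ~~ (r %| nz z')%Z.
  move=> pr rD; apply/negP => h.
  have /dvdnP[t ht] := rD.
  have : (r %| m%:Z ^+ 2 * nz z)%Z.
    have e : nz z' = m%:Z ^+ 2 * nz z + r%:Z * (2 * zre (cz (m%:Z%:~R * z) * (t%:Z%:~R * om)) + r%:Z * nz (t%:Z%:~R * om)).
      rewrite /z' ht PoszM intrM.
      have -> : m%:Z%:~R * z + t%:Z%:~R * r%:Z%:~R * om = m%:Z%:~R * z + (t%:Z%:~R * om) * r%:Z%:~R by ring.
      by rewrite nz_add_mul nzM nz_int.
    move: h; rewrite e; set Y := r%:Z * _ => h.
    by rewrite -(addrK Y (m%:Z ^+ 2 * nz z)) dvdz_sub // /Y dvdz_mulr ?dvdzz.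
  rewrite Euclid_dvdz // (negbTE (hz pr rD)) orbF expr2 Euclid_dvdz // orbb dvdzE /=.
  by rewrite mbad // rD andbF.
have prim r : prime r -> ~~ (r %| 2 * D)%N -> ~ zdvd r%:Z%:~R z'.
  move=> pr rD h.
  have nl x : zdvd r%:Z%:~R ((2 * D)%N%:Z%:~R * x) -> zdvd r%:Z%:~R x.
    by apply: zcoprime_dvd; apply: zcoprime_int; rewrite coprimezE prime_coprime.
  have [rm|rm] := boolP (r %| m)%N.
    move: (rm); rewrite mbad // => /and3P[_ _ /negP]; case.
    apply/andP; apply/zdvd_intP; apply: nl.
    have -> : (2 * D)%N%:Z%:~R * om = z' - m%:Z%:~R * z by rewrite /z'; ring.
    apply: zdvdB h _; apply: zdvd_mulr; exact: zdvd_int.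
  have rk : (r %| kap k)%Z.
    have : zdvd r%:Z%:~R ((2 * D)%N%:Z%:~R * (kap k)%:~R).
      have [y hy] := h.
      have e : zim (cz z * z') = (2 * D)%N%:Z * kap k.
        have e2 : 2 = 2%:Z%:~R :> zs by [].
        by rewrite /z' /om /kap /rho /nu /nz e2 !zsE; ring.
      rewrite -intrM -e hy.
      have -> : zim (cz z * (y * r%:Z%:~R)) = r%:Z * zim (cz z * y) by rewrite !zsE; ring.
      by apply: zdvd_int; rewrite dvdz_mulr ?dvdzz.
    by move=> /nl /zdvd_intP[]; rewrite zreZ.
  (* A prime dividing kap but not m divides om. Dividing z' too, it would divide z and then d, which
     [functional] excludes. *)
  have rom : zdvd r%:Z%:~R om.
    move: rm; rewrite mbad // rD -[(r %| absz _)%N]/(r %| kap k)%Z rk /= negbK.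
    by case/andP=> h1 h2; apply: (iffRL (zdvd_intP _ _)); split.
  have nm x : zdvd r%:Z%:~R (m%:Z%:~R * x) -> zdvd r%:Z%:~R x.
    by apply: zcoprime_dvd; apply: zcoprime_int; rewrite coprimezE prime_coprime.
  have rz : zdvd r%:Z%:~R z.
    apply: nm; have -> : m%:Z%:~R * z = z' - (2 * D)%N%:Z%:~R * om by rewrite /z'; ring.
    by apply: zdvdB h _; apply: zdvd_mull.
  have r2 : coprimez r 4.
    rewrite coprimezE prime_coprime //; apply: contra rD => /=.
    by rewrite (Euclid_dvdX 2 2) // => /andP[h2 _]; rewrite dvdn_mulr.
  have rd : zdvd r%:Z%:~R (4%:Z%:~R * (k%:~R * cz d)).
    have -> : 4%:Z%:~R * (k%:~R * cz d) =
       2 * ((S + a * k ^+ 2)%:~R * z) - sqm2 * om.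
      rewrite /om [sqm2 * (sqm2 * _)]mulrA sqm2_sqr -[4%:Z%:~R]/(4%:R); ring.
    by apply: zdvdB; [apply: zdvd_mull; apply: zdvd_mull|apply: zdvd_mull].
  have {}rd := zcoprime_dvd (zcoprime_int r2) rd.
  have rk2 : coprimez r k.
    have := r2; rewrite (_ : 4 = 2 * 2) // coprimezMr andbb.
    by case: k2 => [|[|]] -> //; rewrite ?coprimezN // => _; rewrite /coprimez gcdz1.
  have {}rd := zcoprime_dvd (zcoprime_int rk2) rd.
  apply: (hdr r pr rD); rewrite -[d]czK -[r%:Z%:~R]cz_int; exact: zdvd_cz.
have z'0 : z' != 0.
  by have := good 2%N isT (dvdn_mulr _ (dvdnn 2)); apply: contraNneq => ->.
have [w1 [w2 [w [cw hw dw]]]] := coprime_iso a0 ad key z'0.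
exists w1, w2, (absz (nz w)); split=> //; first by rewrite absz_nz.
  by rewrite absz_gt0; apply: contraNneq z'0 => e; rewrite -nz_eq0 -dvd0z -e.
move=> p pp pw; have pz' : (p %| nz z')%Z by apply: dvdz_trans dw; rewrite dvdzE.
have pD : ~~ (p %| 2 * D)%N by apply: contraL pz'; apply: good.
by split=> //; apply: prime_norm pz' _ => //; apply: prim.
Qed.

End Primitive.

(** * Reduction of primitive Hermitian forms *)

Definition zprim (H : hform) := forall r : nat, prime r ->
  ~ [/\ (r %| fA H)%Z, zdvd r%:Z%:~R (fB H) & (r %| fC H)%Z].

Lemma zprim_neg H : zprim H -> zprim (hneg H).
Proof.
move=> h r pr [/= h1 h2 h3]; apply: (h r pr); split.
- by rewrite -[fA H]opprK dvdz_opp.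
- by rewrite -[fB H]opprK; apply: zdvdN.
- by rewrite -[fC H]opprK dvdz_opp.
Qed.

Lemma zprim_equiv H H' : hequiv H H' -> zprim H -> zprim H'.
Proof.
move=> /hequiv_sym[p [q [r [s [_ e]]]]] h t pt [h1 h2 h3]; apply: (h t pt).
have hsd u1 u2 v1 v2 : zdvd t%:Z%:~R (hs H' u1 u2 v1 v2).
  rewrite /hs; apply: zdvdD; [apply: zdvdD; [apply: zdvdD|]|]; apply: zdvd_mulr => //.
  - exact: zdvd_int.
  - by rewrite -[t%:Z%:~R]cz_int; apply: zdvd_cz.
  - exact: zdvd_int.
have hqd u1 u2 : (t %| hq H' u1 u2)%Z.
  by have := hsd u1 u2 u1 u2; rewrite -hqE => /zdvd_intP[]; rewrite zreZ.
by rewrite e; split=> /=.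
Qed.

Lemma adiv_equiv a H H' : hequiv H H' -> adiv a H -> adiv a H'.
Proof.
move=> [p [q [r [s [_ ->]]]]] h u1 u2.
have -> : hq (hact H p q r s) u1 u2 = hq H (p * u1 + q * u2) (r * u1 + s * u2).
  by apply: zs_intr_inj; rewrite !hqE hs_lin.
exact: h.
Qed.

Lemma adiv_neg a H : adiv a H -> adiv a (hneg H).
Proof. by move=> h u1 u2; rewrite hq_neg dvdz_opp. Qed.

Lemma hq_shift H u1 u2 w1 w2 (r : int) :
  hq H (u1 + w1 * r%:~R) (u2 + w2 * r%:~R) =
  hq H u1 u2 + r * (hq H (u1 + w1) (u2 + w2) - hq H u1 u2 - hq H w1 w2)
   + r ^+ 2 * hq H w1 w2.
Proof.
apply: zs_intr_inj; rewrite [LHS]hqE.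
move: (hqE H u1 u2) (hqE H w1 w2) (hqE H (u1 + w1) (u2 + w2)).
move: (hq H u1 u2) (hq H w1 w2) (hq H _ _) => X Y Z hX hY hZ.
rewrite expr2 intrD intrD intrM intrM intrM intrB intrB hX hY hZ /hs.
by rewrite !rmorphD !rmorphM /= rmorph_int; ring.
Qed.

Lemma value_coprime H (a : int) (N : nat) : 0 < a -> adiv a H -> (0 < N)%N ->
  (2 %| N)%N ->
  (forall r, prime r -> (r %| N)%N -> exists u1 u2, ~~ (a * r%:Z %| hq H u1 u2)%Z) ->
  exists w1 w2 n, [/\ zcoprime w1 w2, hq H w1 w2 = a * n &
    forall r, prime r -> (r %| N)%N -> ~~ (r %| n)%Z].
Proof.
move=> a0 ad N0 N2 ex.
have [|r [u1 u2] [w1 w2] h|[u1 u2] hu] := @crt_choose (zs * zs)%type 1 N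
   (fun r u => ~~ (a * r%:Z %| hq H u.1 u.2)%Z) N0.
- by move=> r pr rN; have [u1 [u2 h]] := ex r pr rN; exists (u1, u2).
- have -> : (u1, u2) + (w1, w2) *~ (r ^ 1)%N = (u1 + w1 * r%:Z%:~R, u2 + w2 * r%:Z%:~R).
    have -> : (w1, w2) *~ (r ^ 1)%N = (w1 *~ (r ^ 1)%N, w2 *~ (r ^ 1)%N).
      by rewrite -!pmulrn; elim: (r ^ 1)%N => // k IH; rewrite !mulrS IH.
    by rewrite expn1 [w1 *~ _]zs_mulrz [w2 *~ _]zs_mulrz.
  apply: contra h => /=; rewrite hq_shift => h.
  set X := hq H (u1 + w1) _ - _ - _ in h; set Y := hq H w1 w2 in h.
  have -> : hq H u1 u2 = (hq H u1 u2 + r%:Z * X + r%:Z ^+ 2 * Y) - (r%:Z * X + r%:Z ^+ 2 * Y) by ring.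
  rewrite dvdz_sub // dvdz_add //.
    by rewrite mulrC dvdz_mul ?dvdzz // !dvdz_sub // ad.
  by rewrite expr2 -mulrA mulrCA mulrC dvdz_mul ?dvdzz // dvdz_mull // ad.
rewrite /= in hu.
have nt : (u1 != 0) || (u2 != 0).
  apply/negPn; rewrite negb_or !negbK; apply/negP => /andP[/eqP h1 /eqP h2].
  by have := hu 2%N isT N2; rewrite h1 h2 hq00 dvdz0.
have [g [w1 [w2 [g0 h1 h2 cop]]]] := zs_coprime_part nt.
have /dvdzP[n hn] := ad w1 w2.
exists w1, w2, n; split=> //; first by rewrite hn mulrC.
move=> r pr rN; have := hu r pr rN; apply: contra => rn.
rewrite h1 h2 hq_scale dvdz_mull // hn mulrC dvdz_mul ?dvdzz //.
Qed.

Lemma hq10 H : hq H 1 0 = fA H.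
Proof. by rewrite /hq mulr0 mulr0 nz0 nz1 /=; ring. Qed.
Lemma hq01 H : hq H 0 1 = fC H.
Proof. by rewrite /hq rmorph0 mul0r mulr0 nz0 nz1 /=; ring. Qed.
Lemma hq1w H w : hq H 1 w = fA H + 2 * zre (fB H * w) + fC H * nz w.
Proof. by rewrite /hq rmorph1 mul1r nz1; ring. Qed.

Lemma adivP a H : (a %| fA H)%Z -> (a %| fC H)%Z ->
  (a %| 2 * zre (fB H))%Z -> (a %| 4)%Z -> adiv a H.
Proof.
move=> hA hC hB h4 u1 u2; rewrite /hq; apply: dvdz_add; [apply: dvdz_add|];
  [exact: dvdz_mulr| |exact: dvdz_mulr].
move: (cz u1 * u2) => w.
have -> : 2 * zre (fB H * w) = 2 * zre (fB H) * zre w - 4 * (zim (fB H) * zim w).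
  by rewrite !zsE; ring.
by apply: dvdz_sub; apply: dvdz_mulr.
Qed.

Lemma mod_cases (m k : int) : 0 < k -> exists q r, m = q * k + r /\ 0 <= r < k.
Proof.
move=> k0; exists (m %/ k)%Z, (m %% k)%Z; rewrite -divz_eq modz_ge0 ?gt_eqF //.
by rewrite ltz_pmod.
Qed.

(** Here a is the highest power of 2 dividing all values. If 4 divides A and C and 2 divides Re B,
    primitivity makes Im B odd, and then A, C and the value at (1, sqrt(-2)) cannot all be divisible
    by 8. *)
Lemma form_type H : zprim H -> exists a : int, [/\ a = 1 \/ a = 2 \/ a = 4, adiv a H
  & exists u1 u2, ~~ (a * 2 %| hq H u1 u2)%Z].
Proof.
case: H => A B C pr.
have [hA|hA] := boolP (2 %| A)%Z; last first.
  exists 1; split; [by left|by move=> *; rewrite dvd1z|].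
  by exists 1, 0; rewrite hq10 mul1r.
have [hC|hC] := boolP (2 %| C)%Z; last first.
  exists 1; split; [by left|by move=> *; rewrite dvd1z|].
  by exists 0, 1; rewrite hq01 mul1r.
have p2 : ~ ((2 %| zre B)%Z /\ (2 %| zim B)%Z).
  by move=> h; apply: (pr 2%N isT); split=> //; apply: (iffRL (zdvd_intP _ _)).
have a2 : adiv 2 (HForm A B C) by apply: adivP => //=; rewrite dvdz_mulr ?dvdzz.
have [hA4|hA4] := boolP (4 %| A)%Z; last first.
  by exists 2; split; [right; left| |exists 1, 0; rewrite hq10].
have [hC4|hC4] := boolP (4 %| C)%Z; last first.
  by exists 2; split; [right; left| |exists 0, 1; rewrite hq01].
have [hB|hB] := boolP (2 %| zre B)%Z; last first.
  exists 2; split; [by right; left|by []|].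
  exists 1, 1; rewrite hq1w mulr1 nz1 mulr1 /=; apply: contra hB.
  move: hA4 hC4 => /dvdzP[x ->] /dvdzP[y ->] /dvdzP[t ht].
  by apply/dvdzP; exists (t - x - y); lia.
have hB2 : ~~ (2 %| zim B)%Z by apply/negP => h; apply: p2; split.
exists 4; split; first by right; right.
  apply: adivP => //=.
  by move: hB => /dvdzP[x ->]; apply/dvdzP; exists x; ring.
have [hA8|hA8] := boolP (8 %| A)%Z; last by exists 1, 0; rewrite hq10.
have [hC8|hC8] := boolP (8 %| C)%Z; last by exists 0, 1; rewrite hq01.
exists 1, sqm2; rewrite hq1w nz_sqm2 !zsE /=; apply: contra hB2.
move: hA8 hC8 => /dvdzP[x ->] /dvdzP[y ->] /dvdzP[t ht].
by apply/dvdzP; exists (x + 2 * y - t); lia.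
Qed.

(** The values at (1, 0), (0, 1), (1, 1) and (1, sqrt(-2)) determine A, C, 2 Re B and 4 Im B, so an
    odd prime dividing all four would divide the form. *)
Lemma odd_value H (a : int) r : zprim H -> a = 1 \/ a = 2 \/ a = 4 ->
  prime r -> odd r -> exists u1 u2, ~~ (a * r%:Z %| hq H u1 u2)%Z.
Proof.
move=> pH ha pr ord.
have [h1|h1] := boolP (a * r%:Z %| hq H 1%R 0%R)%Z; last by exists 1, 0.
have [h2|h2] := boolP (a * r%:Z %| hq H 0%R 1%R)%Z; last by exists 0, 1.
have [h3|h3] := boolP (a * r%:Z %| hq H 1%R 1%R)%Z; last by exists 1, 1.
have [h4|h4] := boolP (a * r%:Z %| hq H 1%R sqm2)%Z; last by exists 1, sqm2.
have rd x : (a * r%:Z %| x)%Z -> (r %| x)%Z.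
  by apply: dvdz_trans; rewrite dvdz_mull ?dvdzz.
have r2 : coprimez r 2.
  rewrite coprimezE prime_coprime //; apply/negP => /dvdn_leq => /(_ isT) /= h.
  by case: (r) pr ord h => [|[|[|]]].
case: (pH r pr); have hA := rd _ h1; have hC := rd _ h2; rewrite hq10 in hA; rewrite hq01 in hC.
split=> //; apply: (iffRL (zdvd_intP _ _)); split.
  rewrite -(Gauss_dvdzr _ r2).
  have -> : 2 * zre (fB H) = hq H 1 1 - fA H - fC H by rewrite hq1w nz1 mulr1; ring.
  by rewrite !dvdz_sub // rd.
have r4 : coprimez r (2 * 2) by rewrite coprimezMr r2.
rewrite -(Gauss_dvdzr _ r4).
have -> : 2 * 2 * zim (fB H) = fA H + fC H * 2 - hq H 1 sqm2.
  by rewrite hq1w nz_sqm2 !zsE /=; ring.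
by apply: dvdz_sub; [apply: dvdz_add => //; apply: dvdz_mulr|apply: rd].
Qed.

Lemma form_to_type (R : archiRcfType) (D : nat) H : (0 < D)%N -> hdisc H = D ->
  zprim H -> exists (a : int) B C (e : bool), [/\ a = 1 \/ a = 2 \/ a = 4,
    adiv a (HForm a B C) & hequiv (if e then hneg H else H) (HForm a B C)].
Proof.
move=> D0 hD pH; have [a [ha ad [u1 [u2 hu]]]] := form_type pH.
have a0 : 0 < a by case: ha => [->|[->|->]].
have N0 : (0 < 2 * D)%N by rewrite muln_gt0.
have N2 : (2 %| 2 * D)%N by rewrite dvdn_mulr.
have [|w1 [w2 [n [cop hn nN]]]] := value_coprime a0 ad N0 N2.
  move=> r pr rN; case: (even_prime pr) => [->|ord]; first by exists u1, u2.
  exact: odd_value.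
(* An odd n is 1 or 3 modulo 8 up to sign, as [hensel2] requires; changing its sign means passing to
   the negative of H. *)
have [e [n' [hn' n13 hn'N]]] : exists e n', [/\ hq (if e then hneg H else H) w1 w2 = a * n',
    (8 %| n' - 1)%Z || (8 %| n' - 3)%Z & forall r, prime r -> (r %| 2 * D)%N -> ~~ (r %| n')%Z].
  have n2 := nN 2%N isT N2.
  have [q [r [hq0 hr]]] := mod_cases n (isT : 0 < 8 :> int).
  have [q2 [r2 [e1 e2]]] := mod_cases n (isT : 0 < 2 :> int).
  have {e2} r21 : r2 = 1.
    have [e3|//] : r2 = 0 \/ r2 = 1 by lia.
    by move: n2; rewrite e1 e3 addr0 dvdz_mull ?dvdzz.
  have [h|h] : (r = 1 \/ r = 3) \/ (r = 5 \/ r = 7) by lia.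
  - exists false, n; split=> //.
    by case: h => h; rewrite hq0 h ?addrK dvdz_mull ?dvdzz ?orbT.
  - exists true, (- n); split; first by rewrite hq_neg hn mulrN.
      apply/orP; case: h => h; [right|left]; apply/dvdzP; exists (- q - 1); rewrite hq0 h; ring.
    by move=> r' pr' rN; rewrite dvdzE abszN -dvdzE nN.
pose H1 := if e then hneg H else H.
have hD1 : hdisc H1 = D by rewrite /H1; case: (e) => //; rewrite hdisc_neg.
have ad1 : adiv a H1 by rewrite /H1; case: (e) => //; apply: adiv_neg.
have [B1 [C1 eq1]] := hequiv_value H1 cop; rewrite hn' in eq1.
have hD2 := hdisc_equiv eq1; rewrite hD1 in hD2.
have ad2 := adiv_equiv eq1 ad1.
have n0 : n' != 0 by have := hn'N 2%N isT N2; apply: contraNneq => ->.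
have [v1 [v2 [z [hz z0]]]] : exists v1 v2 z, hq (HForm (a * n') B1 C1) v1 v2 = a * nz z /\ z != 0.
  (* Completing the square, read backwards: it turns a solution of Legendre's equation into an
     isotropic vector of H + <-a>. *)
  have hl (X Y Z : zs) : nz X = D%:Z * nz Y + n' * nz Z ->
     hq (HForm (a * n') B1 C1) (X - B1 * Y) ((a * n')%:~R * Y) = a * nz (n'%:~R * Z).
    move=> hX; have an0 : a * n' != 0 by rewrite mulf_neq0 // gt_eqF.
    apply: (mulfI an0); have hD3 : nz B1 - (a * n') * C1 = D by rewrite -hD2.
    rewrite (hq_lin hD3) /linf.
    have -> : (a * n')%:~R * (X - B1 * Y) + B1 * ((a * n')%:~R * Y) = (a * n')%:~R * X by ring.
    rewrite !nzM !nz_int hX; ring.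
  have D0' : D%:Z != 0 by rewrite eqz_nat -lt0n.
  have [|X [Y [Z [hX nt]]]] := @legendre D n' D0' n0; first by rewrite ltz_nat D0.
  have [Z0|Z0] := eqVneq Z 0; last first.
    exists (X - B1 * Y), ((a * n')%:~R * Y), (n'%:~R * Z); split; first exact: hl.
    by rewrite zs_mulf_eq0 negb_or zs_intr_eq0 n0.
  have X0 : X != 0.
    rewrite -nz_eq0 hX Z0 nz0 mulr0 addr0 mulf_neq0 // nz_eq0.
    by move: nt; rewrite Z0 eqxx orbF.
  (* When Z = 0, nz X = D nz Y and the identity (n' + 1)^2 - (n' - 1)^2 = 4 n' give another
     solution, whose third coordinate 2 X is nonzero. *)
  have := hl ((n' + 1)%:~R * X) ((n' - 1)%:~R * Y) (2%:Z%:~R * X) => hl'.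
  exists ((n' + 1)%:~R * X - B1 * ((n' - 1)%:~R * Y)), ((a * n')%:~R * ((n' - 1)%:~R * Y)),
    (n'%:~R * (2%:Z%:~R * X)); split.
    apply: hl'; rewrite !nzM !nz_int.
    have -> : D%:Z * ((n' - 1) ^+ 2 * nz Y) = (n' - 1) ^+ 2 * nz X.
      by rewrite hX Z0 nz0; ring.
    by ring.
  by rewrite !zs_mulf_eq0 !negb_or !zs_intr_eq0 n0 X0.
have [v1' [v2' [z' [hz' gz']]]] := local_fix a0 N0 N2 hn'N n13 hz z0.
have z'0 : z' != 0 by have := gz' 2%N isT N2; apply: contraNneq => ->.
have [x1 [x2 [z'' [copx hx dz]]]] := coprime_iso a0 ad2 hz' z'0.
have gz'' r : prime r -> (r %| 2 * D)%N -> ~~ (r %| nz z'')%Z.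
  by move=> pr rN; apply: contra (gz' r pr rN) => h; apply: dvdz_trans dz.
have [y1 [y2 [m [copy hm m0 pm]]]] := primitive_value D0 hD2 a0 ad2 copx hx gz''.
have [B2 [C2 eq2]] := hequiv_value (HForm (a * n') B1 C1) copy; rewrite hm in eq2.
have ad3 := adiv_equiv eq2 ad2; have hD3 := hdisc_equiv eq2; rewrite hD2 in hD3.
(* For a = 4 this needs Re B even: 4 divides the values at (1, 0), (0, 1) and (1, 1), hence 2 Re
   B. *)
have [kp hkp] : exists kp, kp * a%:~R = 2 * sqm2 * B2.
  case: ha => [a1|[a2|a4]].
  - by exists (2 * sqm2 * B2); rewrite a1 mulr1.
  - by exists (sqm2 * B2); rewrite a2 -[2%:~R]/(2 : zs); ring.
  - have : (4 %| 2 * zre B2)%Z.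
      have h1 := ad3 1 1; have h2 := ad3 1 0; have h3 := ad3 0 1; move: h1 h2 h3.
      rewrite hq10 hq01 hq1w a4 [fA _]/= [fB _]/= [fC _]/= mulr1 nz1 mulr1 => h1 h2 h3.
      have -> : 2 * zre B2 = (4 * m%:Z + 2 * zre B2 + C2) - 4 * m%:Z - C2 by ring.
      by apply: dvdz_sub => //; apply: dvdz_sub.
    move=> /dvdzP[t ht]; exists (ZS (- zim B2) t).
    rewrite a4; apply: zs_eqP; rewrite -[2 : zs]/(2%:Z%:~R) !zsE /=; lia.
have aN0 : a != 0 by rewrite gt_eqF.
have chain : hequiv (HForm (a * m%:Z) B2 C2) (HForm a B2 (m%:Z * C2)).
  apply: (neighbour_chain R D0 aN0 hkp m0) hD3 => p pp pm'.
  have [pN [pi hpi]] := pm p pp pm'.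
  move: pN; rewrite Euclid_dvdM // negb_or => /andP[p2 pD].
  have op : odd p by case: (even_prime pp) p2 => // ->.
  split=> //; last by exists pi.
  rewrite coprime_sym; case: ha => [->|[->|->]]; first exact: coprime1n.
    by rewrite coprime2n.
  by rewrite (coprimeXl 2 (m := 2)) // coprime2n.
exists a, B2, (m%:Z * C2), e; split=> //; first exact: adiv_equiv chain ad3.
by apply: hequiv_trans eq1 _; apply: hequiv_trans eq2 chain.
Qed.

(** In each case the congruence says that a^2 divides nz b - D, so that the last coefficient of a
    form [a, b, c] of discriminant D is divisible by a. *)
Inductive base_form (D : nat) : int -> zs -> Prop :=
| Base1 : base_form D 1 0
| Base2 : D = 1 %[mod 4] -> base_form D 2 1
| Base3 : D = 2 %[mod 16] -> base_form D 4 (- sqm2)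
| Base4 : D = 6 %[mod 16] -> base_form D 4 (2 - sqm2)
| Base5 : D = 2 %[mod 4] -> base_form D 2 sqm2
| Base6 : D = 3 %[mod 4] -> base_form D 2 (1 + sqm2).

Lemma hequiv_translate a B C b m : B = b + a%:~R * m ->
  exists c, hequiv (HForm a B C) (HForm a b c).
Proof.
move=> ->; exists (hq (HForm a (b + a%:~R * m) C) (- m) 1).
exists 1, (- m), 0, 1; split; first by ring.
congr HForm; first by rewrite hq10.
by rewrite /hs /= !rmorph0 !rmorph1; ring.
Qed.

(** Only B modulo a matters, and since a divides C, the equation nz B - a C = D reads as D = nz B
    modulo a^2. The residues of B that belong to no base form are excluded by primitivity at 2 and
    by the divisibility of all values by a. *)
Lemma form_reduction (R : archiRcfType) (D : nat) H : (0 < D)%N -> hdisc H = D ->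
  zprim H -> exists (a a' : int) b c (e : bool), [/\ base_form D a b,
    a' = a \/ a' = - a, nz b - a' * c = D &
    hequiv (if e then hneg H else H) (HForm a' b c)].
Proof.
move=> D0 hD pH; have [a [B [C [e [ha ad eq1]]]]] := form_to_type R D0 hD pH.
have pH1 : zprim (HForm a B C).
  by apply: zprim_equiv eq1 _; case: (e) => //; apply: zprim_neg.
have hD1 : hdisc (HForm a B C) = D.
  by rewrite (hdisc_equiv eq1); case: (e); rewrite ?hdisc_neg.
have main b m : base_form D a b -> B = b + a%:~R * m ->
    exists (a0 a' : int) b0 c (e0 : bool), [/\ base_form D a0 b0,
    a' = a0 \/ a' = - a0, nz b0 - a' * c = D &
    hequiv (if e0 then hneg H else H) (HForm a' b0 c)].
  move=> hb hB; have [c eq2] := hequiv_translate C hB.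
  exists a, a, b, c, e; split=> //; first by left.
    by have := hdisc_equiv eq2; rewrite hD1.
  exact: hequiv_trans eq1 eq2.
(* The negative of [a, - b, c] is [- a, b, - c]: the residue - b is handled through the opposite
   form, which is why a' may be - a. *)
have mainN b m : base_form D a b -> B = - b + a%:~R * m ->
    exists (a0 a' : int) b0 c (e0 : bool), [/\ base_form D a0 b0,
    a' = a0 \/ a' = - a0, nz b0 - a' * c = D &
    hequiv (if e0 then hneg H else H) (HForm a' b0 c)].
  move=> hb hB; have [c eq2] := hequiv_translate C hB.
  exists a, (- a), b, (- c), (~~ e); split=> //; first by right.
    by have := hdisc_equiv eq2; rewrite hD1 /hdisc /= nzN => <-; ring.
  have hc : hneg (HForm a (- b) c) = HForm (- a) b (- c) by rewrite /hneg /= opprK.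
  have := hequiv_neg (hequiv_trans eq1 eq2); rewrite hc.
  by case: (e) => //=; rewrite ?hnegK.
have hDi : nz B - a * C = D by exact: hD1.
have hC : (a %| C)%Z by have := ad 0 1; rewrite hq01.
case: ha => [a1|[a2|a4]]; rewrite ?a1 ?a2 ?a4 in main mainN hDi hC ad pH1.
- by apply: (main 0 B); [exact: Base1|rewrite mul1r add0r].
- have [q1 [r1 [e1 h1]]] := mod_cases (zre B) (isT : 0 < 2 :> int).
  have [q2 [r2 [e2 h2]]] := mod_cases (zim B) (isT : 0 < 2 :> int).
  move/dvdzP: hC => [c0 hc0].
  have hB b : zre b = r1 -> zim b = r2 -> B = b + 2%:~R * ZS q1 q2.
    by move=> b1 b2; apply: zs_eqP; rewrite !zsE /= ?b1 ?b2 ?e1 ?e2; ring.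
  have [[r10|r11] [r20|r21]] : (r1 = 0 \/ r1 = 1) /\ (r2 = 0 \/ r2 = 1) by lia.
  + exfalso; apply: (pH1 2%N isT); split=> /=; rewrite ?dvdzz //; last by rewrite hc0 dvdz_mull ?dvdzz.
    by apply: (iffRL (zdvd_intP _ _)); rewrite e1 e2 r10 r20 !addr0 !dvdz_mull ?dvdzz.
  + apply: (main sqm2 (ZS q1 q2)); last exact: hB.
    by apply: Base5; move: hDi; rewrite /nz e1 e2 r10 r21 hc0; lia.
  + apply: (main 1 (ZS q1 q2)); last exact: hB.
    by apply: Base2; move: hDi; rewrite /nz e1 e2 r11 r20 hc0; lia.
  + apply: (main (1 + sqm2) (ZS q1 q2)); last exact: hB.
    by apply: Base6; move: hDi; rewrite /nz e1 e2 r11 r21 hc0; lia.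
- have [q1 [r1 [e1 h1]]] := mod_cases (zre B) (isT : 0 < 4 :> int).
  have [q2 [r2 [e2 h2]]] := mod_cases (zim B) (isT : 0 < 4 :> int).
  have hB1 : (4 %| 2 * zre B)%Z.
    have k1 := ad 1 1; have k2 := ad 1 0; have k3 := ad 0 1; move: k1 k2 k3.
    rewrite hq10 hq01 hq1w [fA _]/= [fB _]/= [fC _]/= mulr1 nz1 mulr1 => k1 k2 k3.
    have -> : 2 * zre B = (4 + 2 * zre B + C) - 4 - C by ring.
    by apply: dvdz_sub => //; apply: dvdz_sub.
  move/dvdzP: hC => [c0 hc0]; move/dvdzP: hB1 => [b0 hb0].
  have r1E : r1 = 0 \/ r1 = 2 by lia.
  have r2E : r2 = 1 \/ r2 = 3.
    have [|h] : (r2 = 1 \/ r2 = 3) \/ (r2 = 0 \/ r2 = 2) by lia.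
      by [].
    exfalso; apply: (pH1 2%N isT); split=> //=; last by apply/dvdzP; exists (2 * c0); rewrite hc0; ring.
    apply: (iffRL (zdvd_intP _ _)); split; apply/dvdzP.
      by exists b0; lia.
    by case: h => h; [exists (2 * q2)|exists (2 * q2 + 1)]; rewrite e2 h; ring.
  have hB b k1 k2 : zre b + 4 * k1 = zre B -> zim b + 4 * k2 = zim B -> B = b + 4%:~R * ZS k1 k2.
    by move=> b1 b2; apply: zs_eqP; rewrite !zsE /= -?b1 -?b2; ring.
  case: r1E r2E => [r10|r12] [r21|r23].
  + apply: (mainN (- sqm2) (ZS q1 q2)); last by apply: hB; rewrite !zsE; lia.
    apply: Base3; move: hDi; rewrite /nz e1 e2 r10 r21 hc0.
    nia.
  + apply: (main (- sqm2) (ZS q1 (q2 + 1))); last by apply: hB; rewrite !zsE; lia.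
    by apply: Base3; move: hDi; rewrite /nz e1 e2 r10 r23 hc0; nia.
  + apply: (mainN (2 - sqm2) (ZS (q1 + 1) q2)); last by apply: hB; rewrite -[2 : zs]/(2%:Z%:~R) !zsE; lia.
    by apply: Base4; move: hDi; rewrite /nz e1 e2 r12 r21 hc0; nia.
  + apply: (main (2 - sqm2) (ZS q1 (q2 + 1))); last by apply: hB; rewrite -[2 : zs]/(2%:Z%:~R) !zsE; lia.
    by apply: Base4; move: hDi; rewrite /nz e1 e2 r12 r23 hc0; nia.
Qed.

Local Open Scope classical_set_scope.
Local Open Scope ring_scope.

(** * The orders *)

(* The element m + b conj(y) / a + (y / a) j, where i stands for sqrt(-2). *)
Definition ordelt (D : nat) (a : int) (b m y : zs) : Qalg D :=
  Quat (-2) D%:R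
    ((zre m)%:~R + (zre (b * cz y))%:~R / a%:~R)
    ((zim m)%:~R + (zim (b * cz y))%:~R / a%:~R)
    ((zre y)%:~R / a%:~R) ((zim y)%:~R / a%:~R).

Definition ordset (D : nat) (a : int) (b : zs) : set (Qalg D) :=
  [set x | exists m y, x = ordelt D a b m y].

Arguments ordset : clear implicits.

Section Coordinates.
Variables (F : comNzRingType) (a b : F).
Implicit Types (k w x y z : F) (u v : quat a b).

Lemma quat_eqP u v :
  c1 u = c1 v -> ci u = ci v -> cj u = cj v -> ck u = ck v -> u = v.
Proof. by case: u v => [? ? ? ?] [? ? ? ?] /= -> -> -> ->. Qed.

Lemma quatD u v :
  u + v = Quat a b (c1 u + c1 v) (ci u + ci v) (cj u + cj v) (ck u + ck v).
Proof. by []. Qed.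
Lemma quatZ k u : k *: u = Quat a b (k * c1 u) (k * ci u) (k * cj u) (k * ck u).
Proof. by []. Qed.
Lemma quatM u v : u * v = mulh u v. Proof. by []. Qed.
Lemma quat1 : 1 = Quat a b 1 0 0 0. Proof. by []. Qed.
Lemma quatint u (n : int) :
  u *~ n = Quat a b (c1 u * n%:~R) (ci u * n%:~R) (cj u * n%:~R) (ck u * n%:~R).
Proof. by rewrite -scaler_int quatZ; congr Quat; rewrite mulrC. Qed.
Lemma quatn u (n : nat) :
  u *+ n = Quat a b (c1 u * n%:R) (ci u * n%:R) (cj u * n%:R) (ck u * n%:R).
Proof. by rewrite -[u *+ n]/(u *~ n) quatint. Qed.
Lemma quatij : qi a b * qj a b = Quat a b 0 0 0 1.
Proof. by rewrite quatM /mulh /qi /qj /=; congr Quat; ring. Qed.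

Lemma c1Q x y z w : c1 (Quat a b x y z w) = x. Proof. by []. Qed.
Lemma ciQ x y z w : ci (Quat a b x y z w) = y. Proof. by []. Qed.
Lemma cjQ x y z w : cj (Quat a b x y z w) = z. Proof. by []. Qed.
Lemma ckQ x y z w : ck (Quat a b x y z w) = w. Proof. by []. Qed.

End Coordinates.

Definition quatP := (c1Q, ciQ, cjQ, ckQ).

Lemma ordelt_lin (D : nat) (a : int) (b m y m' y' : zs) (n : int) :
  ordelt D a b (m + m' * n%:~R) (y + y' * n%:~R) =
  ordelt D a b m y + ordelt D a b m' y' *~ n.
Proof.
rewrite quatint; apply: quat_eqP; rewrite /ordelt ?quatD ?quatP.
- have -> : zre (m + m' * n%:~R) = zre m + zre m' * n by rewrite !zsE; ring.
  have -> : zre (b * cz (y + y' * n%:~R)) = zre (b * cz y) + zre (b * cz y') * n.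
    by rewrite !zsE; ring.
  by move: (zre m) (zre m') (zre (b * cz y)) (zre (b * cz y')) => *; rewrite !intrD !intrM; ring.
- have -> : zim (m + m' * n%:~R) = zim m + zim m' * n by rewrite !zsE; ring.
  have -> : zim (b * cz (y + y' * n%:~R)) = zim (b * cz y) + zim (b * cz y') * n.
    by rewrite !zsE; ring.
  by move: (zim m) (zim m') (zim (b * cz y)) (zim (b * cz y')) => *; rewrite !intrD !intrM; ring.
- have -> : zre (y + y' * n%:~R) = zre y + zre y' * n by rewrite !zsE; ring.
  by rewrite !intrD !intrM; ring.
- have -> : zim (y + y' * n%:~R) = zim y + zim y' * n by rewrite !zsE; ring.
  by rewrite !intrD !intrM; ring.
Qed.

Lemma ordelt1 D a b : ordelt D a b 1 0 = 1.
Proof. by rewrite /ordelt rmorph0 mulr0 zre1 zim1 zre0 zim0 mul0r addr0 addr0. Qed.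

Lemma ordelti D a b : ordelt D a b sqm2 0 = qi _ _.
Proof. by rewrite /ordelt rmorph0 mulr0 /= mul0r addr0 addr0. Qed.

(** The y-coordinates 1 + t sqrt(-2) and sqrt(-2) of the last two generators form a basis of O,
    while 1 and i span the elements with y = 0; hence m3 and m4 can be arbitrary. *)
Lemma zspan_ordset (D : nat) (a t : int) (b m3 m4 : zs) (e3 e4 : Qalg D) :
  e3 = ordelt D a b m3 (ZS 1 t) -> e4 = ordelt D a b m4 sqm2 ->
  zspan 1 (qi _ _) e3 e4 = ordset D a b.
Proof.
move=> -> ->; rewrite -(ordelt1 D a b) -(ordelti D a b).
have comb n1 n2 n3 n4 : ordelt D a b 1 0 *~ n1 + ordelt D a b sqm2 0 *~ n2
    + ordelt D a b m3 (ZS 1 t) *~ n3 + ordelt D a b m4 sqm2 *~ n4 =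
    ordelt D a b (n1%:~R + sqm2 * n2%:~R + m3 * n3%:~R + m4 * n4%:~R)
      (ZS 1 t * n3%:~R + sqm2 * n4%:~R).
  have h0 : ordelt D a b 0 0 = 0.
    by rewrite /ordelt rmorph0 mulr0 zre0 zim0 mul0r addr0.
  transitivity (ordelt D a b (0 + 1 * n1%:~R + sqm2 * n2%:~R + m3 * n3%:~R + m4 * n4%:~R)
     (0 + 0 * n1%:~R + 0 * n2%:~R + ZS 1 t * n3%:~R + sqm2 * n4%:~R)).
    by rewrite !ordelt_lin h0 add0r.
  by rewrite !mul0r !addr0 !add0r mul1r.
apply/seteqP; split=> x; last first.
  move=> [m [y ->]].
  pose m' := m - m3 * (zre y)%:~R - m4 * (zim y - t * zre y)%:~R.
  exists (zre m'), (zim m'), (zre y), (zim y - t * zre y); rewrite comb; congr ordelt.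
    by rewrite [sqm2 * _]mulrC -zs_decomp /m'; ring.
  by apply: zs_eqP; rewrite !zsE /=; ring.
by move=> [n1 [n2 [n3 [n4 ->]]]]; rewrite comb; eexists; eexists.
Qed.

Section OrderSets.
Variable D : nat.

Lemma order1E : @order1 D = ordset D 1 0.
Proof.
apply: (@zspan_ordset D 1 0 0 0 0).
  by rewrite /ordelt mul0r; congr Quat; rewrite /=; field.
by rewrite quatij /ordelt mul0r; congr Quat; rewrite /=; field.
Qed.

Ltac order_elt := rewrite ?quatij ?quatZ ?quatn /ordelt; apply: quat_eqP; rewrite /=; field.

(** The arguments are a, t, b, m3, m4. The y-coordinate of a generator is a times its j and ij part,
    and m3, m4 are what remains of its 1 and i part after subtracting b conj(y)/a. *)
Lemma order2E : @order2 D = ordset D 2 1.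
Proof. by apply: (@zspan_ordset D 2 0 1 0 sqm2); order_elt. Qed.
Lemma order3E : @order3 D = ordset D 4 (- sqm2).
Proof. by apply: (@zspan_ordset D 4 0 (- sqm2) sqm2 1); order_elt. Qed.
Lemma order4E : @order4 D = ordset D 4 (2 - sqm2).
Proof. by apply: (@zspan_ordset D 4 1 (2 - sqm2) sqm2 (1 + sqm2)); order_elt. Qed.
Lemma order5E : @order5 D = ordset D 2 sqm2.
Proof. by apply: (@zspan_ordset D 2 0 sqm2 0 (-1)); order_elt. Qed.
Lemma order6E : @order6 D = ordset D 2 (1 + sqm2).
Proof. by apply: (@zspan_ordset D 2 1 (1 + sqm2) (-1) (-1 + sqm2)); order_elt. Qed.

Lemma listed_ordset (M : set (Qalg D)) : listed_order M ->
  exists2 ab, base_form D ab.1 ab.2 & M = ordset D ab.1 ab.2.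
Proof.
case=> [|h|h|h|h|h].
- by exists (1, 0); [exact: Base1|exact: order1E].
- by exists (2, 1); [exact: Base2|exact: order2E].
- by exists (4, - sqm2); [exact: Base3|exact: order3E].
- by exists (4, 2 - sqm2); [exact: Base4|exact: order4E].
- by exists (2, sqm2); [exact: Base5|exact: order5E].
- by exists (2, 1 + sqm2); [exact: Base6|exact: order6E].
Qed.

Lemma base_form_listed (a : int) (b : zs) : base_form D a b ->
  listed_order (ordset D a b).
Proof.
case=> [|h|h|h|h|h].
- by rewrite -order1E; exact: Listed1.
- by rewrite -order2E; exact: Listed2.
- by rewrite -order3E; exact: Listed3.
- by rewrite -order4E; exact: Listed4.
- by rewrite -order5E; exact: Listed5.
- by rewrite -order6E; exact: Listed6.
Qed.
End OrderSets.

Lemma base_form_data (D : nat) (a : int) (b : zs) : base_form D a b ->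
  [/\ 0 < a, (exists c : int, nz b - a * (a * c) = D) & exists kp, kp * a%:~R = 2 * sqm2 * b].
Proof.
have dm k r : (D = r %[mod k])%N -> (r < k)%N -> exists c : int, r%:Z - k%:Z * c = D.
  move=> h rk; exists (- (D %/ k)%N%:Z).
  rewrite {2}(divn_eq D k) h modn_small // PoszD PoszM; ring.
case=> [|h|h|h|h|h]; split=> //.
- by exists (- D%:Z); rewrite nz0; ring.
- by exists 0; rewrite mulr0 mul0r.
- by have [//|c hc] := dm 4 1%N h; exists c; rewrite -hc nz1; ring.
- by exists sqm2; apply: zs_eqP.
- by have [//|c hc] := dm 16 2 h; exists c; rewrite -hc nzN nz_sqm2; ring.
- by exists 1; apply: zs_eqP.
- have [//|c hc] := dm 16 6 h; exists c; rewrite -hc.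
  by have -> : nz (2 - sqm2) = 6; [|ring].
- by exists (ZS 1 1); apply: zs_eqP.
- by have [//|c hc] := dm 4 2 h; exists c; rewrite -hc nz_sqm2; ring.
- by exists (-2); apply: zs_eqP.
- have [//|c hc] := dm 4 3 h; exists c; rewrite -hc.
  by have -> : nz (1 + sqm2) = 3; [|ring].
- by exists (-2 + sqm2); apply: zs_eqP.
Qed.

Lemma ordeltE D a b1 b2 m1 m2 y1 y2 :
  ordelt D a (ZS b1 b2) (ZS m1 m2) (ZS y1 y2) = Quat (-2) D%:R
    (m1%:~R + (b1 * y1 + 2 * (b2 * y2))%:~R / a%:~R)
    (m2%:~R + (b2 * y1 - b1 * y2)%:~R / a%:~R) (y1%:~R / a%:~R) (y2%:~R / a%:~R).
Proof.
by rewrite /ordelt !zsE [zre (ZS _ _)]/= [zim (ZS _ _)]/=; congr (Quat _ _ (_ + _%:~R / _) (_ + _%:~R / _)); rewrite /=; ring.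
Qed.

(** Writing b as kp a / (2 sqrt(-2)) and D as nz b - a^2 c cancels all the denominators that a
    product could acquire. *)
Lemma ordset_mul (D : nat) (a c : int) (b kp : zs) x y : a != 0 ->
  nz b - a * (a * c) = D -> kp * a%:~R = 2 * sqm2 * b ->
  ordset D a b x -> ordset D a b y -> ordset D a b (x * y).
Proof.
case: b kp => [b1 b2] [k1 k2] a0 hD hkp.
have e1 : b1%:~R = k2%:~R * a%:~R / 2 :> rat.
  have h : k2 * a = 2 * b1.
    by have := congr1 zim hkp; rewrite -[2 : zs]/(2%:Z%:~R) !zsE /=; lia.
  have -> : k2%:~R * a%:~R = 2 * b1%:~R :> rat by rewrite -intrM h; ring.
  by field.
have e2 : b2%:~R = - (k1%:~R * a%:~R) / 4 :> rat.
  have h : k1 * a = - (4 * b2).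
    by have := congr1 zre hkp; rewrite -[2 : zs]/(2%:Z%:~R) !zsE /=; lia.
  have -> : k1%:~R * a%:~R = - (4 * b2%:~R) :> rat by rewrite -intrM h; ring.
  by field.
have eD : D%:R = b1%:~R ^+ 2 + 2 * b2%:~R ^+ 2 - a%:~R ^+ 2 * c%:~R :> rat.
  by rewrite -[D%:R]/((D%:Z)%:~R) -hD /nz /=; ring.
have a0' : a%:~R != 0 :> rat by rewrite intr_eq0.
move=> [[m1 m2] [[y1 y2] ->]] [[n1 n2] [[z1 z2] ->]].
(* The trace of b conj(y)/a, an integer because kp is in O. *)
pose t := k2 * y1 - k1 * y2.
exists (ZS (m1 * n1 - 2 * (m2 * n2) + m2 * (k1 * z1 + 2 * (k2 * z2)) - c * (y1 * z1 + 2 * (y2 * z2)))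
  (m1 * n2 + m2 * n1 + m2 * (k2 * z1 - k1 * z2) - c * (y2 * z1 - y1 * z2))).
exists (ZS (m1 * z1 - 2 * (m2 * z2) + (y1 * n1 + 2 * (y2 * n2)) + t * z1)
  (m1 * z2 + m2 * z1 + (y2 * n1 - y1 * n2) + t * z2)).
rewrite quatM /t !ordeltE /mulh !quatP; congr Quat.
- by rewrite !(intrB, intrD, intrM) eD e1 e2; field.
- by rewrite !(intrB, intrD, intrM) eD e1 e2; field.
- by rewrite !(intrB, intrD, intrM) e1 e2; field.
- by rewrite !(intrB, intrD, intrM) e1 e2; field.
Qed.

Lemma ordset_Zorder (D : nat) (a : int) (b : zs) : base_form D a b ->
  is_Zorder (ordset D a b).
Proof.
move=> /base_form_data[a0 [c hc] [kp hkp]].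
have an0 : a != 0 by rewrite gt_eqF.
have a0' : a%:~R != 0 :> rat by rewrite intr_eq0.
split.
- by exists 1, 0; rewrite ordelt1.
- move=> x y; exact: ordset_mul hc hkp.
- exists 1, (qi _ _), (ordelt D a b 0 (ZS 1 0)), (ordelt D a b 0 sqm2); split.
    case: b {hc hkp} => b1 b2 r1 r2 r3 r4; rewrite /sqm2 !ordeltE !quatZ /=.
    move=> h; have := congr1 (@c1 _ _ _) h; have := congr1 (@ci _ _ _) h.
    have := congr1 (@cj _ _ _) h; have := congr1 (@ck _ _ _) h.
    rewrite !quatD /= => h4 h3 h2 h1.
    have r40 : r4 = 0.
      have : r4 / a%:~R = 0 by rewrite -[RHS]h4; ring.
      by move/eqP; rewrite mulf_eq0 invr_eq0 (negbTE a0') orbF => /eqP.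
    have r30 : r3 = 0.
      have : r3 / a%:~R = 0 by rewrite -[RHS]h3 r40 !mulr0 !add0r mul0r addr0 div1r.
      by move/eqP; rewrite mulf_eq0 invr_eq0 (negbTE a0') orbF => /eqP.
    move: h1 h2; rewrite r30 r40 !mul0r !mulr0 !addr0 !add0r !mulr1.
    by split.
  by rewrite (@zspan_ordset D a 0 b 0 0).
Qed.

Lemma listed_Zorder (D : nat) (M : set (Qalg D)) : listed_order M -> is_Zorder M.
Proof. by move=> /listed_ordset[[a b] /= hb ->]; apply: ordset_Zorder. Qed.

(** * The embedding of O in C and integral stabilizers *)

Section ZsC.
Variable R : realType.
Local Notation C := (R[i]).

Definition zsC (x : zs) : C := zsqrtm2 R (zre x) (zim x).

Lemma sqrtm2_sqr : sqrtm2 R * sqrtm2 R = -2.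
Proof.
apply/eqP; rewrite eq_complex /= !mulr0 !mul0r sub0r addr0 -expr2 sqr_sqrtr // oppr0.
by rewrite !eqxx.
Qed.

Lemma zsC_is_zmod_morphism : zmod_morphism zsC.
Proof. by move=> x y; rewrite /zsC /zsqrtm2 !zsE !(intrB, intrD, rmorphN) /=; ring. Qed.
Lemma zsC_is_monoid_morphism : monoid_morphism zsC.
Proof.
split=> [|x y]; first by rewrite /zsC /zsqrtm2 zre1 zim1; ring.
rewrite /zsC /zsqrtm2 zreM zimM.
have h := sqrtm2_sqr; move: (zre x) (zim x) (zre y) (zim y) => x1 x2 y1 y2.
transitivity ((x1%:~R * y1%:~R + x2%:~R * y2%:~R * (sqrtm2 R * sqrtm2 R)) +
   (x1%:~R * y2%:~R + x2%:~R * y1%:~R) * sqrtm2 R : C); last by ring.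
by rewrite h; ring.
Qed.
End ZsC.

HB.instance Definition _ (R : realType) :=
  GRing.isZmodMorphism.Build zs R[i] (zsC R) (@zsC_is_zmod_morphism R).
HB.instance Definition _ (R : realType) :=
  GRing.isMonoidMorphism.Build zs R[i] (zsC R) (@zsC_is_monoid_morphism R).

Section Stabilizers.
Variable R : realType.
Local Notation C := (R[i]).
Local Notation zsC := (zsC R).

Lemma conj_sqrtm2 : Num.conj (sqrtm2 R) = - sqrtm2 R.
Proof. by apply/eqP; rewrite eq_complex /= oppr0 !eqxx. Qed.

Lemma zsC_cz x : zsC (cz x) = Num.conj (zsC x).
Proof.
rewrite /zsC /zsqrtm2 rmorphD rmorphM /= !rmorph_int conj_sqrtm2.
by rewrite rmorphN; ring.
Qed.

Lemma zsC_int (n : int) : zsC n%:~R = n%:~R. Proof. exact: rmorph_int. Qed.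

Lemma zsC_inj : injective zsC.
Proof.
move=> x y /eqP; rewrite -subr_eq0 -rmorphB /= => /eqP h.
apply/eqP; rewrite -subr_eq0 -nz_eq0 -(intr_eq0 C) -zsC_int nzE rmorphM /= h.
by rewrite mul0r.
Qed.

Definition mx2 (p q r s : C) : 'M[C]_2 :=
  \matrix_(i < 2, j < 2) if i == 0 then (if j == 0 then p else q)
                          else (if j == 0 then r else s).

Lemma mx2_00 p q r s : mx2 p q r s 0 0 = p. Proof. by rewrite mxE. Qed.
Lemma mx2_01 p q r s : mx2 p q r s 0 1 = q. Proof. by rewrite mxE. Qed.
Lemma mx2_10 p q r s : mx2 p q r s 1 0 = r. Proof. by rewrite mxE. Qed.
Lemma mx2_11 p q r s : mx2 p q r s 1 1 = s. Proof. by rewrite mxE. Qed.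
Definition mx2E := (mx2_00, mx2_01, mx2_10, mx2_11).

Lemma ord2 (i : 'I_2) : i = 0 \/ i = 1.
Proof. by case: i => -[|[|//]] h; [left|right]; apply: val_inj. Qed.

Lemma mx2_eta (A : 'M[C]_2) : A = mx2 (A 0 0) (A 0 1) (A 1 0) (A 1 1).
Proof. by apply/matrixP => i j; case: (ord2 i) (ord2 j) => -> [] ->; rewrite mx2E. Qed.

Lemma mx2M p q r s p' q' r' s' : mx2 p q r s *m mx2 p' q' r' s' =
  mx2 (p * p' + q * r') (p * q' + q * s') (r * p' + s * r') (r * q' + s * s').
Proof.
have o1 : lift ord0 ord0 = 1 :> 'I_2 by apply: val_inj.
have o0 : ord0 = 0 :> 'I_2 by apply: val_inj.
apply/matrixP => i j; rewrite mxE !big_ord_recl big_ord0 addr0 o1 o0.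
by case: (ord2 i) (ord2 j) => -> [] ->; rewrite !mx2E.
Qed.

Lemma det_mx2 p q r s : \det (mx2 p q r s) = p * s - q * r.
Proof.
have o1 : lift ord0 ord0 = 1 :> 'I_2 by apply: val_inj.
have o2 : lift 1 0 = 0 :> 'I_2 by apply: val_inj.
have o0 : ord0 = 0 :> 'I_2 by apply: val_inj.
rewrite (expand_det_row _ 0) !big_ord_recl big_ord0 addr0 o1 o0.
rewrite /cofactor !det_mx11 !mxE /= expr0 expr1.
by rewrite mul1r mulN1r mulrN.
Qed.

Lemma mx2D p q r s p' q' r' s' : mx2 p q r s + mx2 p' q' r' s' =
  mx2 (p + p') (q + q') (r + r') (s + s').
Proof. by apply/matrixP => i j; case: (ord2 i) (ord2 j) => -> [] ->; rewrite mxE !mx2E. Qed.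

Lemma mx2Z k p q r s : k *: mx2 p q r s = mx2 (k * p) (k * q) (k * r) (k * s).
Proof. by apply/matrixP => i j; case: (ord2 i) (ord2 j) => -> [] ->; rewrite mxE !mx2E. Qed.

Lemma mx2_id : mx2 1 0 0 1 = 1%:M.
Proof. by apply/matrixP => i j; case: (ord2 i) (ord2 j) => -> [] ->; rewrite mx2E mxE. Qed.

Definition zmx (p q r s : zs) : 'M[C]_2 := mx2 (zsC p) (zsC q) (zsC r) (zsC s).

Lemma zmx_det p q r s : p * s - q * r = 1 -> \det (zmx p q r s) == 1.
Proof. by move=> h; rewrite det_mx2 -!rmorphM -rmorphB h rmorph1. Qed.

Lemma zmx_detP p q r s : \det (zmx p q r s) = 1 -> p * s - q * r = 1.
Proof. by rewrite det_mx2 -!rmorphM -rmorphB => h; apply: zsC_inj; rewrite h rmorph1. Qed.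

Lemma zmxM p q r s p' q' r' s' : zmx p q r s *m zmx p' q' r' s' =
  zmx (p * p' + q * r') (p * q' + q * s') (r * p' + s * r') (r * q' + s * s').
Proof. by rewrite mx2M /zmx !rmorphD !rmorphM. Qed.

Lemma Bianchi2P g : Bianchi2 g <-> exists p q r s (A : SL2 C),
  g = pcl A /\ SLmx A = zmx p q r s.
Proof.
split=> [[A -> h]|[p [q [r [s [A [-> hA]]]]]]].
  have [m1 [n1 h1]] := h 0 0; have [m2 [n2 h2]] := h 0 1.
  have [m3 [n3 h3]] := h 1 0; have [m4 [n4 h4]] := h 1 1.
  exists (ZS m1 n1), (ZS m2 n2), (ZS m3 n3), (ZS m4 n4), A; split=> //.
  by rewrite [LHS]mx2_eta h1 h2 h3 h4.
exists A => // k l; rewrite hA /zmx.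
by case: (ord2 k) (ord2 l) => -> [] ->; rewrite mx2E; do 2![eexists].
Qed.

(** Exact isometries of H, not isometries up to sign: the multiplier 1 encodes that both sides of
    the circle are kept. *)
Definition stabO (H : hform) : set (PSL2 C) := [set g | exists p q r s (A : SL2 C),
  [/\ g = pcl A, SLmx A = zmx p q r s & hact H p q r s = H]].

Lemma stabO_neg H : stabO (hneg H) = stabO H.
Proof.
have sub H' : stabO H' `<=` stabO (hneg H').
  move=> g [p [q [r [s [A [h1 h2 h3]]]]]]; exists p, q, r, s, A; split=> //.
  apply: hform_eq => u1 u2 v1 v2; rewrite hs_lin !hs_neg; congr (- _).
  by rewrite -hs_lin h3.
by apply/seteqP; split; [rewrite -{2}(hnegK H)|]; apply: sub.
Qed.

Lemma SL2_mulE (A B : SL2 C) : SLmx (A * B)%g = SLmx A *m SLmx B.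
Proof. by []. Qed.
Lemma SL2_invE (A : SL2 C) : SLmx (A^-1)%g = invmx (SLmx A).
Proof. by []. Qed.

Lemma zmx_inv p q r s (A : SL2 C) : SLmx A = zmx p q r s ->
  SLmx (A^-1)%g = zmx s (- q) (- r) p.
Proof.
move=> hA; have d := SL2_det A; rewrite hA in d; have {}d := zmx_detP d.
have e : SLmx A *m zmx s (- q) (- r) p = 1%:M.
  rewrite hA zmxM -mx2_id /zmx; congr mx2.
  - by rewrite -[RHS](rmorph1 zsC) -d; congr zsC; ring.
  - by rewrite -[RHS](rmorph0 zsC); congr zsC; ring.
  - by rewrite -[RHS](rmorph0 zsC); congr zsC; ring.
  - by rewrite -[RHS](rmorph1 zsC) -d; congr zsC; ring.
by rewrite SL2_invE -[LHS]mulmx1 -e mulmxA mulVmx ?SL2_unit // mul1mx.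
Qed.

Lemma pclM (A B : SL2 C) : pcl (A * B)%g = (pcl A * pcl B)%g.
Proof. by rewrite -[RHS]/(PSL2_mul _ _) PSL2_mul_pcl. Qed.
Lemma pclV (A : SL2 C) : pcl (A^-1)%g = ((pcl A)^-1)%g.
Proof. by rewrite -[RHS]/(PSL2_inv _) PSL2_inv_pcl. Qed.

Lemma stabO_subgroup H : is_subgroup (stabO H) /\ stabO H `<=` @Bianchi2 R.
Proof.
split; last first.
  move=> g [p [q [r [s [A [h1 h2 h3]]]]]]; apply/Bianchi2P.
  by exists p, q, r, s, A.
split.
  exists 1, 0, 0, 1, 1%g; split; [by []| |exact: hact1].
  by rewrite /zmx rmorph0 rmorph1 mx2_id.
move=> x y [p [q [r [s [A [-> hA eA]]]]]] [p' [q' [r' [s' [B [-> hB eB]]]]]].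
have d := SL2_det B; rewrite hB in d; have {}d := zmx_detP d.
exists (p * s' + q * - r'), (p * - q' + q * p'), (r * s' + s * - r'), (r * - q' + s * p'), (A * B^-1)%g.
split; first by rewrite pclM pclV.
  by rewrite SL2_mulE (zmx_inv hB) hA zmxM.
rewrite -hact_comp eA -{1}eB hact_comp -[RHS]hact1 -d; apply: hact_congr; ring.
Qed.

Lemma stabO_conj H k : hequiv H k -> conj_in (@Bianchi2 R) (stabO H) (stabO k).
Proof.
move=> [p [q [r [s [d ->]]]]].
pose K : SL2 C := MkSL2 (zmx_det d).
have hK : SLmx K = zmx p q r s by [].
exists (pcl K); first by apply/Bianchi2P; exists p, q, r, s, K.
have sub (H1 : hform) p1 q1 r1 s1 (K1 : SL2 C) (d1 : p1 * s1 - q1 * r1 = 1) g :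
    SLmx K1 = zmx p1 q1 r1 s1 -> stabO H1 g -> stabO (hact H1 p1 q1 r1 s1) (conjg g (pcl K1)).
  move=> hK1 [x [y [z [w [A [-> hA eA]]]]]].
  eexists; eexists; eexists; eexists; exists (K1^-1 * (A * K1))%g; split.
  - by rewrite /conjg !pclM pclV.
  - by rewrite !SL2_mulE (zmx_inv hK1) hA hK1 !zmxM.
  rewrite -[LHS]hact_comp [hact (hact H1 _ _ _ _) s1 _ _ _]hact_comp.
  have -> : hact H1 (p1 * s1 + q1 * - r1) (p1 * - q1 + q1 * p1) (r1 * s1 + s1 * - r1) (r1 * - q1 + s1 * p1) = H1.
    by rewrite -[RHS]hact1 -d1; apply: hact_congr; ring.
  by rewrite -hact_comp eA.
apply/seteqP; split=> g.
  move=> hg; exists (conjg g ((pcl K)^-1)%g); last by rewrite conjgKV.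
  have -> : H = hact (hact H p q r s) s (- q) (- r) p.
    by rewrite hact_comp -[LHS]hact1 -d; apply: hact_congr; ring.
  rewrite -pclV; apply: sub => //; last exact: zmx_inv.
  by rewrite -d; ring.
by move=> [h hh <-]; apply: sub.
Qed.

End Stabilizers.

(** * The matrix representation of the quaternion algebra *)

Section Rho.
Variable R : realType.
Local Notation C := (R[i]).
Variables (D : nat) (a c : int) (b : zs).
Hypotheses (D0 : (0 < D)%N) (a0 : a != 0) (hD : nz b - a * c = D).

Let s : C := sqrtm2 R.
Let al : C := a%:~R.
Let be : C := zsC R b.
Let be' : C := zsC R (cz b).
Let ga : C := c%:~R.

(* Conjugating by [[1, b/a], [0, 1]] turns the form diag(a, -D/a), preserved by
   the matrices [[w, (D/a) y], [a conj(y), conj(w)]], into [[a, b], [conj(b), c]]. *)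
Definition rho (x : QalgC R D) : 'M[C]_2 :=
  let w := c1 x + ci x * s in let w' := c1 x - ci x * s in
  let y := cj x + ck x * s in let y' := cj x - ck x * s in
  mx2 (w - be * y') ((be * (w - w' + be' * y - be * y')) / al - ga * y)
      (al * y') (w' + be * y').

Let ratrN2 : ratr (-2 : rat) = s * s :> C.
Proof. by rewrite sqrtm2_sqr rmorphN /= ratr_nat. Qed.
Let ratrD : ratr (D%:R : rat) = D%:R :> C.
Proof. by rewrite ratr_nat. Qed.
Let al0 : al != 0. Proof. by rewrite intr_eq0. Qed.
Let s2 : s * s = -2. Proof. exact: sqrtm2_sqr. Qed.
Let DE : D%:R = be * be' - al * ga.
Proof.
have -> : be * be' = (nz b)%:~R by rewrite -[RHS](zsC_int R) nzE rmorphM.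
by rewrite -[D%:R]/(D%:Z%:~R) -hD intrB intrM.
Qed.
Let Dn0 : (D%:R : C) != 0. Proof. by rewrite pnatr_eq0 -lt0n. Qed.

Lemma rho_zmod : zmod_morphism rho.
Proof.
move=> x y; apply/eqP; rewrite eq_sym subr_eq; apply/eqP.
rewrite /rho mx2D; congr mx2; rewrite /=; ring.
Qed.

Lemma rho_scal : scalable rho.
Proof. by move=> k x; rewrite /rho mx2Z; congr mx2; rewrite /=; ring. Qed.

Lemma rho_monoid : monoid_morphism rho.
Proof.
split.
  have -> : (1 : 'M[C]_2) = mx2 1 0 0 1 by rewrite mx2_id.
  by rewrite quat1 /rho /=; congr mx2; ring.
move=> x y; rewrite -[rho x * rho y]/(rho x *m rho y) /rho mx2M quatM.
rewrite /=; pose v := c1 x + ci x * s; pose v' := c1 x - ci x * s.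
pose u := cj x + ck x * s; pose u' := cj x - ck x * s.
pose w := c1 y + ci y * s; pose w' := c1 y - ci y * s.
pose z := cj y + ck y * s; pose z' := cj y - ck y * s.
rewrite -/v -/v' -/u -/u' -/w -/w' -/z -/z'.
(* With complex coordinates w and w' are independent: the prime changes the sign of s and is not
   complex conjugation. The four identities are (v + u j)(w + z j) = v w + D u z' + (v z + u w') j
   and its primed form. *)
have e1 : c1 (mulh x y) + ci (mulh x y) * s = v * w + D%:R * (u * z').
  rewrite /mulh !quatP /v /u /w /z';
    move: (c1 x) (ci x) (cj x) (ck x) (c1 y) (ci y) (cj y) (ck y) => *; rewrite ?(ratrN2, ratrD); ring.
have e2 : c1 (mulh x y) - ci (mulh x y) * s = v' * w' + D%:R * (u' * z).
  rewrite /mulh !quatP /v' /u' /w' /z;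
    move: (c1 x) (ci x) (cj x) (ck x) (c1 y) (ci y) (cj y) (ck y) => *; rewrite ?(ratrN2, ratrD); ring.
have e3 : cj (mulh x y) + ck (mulh x y) * s = v * z + u * w'.
  rewrite /mulh !quatP /v /u /w' /z;
    move: (c1 x) (ci x) (cj x) (ck x) (c1 y) (ci y) (cj y) (ck y) => *; rewrite ?(ratrN2, ratrD); ring.
have e4 : cj (mulh x y) - ck (mulh x y) * s = v' * z' + u' * w.
  rewrite /mulh !quatP /v' /u' /w /z';
    move: (c1 x) (ci x) (cj x) (ck x) (c1 y) (ci y) (cj y) (ck y) => *; rewrite ?(ratrN2, ratrD); ring.
rewrite e1 e2 e3 e4 DE; move: v v' u u' w w' z z' {e1 e2 e3 e4} => v v' u u' w w' z z'.
by congr mx2; field.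
Qed.

Definition rho_inv (P : 'M[C]_2) : QalgC R D :=
  let y' := P 1 0 / al in
  let w' := P 1 1 - be * y' in
  let w := P 0 0 + be * y' in
  let y := (al * P 0 1 - be * (w - w' - be * y')) / D%:R in
  Quat _ _ ((w + w') / 2) ((w - w') / (2 * s)) ((y + y') / 2) ((y - y') / (2 * s)).

Let s0 : s != 0.
Proof.
apply/eqP => h; have := s2; rewrite h mul0r => /eqP.
by rewrite eq_sym oppr_eq0 pnatr_eq0.
Qed.

Lemma rho_bij : bijective rho.
Proof.
have n2 : (2 : C) != 0 by rewrite pnatr_eq0.
exists rho_inv.
  move=> x; rewrite /rho_inv /rho !mx2E.
  have -> : (al * ((be * (c1 x + ci x * s - (c1 x - ci x * s) + be' * (cj x + ck x * s) - be * (cj x - ck x * s))) / al -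
       ga * (cj x + ck x * s)) - be * (c1 x + ci x * s - be * (cj x - ck x * s) +
       be * (al * (cj x - ck x * s) / al) -
       (c1 x - ci x * s + be * (cj x - ck x * s) - be * (al * (cj x - ck x * s) / al)) -
       be * (al * (cj x - ck x * s) / al))) / D%:R = cj x + ck x * s.
    by apply: (mulIf Dn0); rewrite divfK // DE; field.
  by apply: quat_eqP; rewrite !quatP; field; rewrite ?n2 ?s0 ?al0.
move=> P; rewrite [RHS]mx2_eta /rho /rho_inv !quatP.
set y' := P 1 0 / al; set w' := P 1 1 - _; set w := P 0 0 + _; set y := (_ / D%:R).
have e1 : (w + w') / 2 + (w - w') / (2 * s) * s = w by field; rewrite ?n2 ?s0.
have e2 : (w + w') / 2 - (w - w') / (2 * s) * s = w' by field; rewrite ?n2 ?s0.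
have e3 : (y + y') / 2 + (y - y') / (2 * s) * s = y by field; rewrite ?n2 ?s0.
have e4 : (y + y') / 2 - (y - y') / (2 * s) * s = y' by field; rewrite ?n2 ?s0.
rewrite e1 e2 e3 e4; congr mx2.
- by rewrite /w; ring.
- apply: (mulfI al0).
  have hy : D%:R * y = al * P 0 1 - be * (w - w' - be * y') by rewrite /y mulrC divfK.
  transitivity (be * (w - w' - be * y') + D%:R * y); last by rewrite hy; ring.
  by rewrite DE; field.
- by rewrite /y' mulrC divfK.
- by rewrite /w'; ring.
Qed.

Lemma det_rho (x : QalgC R D) : \det (rho x) = nrd x.
Proof.
by case: x => x y z w; rewrite det_mx2 /nrd /= ratrN2 ratrD DE; field.
Qed.

Definition rho_lrmorphism : {lrmorphism QalgC R D -> 'M[C]_2} :=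
  HB.pack rho (GRing.isZmodMorphism.Build _ _ rho rho_zmod)
    (GRing.isScalable.Build _ _ _ _ rho rho_scal)
    (GRing.isMonoidMorphism.Build _ _ rho rho_monoid).


End Rho.

(** * Stabilizers as norm one groups *)

Section StabilizerIsNorm1.
Variable R : realType.
Local Notation C := (R[i]).
Variables (D : nat) (a c : int) (b kp : zs).
Hypotheses (D0 : (0 < D)%N) (a0 : a != 0) (hD : nz b - a * (a * c) = D)
  (hkp : kp * a%:~R = 2 * sqm2 * b).

Let zsqm2I (x y : zs) : 2 * sqm2 * x = 2 * sqm2 * y -> x = y.
Proof. by apply: zs_mulfI. Qed.

Let tr_kp (y : zs) : b * cz y + cz b * y = (a * zim (kp * cz y))%:~R.
Proof.
apply: zsqm2I.
have e := esym (zim2 (kp * cz y)).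
have hkc : cz kp * a%:~R = 2 * - sqm2 * cz b.
  by rewrite -cz_sqm2 -[2 : zs]/(2%:Z%:~R) -(cz_int 2) -(cz_int a) -!rmorphM /= hkp.
rewrite intrM mulrCA -e rmorphM /= czK.
transitivity (cz y * (kp * a%:~R) - y * (cz kp * a%:~R)); first by rewrite hkp hkc; ring.
ring.
Qed.

Let az0 : a%:~R != 0 :> zs. Proof. by rewrite zs_intr_eq0. Qed.

(** An isometry g satisfies g^* H = H g^-1, whose first row expresses a q and a s through p and r;
    [hkp] makes the divisions by a exact. Conversely, two coefficients of the transformed form are
    computed and the third follows from the discriminant. *)
Lemma hact_stab p q r s : p * s - q * r = 1 ->
  hact (HForm a b (a * c)) p q r s = HForm a b (a * c) <->
  q = kp * (zim p)%:~R - c%:~R * cz r /\ s = cz p + (zim (kp * r))%:~R.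
Proof.
move=> d; have := tr_kp (cz r); rewrite czK intrM => ht.
have hp := esym (zim2 p).
have hb : b * (p - cz p) = a%:~R * (kp * (zim p)%:~R).
  by rewrite hp mulrA [b * _]mulrC -hkp; ring.
split=> [h|[eq es]].
  have e1 : a%:~R * (cz p * p) + b * (cz p * r) + cz b * (cz r * p)
      + (a * c)%:~R * (cz r * r) = a%:~R.
    by have := congr1 (fun H => (fA H)%:~R : zs) h; rewrite /= hqE.
  have e2 : a%:~R * (cz p * q) + b * (cz p * s) + cz b * (cz r * q)
      + (a * c)%:~R * (cz r * s) = b.
    by have := congr1 fB h.
  rewrite intrM in e1 e2.
  pose u1 := a%:~R * cz p + cz b * cz r; pose u2 := b * cz p + a%:~R * c%:~R * cz r.
  have {}e1 : a%:~R = u1 * p + u2 * r by rewrite -e1 /u1 /u2; ring.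
  have {}e2 : b = u1 * q + u2 * s by rewrite -e2 /u1 /u2; ring.
  have e3 : a%:~R * q = b * p - u2.
    transitivity (b * p - u2 * (p * s - q * r)); last by rewrite d mulr1.
    by move: (u1) (u2) e1 e2 => v1 v2 -> ->; ring.
  have e4 : a%:~R * s = u1 + b * r.
    transitivity (u1 * (p * s - q * r) + b * r); last by rewrite d mulr1.
    by move: (u1) (u2) e1 e2 => v1 v2 -> ->; ring.
  split; apply: (zs_mulfI az0).
    by rewrite e3 mulrBr -hb /u2; ring.
  by rewrite e4 mulrDr -ht /u1; ring.
have e1 : a%:~R * s = a%:~R * cz p + b * r + cz b * cz r by rewrite es mulrDr -ht; ring.
have e2 : a%:~R * q = b * p - b * cz p - (a * c)%:~R * cz r.
  by rewrite eq intrM mulrBr -hb; ring.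
have hA : hq (HForm a b (a * c)) p r = a.
  apply: zs_intr_inj; rewrite hqE /hs /=.
  transitivity (p * (a%:~R * s) - r * (a%:~R * q)); last first.
    by rewrite -[RHS]mulr1 -[X in _ = _ * X]d; ring.
  by rewrite e1 e2; ring.
have hB : hs (HForm a b (a * c)) p r q s = b.
  rewrite /hs /=.
  transitivity (q * (a%:~R * s - b * r) + s * (b * p - a%:~R * q)); last first.
    by rewrite -[RHS]mulr1 -[X in _ = _ * X]d; ring.
  by rewrite e1 e2; ring.
rewrite /hact hA hB; congr HForm.
have := hdisc_act (HForm a b (a * c)) p q r s; rewrite d nz1 mulr1 /hact hA hB /hdisc /=.
move: (hq _ q s) => X hX; apply: (mulfI a0); lia.
Qed.

(** This is the shape found in [hact_stab], with p = m and r = conj(y), so elements of the order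
    correspond to integral matrices of that shape and the norm to the determinant. *)
Lemma rho_ordelt m y : rho a (a * c) b (Qalg_ext R (ordelt D a b m y)) =
  zmx R m (kp * (zim m)%:~R - c%:~R * y) (cz y) (cz m + (zim (kp * cz y))%:~R).
Proof.
have al0 : (a%:~R : C) != 0 by rewrite intr_eq0.
have hm : zsC R b * (zsC R m - zsC R (cz m)) = a%:~R * zsC R (kp * (zim m)%:~R).
  transitivity (zsC R (b * (m - cz m))); first by rewrite rmorphM rmorphB.
  have -> : b * (m - cz m) = a%:~R * (kp * (zim m)%:~R).
    by rewrite -zim2 mulrA [b * _]mulrC -hkp; ring.
  by rewrite rmorphM /= zsC_int.
have ht : zsC R b * zsC R (cz y) + zsC R (cz b) * zsC R y =
    a%:~R * zsC R (zim (kp * cz y))%:~R.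
  transitivity (zsC R (b * cz y + cz b * y)); first by rewrite rmorphD !rmorphM.
  by rewrite tr_kp intrM rmorphM /= zsC_int.
have f1 x : zsC R x = (zre x)%:~R + (zim x)%:~R * sqrtm2 R by [].
have f2 x : zsC R (cz x) = (zre x)%:~R - (zim x)%:~R * sqrtm2 R.
  by rewrite f1 /= rmorphN; ring.
have rq (u : int) : ratr (u%:~R / a%:~R) = u%:~R / a%:~R :> C.
  by rewrite fmorph_div /= !ratr_int.
set x := Qalg_ext R _.
have x1 : c1 x = (zre m)%:~R + (zre (b * cz y))%:~R / a%:~R.
  by rewrite [LHS]rmorphD /= rq ratr_int.
have x2 : ci x = (zim m)%:~R + (zim (b * cz y))%:~R / a%:~R.
  by rewrite [LHS]rmorphD /= rq ratr_int.
have x3 : cj x = (zre y)%:~R / a%:~R by exact: rq.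
have x4 : ck x = (zim y)%:~R / a%:~R by exact: rq.
rewrite /rho x1 x2 x3 x4.
have ew : (zre m)%:~R + (zre (b * cz y))%:~R / a%:~R +
   ((zim m)%:~R + (zim (b * cz y))%:~R / a%:~R) * sqrtm2 R =
   zsC R m + zsC R (b * cz y) / a%:~R :> C by rewrite !f1; field.
have ew' : (zre m)%:~R + (zre (b * cz y))%:~R / a%:~R -
   ((zim m)%:~R + (zim (b * cz y))%:~R / a%:~R) * sqrtm2 R =
   zsC R (cz m) + zsC R (cz (b * cz y)) / a%:~R :> C by rewrite !f2; field.
have ey : (zre y)%:~R / a%:~R + (zim y)%:~R / a%:~R * sqrtm2 R = zsC R y / a%:~R :> C.
  by rewrite f1; field.
have ey' : (zre y)%:~R / a%:~R - (zim y)%:~R / a%:~R * sqrtm2 R = zsC R (cz y) / a%:~R :> C.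
  by rewrite f2; field.
have eb : zsC R (b * cz y) = zsC R b * zsC R (cz y) by rewrite rmorphM.
have eb' : zsC R (cz (b * cz y)) = zsC R (cz b) * zsC R y by rewrite rmorphM /= czK rmorphM.
rewrite ew ew' ey ey' eb eb' /zmx; congr mx2.
- by field.
- apply: (mulfI al0); rewrite rmorphB /= [RHS]mulrBr -hm intrM.
  have -> : zsC R (c%:~R * y) = c%:~R * zsC R y by rewrite rmorphM /= zsC_int.
  by field.
- by field.
- rewrite rmorphD /=; apply: (mulfI al0); rewrite [RHS]mulrDr -ht; by field.
Qed.

Lemma stabO_norm1 :
  stabO (HForm a b (a * c)) = norm1_group (ordset D a b) (@rho R D a (a * c) b).
Proof.
have hdet (x : Qalg D) : \det (rho a (a * c) b (Qalg_ext R x)) = ratr (nrd x).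
  rewrite (det_rho a0 hD) /nrd /=.
  have rX := rmorphXn (ratr : {rmorphism rat -> C}) 2.
  have rM := rmorphM (ratr : {rmorphism rat -> C}).
  have rB := rmorphB (ratr : {rmorphism rat -> C}).
  by rewrite -rX -rX -rX -rX -rM -rM -rM -rM -rB -rB -rmorphD.
apply/seteqP; split=> g.
  move=> [p [q [r [s [A [-> hA hact]]]]]].
  have d := SL2_det A; rewrite hA in d; have {}d := zmx_detP d.
  have [hq hs] := (hact_stab d).1 hact.
  exists (ordelt D a b p (cz r)), A.
  have e : SLmx A = rho a (a * c) b (Qalg_ext R (ordelt D a b p (cz r))).
    by rewrite rho_ordelt hA hq hs czK.
  split=> //; first by exists p, (cz r).
  by apply: (fmorph_inj (ratr : rat -> C)); rewrite rmorph1 -[LHS]hdet -e SL2_det.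
move=> [x [A [[m [y ->]] n1 hA ->]]].
rewrite rho_ordelt in hA.
do 4![eexists]; exists A; split; [by []|exact: hA|].
apply/hact_stab; last by rewrite !czK.
by apply: (@zmx_detP R); rewrite -hA SL2_det.
Qed.
End StabilizerIsNorm1.

Lemma ordset_opp D a b : ordset D (- a) b = ordset D a b.
Proof.
have sub a' : ordset D (- a') b `<=` ordset D a' b.
  move=> x [m [y ->]]; exists m, (- y).
  rewrite /ordelt (rmorphN cz) mulrN !zreN !zimN.
  by congr Quat; rewrite !(mulrNz, invrN, mulrN, mulNr).
by apply/seteqP; split=> //; rewrite -{1}(opprK a).
Qed.

Lemma base_form_stabO (R : realType) (D : nat) (a a' c : int) (b : zs) : (0 < D)%N ->
  base_form D a b -> a' = a \/ a' = - a -> nz b - a' * c = D ->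
  exists rho' : {lrmorphism QalgC R D -> 'M[R[i]]_2}, bijective rho' /\
    stabO (HForm a' b c) = norm1_group (ordset D a b) rho'.
Proof.
move=> D0 /base_form_data[a0 [c0 hc] [kp hkp]] ha' hD.
have an0 : a != 0 by rewrite gt_eqF.
have [e [he ea' eo]] : exists e : int, [/\ e * e = 1, a' = e * a & ordset D a' b = ordset D a b].
  case: ha' => ->; first by exists 1; rewrite mulr1 mul1r.
  by exists (-1); rewrite mulrNN mulr1 mulN1r ordset_opp.
have a'0 : a' != 0 by rewrite ea' mulf_neq0 //; apply/eqP => e0; rewrite e0 in he.
(* Comparing the two expressions for D gives a' c = a^2 c0, so the form is [a', b, a' c0], as
   [stabO_norm1] requires. *)
have hc' : c = a' * c0.
  apply: (mulfI a'0); rewrite {2 3}ea'.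
  transitivity (a * (a * c0)); first by lia.
  by rewrite -[LHS]mul1r -[X in X * _]he; ring.
have hkp' : (kp * e%:~R) * a'%:~R = 2 * sqm2 * b.
  rewrite -hkp ea' -mulrA -intrM mulrA he mul1r //.
subst c; exists (rho_lrmorphism R a'0 hD); split; first exact: (rho_bij R D0 a'0 hD).
by rewrite (stabO_norm1 R D0 a'0 hD hkp') eo.
Qed.

(** * Circles and complex Hermitian forms *)

Section Hermitian.
Variable R : realType.
Local Notation C := (R[i]).
Local Notation conj := (@Num.conj C).

Record cform := CForm { ca : C; cb : C; cc : C }.

Definition creal (h : cform) := conj (ca h) = ca h /\ conj (cc h) = cc h.
Definition cv (h : cform) (u v : C) : C :=
  ca h * (u * conj u) + cb h * (conj u * v) + conj (cb h) * (u * conj v) + cc h * (v * conj v).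
Definition cs (h : cform) (u v u' v' : C) : C :=
  ca h * (conj u * u') + cb h * (conj u * v') + conj (cb h) * (conj v * u') + cc h * (conj v * v').
Definition cact (h : cform) (M : 'M[C]_2) : cform :=
  CForm (cv h (M 0 0) (M 1 0)) (cs h (M 0 0) (M 1 0) (M 0 1) (M 1 1)) (cv h (M 0 1) (M 1 1)).
Definition cdisc (h : cform) : C := cb h * conj (cb h) - ca h * cc h.
Definition cneg (h : cform) := CForm (- ca h) (- cb h) (- cc h).
(* The value at p up to positive factors. *)
Definition sv (h : cform) (p : sphere R) : C := if p is Some z then cv h z 1 else ca h.

Lemma conjM (x y : C) : conj (x * y) = conj x * conj y. Proof. exact: rmorphM. Qed.
Lemma conjD (x y : C) : conj (x + y) = conj x + conj y. Proof. exact: rmorphD. Qed.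
Lemma conjB (x y : C) : conj (x - y) = conj x - conj y. Proof. exact: rmorphB. Qed.
Lemma conjN (x : C) : conj (- x) = - conj x. Proof. exact: rmorphN. Qed.
Lemma conjI (n : int) : conj n%:~R = n%:~R. Proof. exact: rmorph_int. Qed.
Lemma conj_1 : conj 1 = 1. Proof. exact: rmorph1. Qed.
Lemma conj_0 : conj 0 = 0. Proof. exact: rmorph0. Qed.
Definition conjE := (conjM, conjD, conjB, conjN, conjI, conj_1, conj_0, @conjCK C).

Lemma cv_real h u v : creal h -> conj (cv h u v) = cv h u v.
Proof. by move=> [h1 h2]; rewrite /cv !conjE h1 h2; ring. Qed.

Lemma sv_real h p : creal h -> conj (sv h p) = sv h p.
Proof. by case: p => [z|] hr; [exact: cv_real|exact: hr.1]. Qed.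

Lemma sv_neg h p : sv (cneg h) p = - sv h p.
Proof. by case: p => [z|//]; rewrite /= /cv /= conjN; ring. Qed.

Lemma creal_neg h : creal h -> creal (cneg h).
Proof. by move=> [h1 h2]; split; rewrite /= conjN ?h1 ?h2. Qed.

Lemma creal_act h M : creal h -> creal (cact h M).
Proof. by move=> hr; split; apply: cv_real. Qed.

Lemma cv_act h M u v : creal h ->
  cv (cact h M) u v = cv h (M 0 0 * u + M 0 1 * v) (M 1 0 * u + M 1 1 * v).
Proof. by move=> [h1 h2]; rewrite /cact /cv /cs /= !conjE h1 h2; ring. Qed.

Lemma cs_act h M u v u' v' : creal h ->
  cs (cact h M) u v u' v' = cs h (M 0 0 * u + M 0 1 * v) (M 1 0 * u + M 1 1 * v)
    (M 0 0 * u' + M 0 1 * v') (M 1 0 * u' + M 1 1 * v').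
Proof. by move=> [h1 h2]; rewrite /cact /cv /cs /= !conjE h1 h2; ring. Qed.

Lemma cdisc_act h M : creal h -> cdisc (cact h M) = cdisc h * (\det M * conj (\det M)).
Proof.
by move=> [h1 h2]; rewrite [M]mx2_eta det_mx2 /cdisc /cact /cv /cs /= !mx2E !conjE h1 h2; ring.
Qed.

Lemma cv_scale h k u v : cv h (k * u) (k * v) = (k * conj k) * cv h u v.
Proof. by rewrite /cv !conjE; ring. Qed.

Lemma mulc_conj_gt0 (k : C) : k != 0 -> 0 < k * conj k.
Proof. by move=> k0; rewrite mul_conjC_gt0. Qed.

Definition hproj (u v : C) : sphere R := if v == 0 then None else Some (u / v).

Lemma proj_surj p : exists u v, ~~ ((u == 0) && (v == 0)) /\ p = hproj u v.
Proof.
case: p => [z|]; first by exists z, 1; rewrite oner_eq0 andbF /hproj oner_eq0 divr1.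
by exists 1, 0; rewrite oner_eq0 /hproj eqxx.
Qed.

Lemma mobius_proj A u v : ~~ ((u == 0) && (v == 0)) ->
  mobius A (hproj u v) = hproj (A 0 0 * u + A 0 1 * v) (A 1 0 * u + A 1 1 * v).
Proof.
rewrite {1}/hproj; have [->|v0] := eqVneq v 0.
  rewrite andbT !mulr0 !addr0 /hproj /= => u0; rewrite mulf_eq0 (negbTE u0) orbF.
  by case: eqVneq => // a0; rewrite -mulf_div divff // mulr1.
move=> _ /=; have e a b : a * (u / v) + b = (a * u + b * v) / v by field.
rewrite !e mulf_eq0 invr_eq0 (negbTE v0) orbF /hproj.
by case: eqVneq => // w0; congr Some; field; rewrite w0 v0.
Qed.

Lemma sv_proj h u v : ~~ ((u == 0) && (v == 0)) ->
  exists2 n : C, 0 < n & cv h u v = n * sv h (hproj u v).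
Proof.
rewrite /hproj; have [->|v0] := eqVneq v 0.
  rewrite andbT => u0; exists (u * conj u); first exact: mulc_conj_gt0.
  by rewrite /cv /= !conjE; ring.
move=> _; exists (v * conj v); first exact: mulc_conj_gt0.
rewrite /= -cv_scale mulr1; congr cv; by rewrite mulrCA divff // mulr1.
Qed.

Lemma SL2_mx_neq0 (M : SL2 C) u v : ~~ ((u == 0) && (v == 0)) ->
  ~~ ((M 0 0 * u + M 0 1 * v == 0) && (M 1 0 * u + M 1 1 * v == 0)).
Proof.
apply: contra => /andP[/eqP h1 /eqP h2].
have := SL2_det M; rewrite [SLmx M]mx2_eta det_mx2 => d.
have eu : u = M 1 1 * (M 0 0 * u + M 0 1 * v) - M 0 1 * (M 1 0 * u + M 1 1 * v).
  by rewrite -[LHS]mul1r -d; ring.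
have ev : v = M 0 0 * (M 1 0 * u + M 1 1 * v) - M 1 0 * (M 0 0 * u + M 0 1 * v).
  by rewrite -[LHS]mul1r -d; ring.
by rewrite h1 h2 !mulr0 subr0 in eu ev; rewrite eu ev !eqxx.
Qed.

Lemma mobiusM (M N : SL2 C) p : mobius (M * N)%g p = mobius M (mobius N p).
Proof.
have [u [v [uv ->]]] := proj_surj p.
rewrite !mobius_proj ?SL2_mx_neq0 // SL2_mulE.
rewrite [SLmx M]mx2_eta [SLmx N]mx2_eta mx2M !mx2E; congr hproj; ring.
Qed.

Lemma mobius1 p : mobius (1%g : SL2 C) p = p.
Proof.
have [u [v [uv ->]]] := proj_surj p.
have e1 : SLmx (1%g : SL2 C) = mx2 1 0 0 1 by rewrite mx2_id.
by rewrite mobius_proj // e1 !mx2E; congr hproj; ring.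
Qed.

Lemma sv_act h (M : SL2 C) p : creal h ->
  exists2 n : C, 0 < n & sv (cact h M) p = n * sv h (mobius M p).
Proof.
move=> hr; have [u [v [uv ->]]] := proj_surj p.
have [n n0 e1] := sv_proj (cact h M) uv.
have [n' n'0 e2] := sv_proj h (SL2_mx_neq0 M uv).
rewrite mobius_proj //; exists (n^-1 * n'); first by rewrite mulr_gt0 ?invr_gt0.
by rewrite -mulrA -e2 -cv_act // e1 mulrA mulVf ?mul1r // lt0r_neq0.
Qed.

Lemma cact_comp h M N : creal h -> cact (cact h M) N = cact h (M *m N).
Proof.
move=> hr; rewrite [M]mx2_eta [N]mx2_eta mx2M /cact.
by rewrite !mx2E !cs_act // !cv_act // !mx2E; congr CForm.
Qed.

Definition cnull (h : cform) : set (sphere R) := [set p | sv h p = 0].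
Definition cpos (h : cform) : set (sphere R) := [set p | 0 < sv h p].

Lemma cact_image h (M : SL2 C) : creal h -> cact h M = h ->
  [set mobius M p | p in cnull h] = cnull h /\ [set mobius M p | p in cpos h] = cpos h.
Proof.
move=> hr hM.
have hV : cact h (M^-1)%g = h.
  rewrite -{1}hM cact_comp // SL2_invE mulmxV ?SL2_unit // -mx2_id /cact /cv /cs !mx2E.
  by case: (h) => a b c /=; rewrite !conjE; congr CForm; ring.
have img (P : C -> bool) : (forall n x, 0 < n -> P (n * x) = P x) ->
    [set mobius M p | p in [set p | P (sv h p)]] = [set p | P (sv h p)].
  move=> hP; have sub (N : SL2 C) p : cact h N = h -> P (sv h p) -> P (sv h (mobius N p)).
    by move=> hN; have [n n0] := sv_act N p hr; rewrite hN => ->; rewrite hP.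
  apply/seteqP; split=> q /= => [[p hp <-]|hq]; first exact: sub.
  by exists (mobius (M^-1)%g q); [exact: sub|rewrite -mobiusM mulgV mobius1].
split; last first.
  by apply: (img (fun x => 0 < x)) => n x n0; rewrite pmulr_rgt0.
have -> : cnull h = [set p | sv h p == 0] by apply/seteqP; split=> p /eqP.
by apply: (img (fun x => x == 0)) => n x n0; rewrite mulf_eq0 gt_eqF.
Qed.

End Hermitian.

(** * The sides of a circle are the components of its complement *)

Section Topology.
Variable R : realType.
Local Notation C := (R[i]).
Local Open Scope complex_scope.
Local Notation conj := (@Num.conj C).

Lemma Re_continuous : continuous (fun z : C^o => complex.Re z : R).
Proof.
move=> z; apply/(@cvgrPdist_lt _ _ _ (nbhs (z : C^o))) => e e0; near=> w.
rewrite -ltcR; apply: (@le_lt_trans _ _ `|z - w|).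
  by rewrite -raddfB; exact: normc_ge_Re.
near: w; apply: (@cvgr_dist_lt _ C^o _ _ _ id z); last by rewrite ltcR.
exact: cvg_id.
Unshelve. all: by end_near. Qed.

Lemma conj_continuous : continuous (conj : C^o -> C^o).
Proof.
move=> z; apply/(@cvgrPdist_lt _ _ _ (nbhs (z : C^o))) => e e0; near=> w.
rewrite -rmorphB norm_conjC.
near: w; apply: (@cvgr_dist_lt _ C^o _ _ _ id z) => //.
Unshelve. all: by end_near. Qed.

Lemma real_complex_continuous : continuous (fun t : R => t%:C : C^o).
Proof.
move=> x; apply/cvgrPdist_lt => -[e e'] h.
move: (h); rewrite ltcE /= => /andP[/eqP -> e0]; near=> y.
rewrite -rmorphB normc_def /= expr0n addr0 sqrtr_sqr ltcR.
by near: y; apply: (@cvgr_dist_lt _ R _ (nbhs x) _ id x).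
Unshelve. all: by end_near. Qed.

Lemma cv_continuous (h : cform R) : continuous (fun z : C^o => cv h z 1 : C^o).
Proof.
have cD (f g : C^o -> C^o) : continuous f -> continuous g -> continuous (fun z => f z + g z : C^o).
  by move=> hf hg z; apply: continuousD; [exact: hf|exact: hg].
have cM (f g : C^o -> C^o) : continuous f -> continuous g -> continuous (fun z => f z * g z : C^o).
  by move=> hf hg z; apply: continuousM; [exact: hf|exact: hg].
have cC (k : C^o) : continuous (fun _ : C^o => k) by move=> z; exact: cst_continuous.
have cI : continuous (fun z : C^o => z) by move=> z; exact: cvg_id.
rewrite /cv; apply: (cD); last exact: cC.
apply: (cD); last exact: (cM _ _ (cC _) (cM _ _ cI (cC _))).
apply: (cD); first exact: (cM _ _ (cC _) (cM _ _ cI conj_continuous)).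
exact: (cM _ _ (cC _) (cM _ _ conj_continuous (cC _))).
Qed.

Lemma real_gt0 (x : C) : conj x = x -> (0 < x) = (0 < complex.Re x).
Proof.
by case: x => a b h; rewrite ltcE /=; have := congr1 (@complex.Im R) h => /= /eqP; rewrite eq_sym -addr_eq0 -mulr2n mulrn_eq0 => /= ->.
Qed.

Lemma cv_coord (h : cform R) (x y : R) : creal h ->
  complex.Re (cv h (x +i* y) 1) = complex.Re (ca h) * (x ^+ 2 + y ^+ 2) +
    2 * (complex.Re (cb h) * x + complex.Im (cb h) * y) + complex.Re (cc h).
Proof.
move=> [h1 h2]; rewrite /cv; case: h h1 h2 => [[a a'] [b b'] [c c']] /= h1 h2.
have a0 : a' = 0 by have := congr1 (@complex.Im R) h1; rewrite /=; lra.
have c0 : c' = 0 by have := congr1 (@complex.Im R) h2; rewrite /=; lra.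
rewrite a0 c0; ring.
Qed.

Lemma rectangle_compact (M : R) :
  compact [set z : C^o | `|complex.Re z| <= M /\ `|complex.Im z| <= M].
Proof.
pose f (p : R * R) : C^o := p.1%:C + 'i * p.2%:C.
have -> : [set z : C^o | `|complex.Re z| <= M /\ `|complex.Im z| <= M] =
    f @` (`[- M, M] `*` `[- M, M]).
  apply/seteqP; split=> z /=.
    move=> [h1 h2]; exists (complex.Re z, complex.Im z).
      by rewrite /= !in_itv /= -!ler_norml.
    by case: z {h1 h2} => x y; rewrite /f; simpc.
  move=> [[x y]]; rewrite /= !in_itv /= -!ler_norml => -[h1 h2] <-.
  by rewrite /f; simpc.
apply: continuous_compact; last by apply: compact_setX; exact: segment_compact.
apply: continuous_subspaceT => p.
have c1 : continuous (fun p : R * R => p.1%:C : C^o).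
  move=> q; apply: (@continuous_comp _ _ _ fst (fun t : R => t%:C : C^o)); first exact: cvg_fst.
  exact: real_complex_continuous.
have c2 : continuous (fun p : R * R => p.2%:C : C^o).
  move=> q; apply: (@continuous_comp _ _ _ snd (fun t : R => t%:C : C^o)); first exact: cvg_snd.
  exact: real_complex_continuous.
have c3 : continuous (fun _ : R * R => 'i : C^o) by move=> q; exact: cvg_cst.
have c4 := continuousM (c3 p) (c2 p).
exact: (@continuousD C C^o (R * R)%type _ _ p (c1 p) c4).
Qed.

(** Openness at infinity asks for a compact set outside which the form is positive; when the leading
    coefficient is positive, completing the square provides a rectangle. *)
Lemma open_cpos (h : cform R) : creal h -> open (cpos h).
Proof.
move=> hr; rewrite openE => -[z|] hz.
  suff : nbhs (z : C^o) (Some @^-1` cpos h) by [].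
  have hc : {for (z : C^o), continuous (fun z : C^o => complex.Re (cv h z 1))}.
    apply: (@continuous_comp _ _ _ (fun z : C^o => cv h z 1 : C^o)); first exact: cv_continuous.
    exact: Re_continuous.
  have hz' : 0 < complex.Re (cv h z 1) by rewrite -real_gt0 //; exact: cv_real.
  have H := @cvgr_gt R _ (nbhs (z : C^o)) _ _ _ hc _ hz'.
  apply: (@filterS _ (nbhs (z : C^o)) _ [set w | 0 < complex.Re (cv h w 1)]); last exact: H.
  move=> w /= hw.
  by rewrite /cpos /= real_gt0 //; exact: cv_real.
have a0 : 0 < complex.Re (ca h) by rewrite -real_gt0 //; exact: hr.1.
have [M hM] : exists M, forall x y, ~ (`|x| <= M /\ `|y| <= M) -> 0 < complex.Re (cv h (x +i* y) 1).
  move: (complex.Re (ca h)) (complex.Re (cb h)) (complex.Im (cb h)) (complex.Re (cc h)) a0 (fun x y => @cv_coord h x y hr) => a b b' c a0 e.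
  (* Once |x| or |y| exceeds 2 N / a, one of the two squares exceeds |a c - b^2 - b'^2|. *)
  pose N := 1 + `|b| + `|b'| + `|a * c - b ^+ 2 - b' ^+ 2|.
  exists (2 * N / a) => x y hxy; rewrite e //.
  rewrite -(pmulr_rgt0 _ a0).
  have -> : a * (a * (x ^+ 2 + y ^+ 2) + 2 * (b * x + b' * y) + c) =
    (a * x + b) ^+ 2 + (a * y + b') ^+ 2 + (a * c - b ^+ 2 - b' ^+ 2) by ring.
  have big (n d u v : R) : 0 <= d -> `|v| <= n - 1 - d -> 2 * n / a < `|u| -> d < (a * u + v) ^+ 2.
    move=> d0 hv; rewrite ltr_pdivrMr // => hu; have v0 := normr_ge0 v.
    have := lerB_normD (a * u) v; rewrite normrM (gtr0_norm a0) => h1.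
    rewrite -real_normK ?num_real //; move: `|a * u + v| `|v| `|u| hv hu v0 h1 => t v' u' *.
    apply: (@lt_le_trans _ _ t); first by lra.
    by nra.
  have [hx|hx] := lerP `|x| (2 * N / a).
    have hy : 2 * N / a < `|y| by rewrite ltNge; apply/negP => hy; apply: hxy.
    have := big _ `|a * c - b ^+ 2 - b' ^+ 2| _ b' (normr_ge0 _) _ hy; rewrite {1}/N; have := normr_ge0 b => h1 /(_ ltac:(lra)).
    have := ler_norm (- (a * c - b ^+ 2 - b' ^+ 2)); rewrite normrN; have := sqr_ge0 (a * x + b); lra.
  have := big _ `|a * c - b ^+ 2 - b' ^+ 2| _ b (normr_ge0 _) _ hx; rewrite {1}/N; have := normr_ge0 b' => h1 /(_ ltac:(lra)).
  have := ler_norm (- (a * c - b ^+ 2 - b' ^+ 2)); rewrite normrN; have := sqr_ge0 (a * y + b'); lra.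
exists [set z : C^o | `|complex.Re z| <= M /\ `|complex.Im z| <= M].
  split; first exact: rectangle_compact.
  apply: compact_closed; [exact: norm_hausdorff|exact: rectangle_compact].
move=> p [[[x y] hxy <-]|-> //].
by rewrite /cpos /= real_gt0; [apply: hM|exact: cv_real].
Qed.

Lemma connected_line (A : set R) (z w : C) : connected A ->
  connected ((fun t : R => Some (z + t%:C * w) : sphere R) @` A).
Proof.
move=> hA; apply: connected_continuous_connected => //; apply: continuous_subspaceT => t.
have c1 : {for t, continuous (fun t : R => t%:C : C^o)} by exact: real_complex_continuous.
have c2 : continuous (fun _ : R => w : C^o) by move=> q; exact: cvg_cst.
have c3 : continuous (fun _ : R => z : C^o) by move=> q; exact: cvg_cst.
have c4 := @continuousD C C^o R _ _ t (c3 t) (continuousM c1 (c2 t)).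
apply: (@continuous_comp _ _ _ _ (Some : C^o -> sphere R)); first exact: c4.
exact: one_point_compactification_some_continuous.
Qed.

(** The form is concave along segments, so its finite points of positive value form a convex set,
    and infinity is not among them. *)
Lemma connected_cpos_concave (h : cform R) : creal h -> ca h <= 0 -> connected (cpos h).
Proof.
move=> hr a0; have [[p0 hp0]|h0] := pselect (exists p, cpos h p); last first.
  suff -> : cpos h = set0 by exact: connected0.
  by apply/seteqP; split=> // p hp; case: h0; exists p.
have noneN : ~ cpos h None by rewrite /cpos /= => h1; have := lt_le_trans h1 a0; rewrite ltxx.
case: p0 hp0 => [z0 hz0|/noneN //].
pose L z := (fun t : R => Some (z0 + t%:C * (z - z0)) : sphere R) @` `[0, 1].
have -> : cpos h = \bigcup_(z in [set z | cpos h (Some z)]) L z.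
  apply/seteqP; split=> p.
    case: p => [z hz|/noneN //]; exists z => //; exists 1; first by rewrite /= in_itv /= ler01 lexx.
    by congr Some; rewrite mul1r; ring.
  move=> [z hz [t]]; rewrite /= in_itv /= => /andP[t0 t1] <-.
  rewrite /cpos /=; have := hz; have := hz0; rewrite /cpos /=.
  have t0' : 0 <= t%:C by rewrite lecR.
  have t1' : 0 <= 1 - t%:C by rewrite subr_ge0 lecR.
  have -> : cv h (z0 + t%:C * (z - z0)) 1 =
     (1 - t%:C) * cv h z0 1 + t%:C * cv h z 1 + (t%:C * (1 - t%:C)) * (- ca h * ((z - z0) * conj (z - z0))).
    have ht : conj t%:C = t%:C by apply/eqP; rewrite eq_complex /= oppr0 !eqxx.
    by rewrite /cv !conjE ht; ring.
  move=> p1 p2; have [->|tn] := eqVneq t 0.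
    by rewrite subr0 !mul0r mul1r !addr0.
  apply: ltr_wpDr.
    apply: mulr_ge0; first exact: mulr_ge0.
    by apply: mulr_ge0; [rewrite oppr_ge0|exact: mul_conjC_ge0].
  by rewrite ltr_wpDl ?mulr_ge0 ?(ltW p1) // mulr_gt0 // ltcR lt_neqAle eq_sym tn.
apply: bigcup_connected.
  exists (Some z0) => z _; exists 0; first by rewrite /= in_itv /= ler01 lexx.
  by rewrite mul0r addr0.
by move=> z _; apply: connected_line; exact: segment_connected.
Qed.

(** A neighbourhood of infinity misses only points of a compact, hence bounded, set. *)
Lemma closure_ray (z w : C) : w = 1 \/ w = -1 ->
  closure ((fun t : R => Some (z + t%:C * w) : sphere R) @` `[0, +oo[) None.
Proof.
move=> hw U [K [cK _] hU].
have : bounded_set ((fun z : C^o => complex.Re z : R) @` K).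
  apply: compact_bounded; apply: continuous_compact => //.
  apply: continuous_subspaceT => x; exact: Re_continuous.
move=> [M [_ hM]].
have [m hb] : exists m : R, forall x, K x -> `|complex.Re x| <= m.
  exists (`|M| + 1) => x hx; apply: (hM (`|M| + 1)); first by apply: le_lt_trans (ler_norm M) _; rewrite ltrDl.
  by exists x.
have [t [t0 ht]] : exists t : R, 0 <= t /\ m < `|complex.Re (z + t%:C * w)|.
  case: z => x y; exists (`|m| + 1 + `|x|).
  have := ler_norm m; have := ler_norm x; have := ler_norm (- x); rewrite normrN.
  move: (normr_ge0 m) (normr_ge0 x) => h1 h2 h3 h4 h5; split; first by lra.
  case: hw => ->; rewrite /= ?oppr0 ?mulr0 ?mul0r ?subr0.
    by apply: lt_le_trans (ler_norm _); lra.
  by rewrite -normrN; apply: lt_le_trans (ler_norm _); lra.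
exists (Some (z + t%:C * w)); split.
  by exists t => //; rewrite /= in_itv /= t0.
apply: hU; left; exists (z + t%:C * w) => // hK.
by have := hb _ hK; rewrite leNgt ht.
Qed.

(** Convexity fails here, as for the exterior of a disc. Each finite point is instead joined to
    infinity by the horizontal ray along which the form does not decrease, and the closures of these
    rays share the point at infinity. *)
Lemma connected_cpos_convex (h : cform R) : creal h -> 0 < ca h -> connected (cpos h).
Proof.
move=> hr a0.
pose w z := if 0 <= complex.Re (ca h * z + cb h) then 1 else -1 : C.
have hw z : w z = 1 \/ w z = -1 by rewrite /w; case: ifP; [left|right].
pose A z := (fun t : R => Some (z + t%:C * w z) : sphere R) @` `[0, +oo[.
have hA z p : A z p -> cv h z 1 <= sv h p.
  move=> [t]; rewrite /= in_itv /= andbT => t0 <- /=.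
  have ht : conj t%:C = t%:C by apply/eqP; rewrite eq_complex /= oppr0 !eqxx.
  have t0' : 0 <= t%:C by rewrite lecR.
  pose d := ca h * z + cb h.
  have -> : cv h (z + t%:C * w z) 1 = cv h z 1 + t%:C * (w z * (d + conj d)) + ca h * (t%:C * t%:C).
    rewrite /d /cv; case: (hw z) => ->; rewrite !conjE ht (hr.1); ring.
  rewrite -addrA lerDl; apply: addr_ge0; last exact: mulr_ge0 (ltW a0) (mulr_ge0 t0' t0').
  apply: mulr_ge0 => //.
  have -> : d + conj d = (2 * complex.Re d)%:C.
    by case: (d) => x y; apply/eqP; rewrite eq_complex /= subrr; apply/andP; split=> //; apply/eqP; ring.
  rewrite /w -/d; case: ifP => [h1|/negbT]; first by rewrite mul1r lecR mulr_ge0.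
  by rewrite -ltNge => h1; rewrite mulN1r -rmorphN lecR; lra.
have hcl z p : cpos h (Some z) -> closure (A z) p -> cpos h p.
  (* The form is lowered by its value at z: nonnegativity of h' holds along the ray and is a closed
     condition, hence persists on the closure. *)
  move=> hz; pose h' := CForm (ca h) (cb h) (cc h - cv h z 1).
  have hr' : creal h'.
    by case: (hr) => r1 r2; split; rewrite //= conjB r2 cv_real.
  have hB : closed (~` cpos (cneg h')).
    by apply: open_closedC; apply: open_cpos; exact: creal_neg.
  have hsv q : sv h' q = if q is Some _ then sv h q - cv h z 1 else sv h q.
    by case: q => [x|//]; rewrite /h' /= /cv /= !conjE; ring.
  have sub : A z `<=` ~` cpos (cneg h').
    move=> q hq; rewrite /cpos /= sv_neg oppr_gt0 => hlt.
    have := hA z q hq; case: q hq hlt => [x|] hq; last by case: hq.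
    by rewrite hsv /= subr_lt0 => h1 h2; have := lt_le_trans h1 h2; rewrite ltxx.
  move=> /(closureS sub); rewrite -(closure_id _).1 // => hp.
  have : 0 <= sv h' p.
    have rp := sv_real p hr'; rewrite real_leNgt ?real0 ?CrealE ?rp //.
    by apply/negP => hlt; apply: hp; rewrite /cpos /= sv_neg oppr_gt0.
  rewrite hsv; case: p hp => [x|] hp; last by move=> _; exact: a0.
  by rewrite subr_ge0; apply: lt_le_trans.
have -> : cpos h = \bigcup_(z in [set z | cpos h (Some z)]) closure (A z) `|` [set None].
  apply/seteqP; split=> p; last by case=> [[z hz]|->]; [exact: hcl|exact: a0].
  case: p => [z hz|]; last by right.
  left; exists z => //; apply: subset_closure; exists 0; first by rewrite /= in_itv /= lexx.
  by rewrite mul0r addr0.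
have [[z hz]|hE] := pselect (exists z, cpos h (Some z)); last first.
  rewrite (_ : \bigcup_(z in _) _ = set0) ?set0U; first exact: connected1.
  by apply/seteqP; split=> // p [z hz _]; apply: hE; exists z.
apply: connectedU; [|apply: bigcup_connected|exact: connected1].
- exists None; split=> //; exists z => //; exact: closure_ray.
- by exists None => z' _; exact: closure_ray.
move=> z' _; apply: connected_closure; apply: connected_line.
apply/connected_intervalP; exact: interval_is_interval.
Qed.

Lemma connected_cpos (h : cform R) : creal h -> connected (cpos h).
Proof.
move=> hr; have ra : ca h \is Num.real by rewrite CrealE; apply/eqP; exact: hr.1.
have [a0|a0] := real_leP ra (real0 _).
  exact: connected_cpos_concave.
exact: connected_cpos_convex.
Qed.

Lemma cnull_neg (h : cform R) : cnull (cneg h) = cnull h.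
Proof. by apply/seteqP; split=> p; rewrite /cnull /= sv_neg => /eqP; rewrite ?oppr_eq0 // => /eqP ->; rewrite ?oppr0. Qed.

Lemma cnullC (h : cform R) : creal h -> ~` cnull h = cpos h `|` cpos (cneg h).
Proof.
move=> hr; apply/seteqP; split=> p; rewrite /cnull /cpos /= sv_neg oppr_gt0.
  have r : sv h p \is Num.real by rewrite CrealE sv_real.
  by case: (real_ltgtP r (real0 _)) => // _ _; [right|left].
by case=> h0 e; move: h0; rewrite e ltxx.
Qed.

(** The side is connected, and it is open and closed in the complement because the remainder is the
    open set [cpos (cneg h)]. *)
Lemma component_cpos (h : cform R) p : creal h -> cpos h p ->
  connected_component (~` cnull h) p = cpos h.
Proof.
move=> hr hp; apply/seteqP; split=> q; last first.
  apply: connected_component_max => //; last exact: connected_cpos.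
  by rewrite cnullC // => x; left.
move=> [B [Bp BS cB] Bq].
suff e : B `&` cpos h = B by have [] : (B `&` cpos h) q by rewrite e.
apply: cB; [by exists p|by exists (cpos h) => //; exact: open_cpos|].
exists (~` cpos (cneg h)); first by apply: open_closedC; apply: open_cpos; exact: creal_neg.
apply/seteqP; split=> x [Bx hx]; split=> //.
  rewrite /cpos /= sv_neg oppr_gt0 => h1.
  by have := lt_trans hx h1; rewrite ltxx.
by have := BS _ Bx; rewrite cnullC // => -[].
Qed.

End Topology.

(** * Circles and the forms defining them *)

Section Circles.
Variable R : realType.
Local Notation C := (R[i]).
Local Notation conj := (@Num.conj C).

Definition scform (k : C) (h : cform R) := CForm (k * ca h) (k * cb h) (k * cc h).

Lemma sv_scform k h p : conj k = k -> sv (scform k h) p = k * sv h p.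
Proof. by move=> rk; case: p => [z|//]; rewrite /= /cv /= conjM rk; ring. Qed.

Let conj_i : conj 'i = - 'i. Proof. exact: conjCi. Qed.
Let ii : 'i * 'i = -1 :> C. Proof. by rewrite -expr2 sqrCi. Qed.
Let n2 : (2 : C) != 0. Proof. by rewrite pnatr_eq0. Qed.

Let ib (x : C) : 'i * (x - conj x) = 0 -> conj x = x.
Proof.
by move=> /eqP; rewrite mulf_eq0 (negbTE (neq0Ci _)) subr_eq0 eq_sym /= => /eqP.
Qed.

(* Four points of the circle, or three of the line, determine the form. *)
Lemma cnull_scale (h h1 : cform R) : creal h -> creal h1 -> 0 < cdisc h ->
  cnull h `<=` cnull h1 -> exists2 k, conj k = k & h1 = scform k h.
Proof.
case: h h1 => [a b c] [a1 b1 c1] [/= ra rc] [/= ra1 rc1]; rewrite /cdisc /= => D0 sub.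
have [a0|a0] := eqVneq a 0; last first.
  have [s [rs ss s0]] : exists s, [/\ conj s = s, s * s = (b * conj b - a * c) / (a * a) & s != 0].
    exists (sqrtC (b * conj b - a * c) / a); split.
    - by rewrite conjM fmorphV /= ra geC0_conj // sqrtC_ge0 ltW.
    - by rewrite mulf_div -!expr2 sqrtCK.
    - by rewrite mulf_neq0 ?invr_eq0 // sqrtC_eq0 gt_eqF.
  have [z0 [ez0 rz0]] : exists z0, z0 = - b / a /\ conj z0 = - conj b / a.
    by exists (- b / a); rewrite conjM conjN fmorphV /= ra.
  have [w ew] : exists w, w = a1 * z0 + b1 by eexists.
  (* The points of the circle are z0 + s u, where h1 takes the value a1 s^2 + 2 s Re(conj(u) w) plus
     a constant. The choices u = 1, -1, i, - i force w = 0, that is, a common center. *)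
  have key u : u * conj u = 1 ->
      a1 * (s * s) + s * (conj u * w + u * conj w) + cv (CForm a1 b1 c1) z0 1 = 0.
    move=> hu; have : cnull (CForm a b c) (Some (z0 + s * u)).
      rewrite /cnull /= /cv /= !conjE rs rz0 ez0.
      transitivity (a * ((s * s) * (u * conj u)) - (b * conj b - a * c) / a); first by field.
      by rewrite hu ss; field.
    move/sub; rewrite /cnull /= => <-; rewrite ew /cv /= !conjE rs ra1.
    by rewrite -[a1 * (s * s)]mulr1 -[X in _ * (s * s) * X + _]hu; ring.
  have k1 := key 1 ltac:(by rewrite conj_1 mulr1).
  have k2 := key (-1) ltac:(by rewrite conjN conj_1 mulrNN mulr1).
  have k3 := key 'i ltac:(by rewrite conj_i mulrN ii opprK).
  have k4 := key (- 'i) ltac:(by rewrite conjN conj_i opprK mulNr ii opprK).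
  have e1 : w + conj w = 0.
    apply: (mulfI (mulf_neq0 n2 s0)); rewrite mulr0 -[RHS](subrr 0) -{1}k1 -k2 !conjE; ring.
  have e2 : 'i * (w - conj w) = 0.
    apply: (mulfI (mulf_neq0 n2 s0)); rewrite mulr0 -[RHS](subrr 0) -{1}k4 -k3 !conjE conj_i; ring.
  have w0 : w = 0.
    apply: (mulfI n2); rewrite mulr0 -[RHS]e1 (ib e2); ring.
  have eb : b1 = a1 / a * b.
    by rewrite -[LHS](addrK (a1 * z0)) [b1 + _]addrC -ew w0 ez0; field.
  exists (a1 / a); first by rewrite conjM fmorphV /= ra ra1.
  rewrite /scform /= -eb; congr CForm; first by field.
  move: k1; rewrite w0 conj_0 !mulr0 addr0 mulr0 addr0 ss /cv /= rz0 eb !conjE fmorphV /= ra ra1 ez0.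
  move=> h; rewrite -[LHS]addr0 -[RHS]add0r -{2}h -[X in _ + X = _](subrr (a1 / a * c)).
  by field.
subst a; have b0 : b != 0 by apply/eqP => b0; move: D0; rewrite b0 !mul0r subrr ltxx.
have cb0 : conj b != 0 by rewrite conjC_eq0.
have a10 : a1 = 0 by exact: (sub None).
subst a1; pose t := b1 / b.
have et : b1 = t * b by rewrite /t divfK.
(* The line is parametrized by z = (- c/2 + i x) / conj(b) with x real; the points x = 0 and x = 1
   suffice, infinity having given a1 = 0. *)
have key (x : C) : conj x = x -> t * (- c / 2 - 'i * x) + conj t * (- c / 2 + 'i * x) + c1 = 0.
  move=> rx; have [z [hz hzc]] : exists z, z = (- c / 2 + 'i * x) / conj b /\
      conj z = (- c / 2 - 'i * x) / b.
    eexists; split=> //; rewrite conjM fmorphV /= conjCK conjD !conjM conjN fmorphV /=.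
    by rewrite rmorph_nat rc rx conj_i; field.
  have : cnull (CForm 0 b c) (Some z).
    by rewrite /cnull /= /cv /= conj_1 hzc hz; field; rewrite b0 cb0.
  move/sub; rewrite /cnull /= => <-.
  by rewrite /cv /= et conj_1 conjM hzc hz; field; rewrite b0 cb0.
have k0 := key 0 (conj_0 R); have k1 := key 1 (conj_1 R).
have rt : conj t = t.
  apply: ib; rewrite -[RHS](subrr 0) -[X in _ = X - _]k0 -[X in _ = _ - X]k1; ring.
exists t => //; rewrite /scform /= mulr0 -et; congr CForm.
move: k0; rewrite rt mulr0 subr0 addr0 => /eqP; rewrite addrC addr_eq0 => /eqP ->.
by field.
Qed.

Lemma sv_neq0 (h : cform R) : 0 < cdisc h -> exists p, sv h p != 0.
Proof.
case: h => a b c D0.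
have [a0|] := eqVneq a 0; last by exists None.
have [c0|c0] := eqVneq c 0; last first.
  by exists (Some 0); rewrite /= /cv /= a0 !(mul0r, mulr0, add0r, conj_0, conj_1, mulr1).
subst a c; exists (Some b); move: D0; rewrite /cdisc /= mulr0 subr0 => D0.
rewrite /cv /= !conjE !(mul0r, mulr1, add0r, addr0) [conj b * b]mulrC -mulr2n mulrn_eq0 /=.
by rewrite gt_eqF.
Qed.

(** The transformed form vanishes on the same circle, hence is k h with k real, and the determinant
    gives k^2 = 1. The value k = -1 would exchange the two sides, contrary to the preservation of
    components. *)
Lemma act_of_preserves (h : cform R) (A : SL2 C) : creal h -> 0 < cdisc h ->
  [set act (pcl A) p | p in cnull h] = cnull h ->
  (forall K, is_component (~` cnull h) K -> [set act (pcl A) p | p in K] = K) ->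
  cact h A = h.
Proof.
rewrite act_pcl => hr D0 hS hK.
have hr1 := creal_act A hr.
have [k rk hk] : exists2 k, conj k = k & cact h A = scform k h.
  apply: cnull_scale => // p hp; have [n n0] := sv_act A p hr; rewrite /cnull /= => ->.
  suff : cnull h (mobius A p) by rewrite /cnull /= => ->; rewrite mulr0.
  by rewrite -hS; exists p.
have k2 : k * k = 1.
  have := cdisc_act A hr; rewrite SL2_det conj_1 !mulr1 hk => e.
  apply: (mulIf (lt0r_neq0 D0)); rewrite mul1r -[RHS]e /cdisc /= conjM rk; ring.
have hsv p : sv (cact h A) p = k * sv h p by rewrite hk sv_scform.
have hv h' p : creal h' -> ~` cnull h = cpos h' `|` cpos (cneg h') -> cnull h' = cnull h ->
    0 < sv h' p -> 0 < sv h' (mobius A p).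
  move=> hr' hC hN hp; have comp := component_cpos hr' (hp : cpos h' p).
  have : is_component (~` cnull h) (cpos h').
    by exists p; [rewrite hC; left|rewrite -comp hN].
  by move=> /hK e; have : cpos h' (mobius A p) by rewrite -e; exists p.
have [p hp] := sv_neq0 D0.
have [n n0 en] := sv_act A p hr; rewrite hsv in en.
have k0 : 0 <= k.
  have rp : sv h p \is Num.real by rewrite CrealE sv_real.
  have hcc : ~` cnull h = cpos (cneg h) `|` cpos (cneg (cneg h)).
    by rewrite -cnull_neg cnullC //; exact: creal_neg.
  case: (real_ltgtP rp (real0 _)) hp => // hp _.
    have := hv (cneg h) p (creal_neg hr) hcc (cnull_neg h); rewrite !sv_neg !oppr_gt0.
    by move=> /(_ hp) h1; rewrite -(nmulr_rle0 k hp) mulrC en ltW // nmulr_llt0.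
  have := hv h p hr (cnullC hr) erefl hp => h1.
  by rewrite -(pmulr_lge0 k hp) en ltW // mulr_gt0.
have -> : cact h A = scform 1 h.
  rewrite hk; congr scform; apply/eqP; rewrite -subr_eq0.
  have : (k - 1) * (k + 1) = 0 by rewrite -[RHS](subrr 1) -[X in _ = X - _]k2; ring.
  by move/eqP; rewrite mulf_eq0 => /orP[//|]; rewrite gt_eqF // ltr_wpDl.
by rewrite /scform; case: (h) => a b c /=; rewrite !mul1r.
Qed.

Lemma preserves_of_act (h : cform R) (G : set (PSL2 C)) : creal h ->
  (forall A, G (pcl A) -> cact h A = h) -> preserves_circle G (cnull h).
Proof.
move=> hr hG g; rewrite -(pcl_repr g) act_pcl => /hG e.
have [e1 e2] := cact_image hr e.
have e' : cact (cneg h) (repr g) = cneg h.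
  by rewrite -[in RHS]e /cact /cneg /cv /cs /=; congr CForm; rewrite conjN; ring.
have [_ e3] := cact_image (creal_neg hr) e'.
split=> // K [p]; rewrite {1}cnullC // => -[hp|hp] ->.
  by rewrite component_cpos.
by rewrite -cnull_neg component_cpos //; exact: creal_neg.
Qed.

Lemma preservesP (h : cform R) (G : set (PSL2 C)) : creal h -> 0 < cdisc h ->
  preserves_circle G (cnull h) <-> forall A, G (pcl A) -> cact h A = h.
Proof.
move=> hr D0; split; last exact: preserves_of_act.
by move=> hG A /hG[h1 h2]; apply: act_of_preserves.
Qed.

Lemma circle_cform (S : set (sphere R)) : is_circle S ->
  exists h, [/\ creal h, 0 < cdisc h & S = cnull h].
Proof.
have cR (t : R) : conj (t%:C)%C = (t%:C)%C by apply/eqP; rewrite eq_complex /= oppr0 !eqxx.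
case=> [[z0 [r [r0 ->]]]|[z0 [v [v0 ->]]]].
  have r0' : 0 < (r%:C)%C by rewrite ltcR.
  exists (CForm 1 (- z0) (z0 * conj z0 - (r%:C)%C ^+ 2)); split.
  - by split; [exact: conj_1|rewrite [cc _]/= expr2 !conjE !cR; ring].
  - by rewrite /cdisc /= !conjE; have := mulr_gt0 r0' r0'; congr (_ < _); ring.
  have hz z : (`|z - z0| = (r%:C)%C) <-> (z - z0) * conj (z - z0) = (r%:C)%C ^+ 2.
    rewrite -normCK; split=> [->//|/eqP]; by rewrite eqrXn2 ?normr_ge0 ?(ltW r0') // => /eqP.
  apply/seteqP; split=> p.
    move=> [z /hz e ->]; rewrite /cnull /= /cv /= -e !conjE; ring.
  rewrite /cnull /=; case: p => [z|/eqP]; last by rewrite oner_eq0.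
  rewrite /= /cv /= => e; exists z => //; apply/hz; apply/eqP; rewrite -subr_eq0 -e !conjE.
  by apply/eqP; ring.
(* Up to a real factor this is Im(conj(v) (z - z0)). *)
exists (CForm 0 (- 'i * v) ('i * (v * conj z0 - conj v * z0))); split.
- by split; rewrite /= !conjE // conj_i; ring.
- rewrite /cdisc /= mul0r subr0 !conjE conj_i.
  have -> : - 'i * v * (- - 'i * conj v) = - ('i * 'i) * (v * conj v) by ring.
  by rewrite ii opprK mul1r mul_conjC_gt0.
apply/seteqP; split=> p; rewrite /cnull /=.
  move=> [->|[t ->]] //; rewrite /= /cv /= !conjE conj_i cR; ring.
case: p => [z|]; last by left.
have [t ->] : exists t, z = z0 + t * v by exists ((z - z0) / v); rewrite divfK // addrC subrK.
rewrite /= /cv /= => e; right.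
have rt : conj t = t.
  apply: ib; apply: (mulfI (mulf_neq0 v0 (_ : conj v != 0))); first by rewrite conjC_eq0.
  by rewrite mulr0 -[RHS]e !conjE conj_i; ring.
exists (complex.Re t); congr (Some (_ + _ * _)).
by rewrite RRe_real // CrealE rt.
Qed.

Lemma is_circle_cnull (h : cform R) : creal h -> 0 < cdisc h -> ca h != 0 -> is_circle (cnull h).
Proof.
case: h => a b c [/= ra rc]; rewrite /cdisc /= => D0 a0; left.
have d0 : 0 < (b * conj b - a * c) / (a * a).
  by rewrite divr_gt0 // -{1}ra mulrC mul_conjC_gt0.
have [r [r0 hr]] : exists r : R, 0 < r /\ (r%:C)%C ^+ 2 = (b * conj b - a * c) / (a * a).
  move: d0; case: (_ / _) => x y; rewrite ltcE /= => /andP[/eqP -> x0].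
  exists (Num.sqrt x); rewrite sqrtr_gt0; split=> //.
  by rewrite -rmorphXn /= sqr_sqrtr // ltW.
have r0' : 0 < (r%:C)%C by rewrite ltcR.
exists (- b / a), r; split=> //.
have hz z : (`|z - - b / a| = (r%:C)%C) <-> cv (CForm a b c) z 1 = 0.
  have -> : cv (CForm a b c) z 1 = a * (`|z - - b / a| ^+ 2 - (r%:C)%C ^+ 2).
    by rewrite hr normCK /cv /= !conjE fmorphV /= ra; field.
  split=> [->|/eqP]; first by rewrite subrr mulr0.
  by rewrite mulf_eq0 (negbTE a0) subr_eq0 eqrXn2 ?normr_ge0 ?(ltW r0') // => /eqP.
apply/seteqP; split=> p; last by move=> [z /hz e ->]; exact: e.
rewrite /cnull /=; case: p => [z /= /hz e|e]; first by exists z.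
by move: e; rewrite /= => e; rewrite e eqxx in a0.
Qed.

End Circles.

(** * F-subgroups *)

Section Bridge.
Variable R : realType.
Local Notation C := (R[i]).
Local Notation conj := (@Num.conj C).

Definition cform_of (H : hform) : cform R :=
  CForm (fA H)%:~R (zsC R (fB H)) (fC H)%:~R.

Lemma creal_of H : creal (cform_of H).
Proof. by split; exact: conjI. Qed.

Lemma cdisc_of H : cdisc (cform_of H) = (hdisc H)%:~R.
Proof. by rewrite /cdisc /= -zsC_cz -rmorphM -nzE /= zsC_int /hdisc intrB intrM. Qed.

Lemma cs_of H u v u' v' :
  cs (cform_of H) (zsC R u) (zsC R v) (zsC R u') (zsC R v') = zsC R (hs H u v u' v').
Proof.
have zD x y : zsC R (x + y) = zsC R x + zsC R y by exact: rmorphD.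
have zM x y : zsC R (x * y) = zsC R x * zsC R y by exact: rmorphM.
by rewrite /cs /hs /= !zD !zM !zsC_cz !zsC_int.
Qed.

Lemma cv_of H u v : cv (cform_of H) (zsC R u) (zsC R v) = (hq H u v)%:~R.
Proof.
rewrite -zsC_int hqE -cs_of /cv /cs; ring.
Qed.

Lemma cact_of H p q r s : cact (cform_of H) (zmx R p q r s) = cform_of (hact H p q r s).
Proof. by rewrite /cact /zmx !mx2E !cv_of cs_of. Qed.

Lemma cform_of_inj : injective cform_of.
Proof.
move=> [a b c] [a' b' c'] [/eqP h1 h2 /eqP h3].
by rewrite (zsC_inj h2); move: h1 h3; rewrite !eqr_int => /eqP -> /eqP ->.
Qed.

Lemma circle_locusE A b1 b2 E :
  circle_locus A (zsqrtm2 R b1 b2) E = cnull (cform_of (HForm A (ZS b1 b2) E)).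
Proof.
apply/seteqP; split=> -[z|]; rewrite /circle_locus /cnull /= ?/cv /= ?conj_1 ?mulr1.
- move=> <-; rewrite /zsC /=; ring.
- by move=> ->.
- move=> <-; rewrite /zsC /=; ring.
- by move/eqP; rewrite intr_eq0 => /eqP.
Qed.

(** Elements of the Bianchi group have lifts over O, so equality of complex forms descends to
    equality of integral ones; the two lifts A and - A act alike on forms. *)
Lemma stabO_preserves H (G : set (PSL2 C)) : 0 < hdisc H -> G `<=` @Bianchi2 R ->
  preserves_circle G (cnull (cform_of H)) <-> G `<=` stabO H.
Proof.
move=> D0 hG; rewrite preservesP; [|exact: creal_of|by rewrite cdisc_of ltr0z].
split=> h.
  move=> g gG; have [p [q [r [s [A [e eA]]]]]] := (Bianchi2P _).1 (hG _ gG).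
  exists p, q, r, s, A; split=> //; apply: cform_of_inj.
  by rewrite -cact_of -eA; apply: h; rewrite -e.
move=> A /h[p [q [r [s [B [e eB hact]]]]]].
have [->|->] : SLmx A = SLmx B \/ SLmx A = - SLmx B.
  by have /pcl_eq/orP[/eqP|/eqP] := e; [left|right].
  by rewrite eB cact_of hact.
rewrite -[RHS](_ : cact (cform_of H) (SLmx B) = _); last by rewrite eB cact_of hact.
by rewrite /cact /cv /cs !mxE !conjN; congr CForm; ring.
Qed.

Lemma elementary_sub (G G' : set (PSL2 C)) : G `<=` G' -> elementary G' -> elementary G.
Proof.
move=> sub; case=> [[p hp]|[p p0 hp]]; [left; exists p|right; exists p => //];
  by apply: sub_finite_set hp => q [g gG <-]; exists g => //; apply: sub.
Qed.

Lemma stabO_Fuchsian H : 0 < hdisc H -> is_circle (cnull (cform_of H)) ->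
  Fuchsian (@Bianchi2 R) (stabO H).
Proof.
move=> D0 hc; have [h1 h2] := stabO_subgroup R H; split=> //.
by exists (cnull (cform_of H)) => //; apply/stabO_preserves.
Qed.

(** The stabilizer is Fuchsian and inherits nonelementarity from its subgroup F, so maximality of F
    gives equality. *)
Lemma F_subgroup_stabO H (F : set (PSL2 C)) : 0 < hdisc H ->
  is_circle (cnull (cform_of H)) -> preserves_circle F (cnull (cform_of H)) ->
  F_subgroup (@Bianchi2 R) F -> F = stabO H.
Proof.
move=> D0 hc hF [[hF1 hF2 _] hF3 hF4].
have sub : F `<=` stabO H by apply/(stabO_preserves D0 hF2).
apply/esym/hF4 => //; first exact: stabO_Fuchsian.
by move=> /(elementary_sub sub).
Qed.

Lemma F_subgroup_represented (D : nat) (F : set (PSL2 C)) : (0 < D)%N ->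
  F_subgroup (@Bianchi2 R) F -> F_disc F (Posz D) ->
  exists2 M : set (Qalg D), listed_order M & represented_by F M.
Proof.
move=> D0 hF [S [hS pS [A [b1 [b2 [E [hg eS eD]]]]]]].
pose H := HForm A (ZS b1 b2) E.
rewrite circle_locusE in eS; rewrite eS in hS pS.
have hD : hdisc H = D by rewrite /hdisc /nz /= eD.
have HD0 : 0 < hdisc H by rewrite hD.
have hz : zprim H.
  move=> r pr [h1 /zdvd_intP[h2 h3] h4].
  have : (r %| gcdz (gcdz (gcdz A b1) b2) E)%Z by rewrite !dvdz_gcd h1 h2 h3 h4.
  by rewrite hg dvdz1 /= eqn_leq leqNgt prime_gt1.
have [a [a' [b [c [e [hb ha' hD' heq]]]]]] := form_reduction R D0 hD hz.
have [rho [bij erho]] := base_form_stabO R D0 hb ha' hD'.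
exists (ordset D a b); first exact: base_form_listed.
exists rho; split=> //; rewrite -erho (F_subgroup_stabO HD0 hS pS hF).
have -> : stabO H = stabO (if e then hneg H else H) :> set (PSL2 C).
  by case: e {heq} => //; rewrite stabO_neg.
exact: stabO_conj.
Qed.

End Bridge.

(** * Pell units in the stabilizers *)

Section Units.
Variables (a : int) (b : zs) (c : int).

(* The elements t + a y j of the order, in the coordinates of HForm a b c. *)
Definition up (t : int) (y : zs) : zs := t%:~R - a%:~R * b * cz y.
Definition uq (y : zs) : zs := (nz b - a * c)%:~R * y - b * b * cz y.
Definition ur (y : zs) : zs := a%:~R * a%:~R * cz y.
Definition us (t : int) (y : zs) : zs := t%:~R + a%:~R * b * cz y.

(** The factor a in t + a y j clears the denominator of the upper right entry, so integrality holds
    for every b. *)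
Lemma unit_stab t y : t ^+ 2 - (nz b - a * c) * a ^+ 2 * nz y = 1 ->
  up t y * us t y - uq y * ur y = 1 /\
  hact (HForm a b c) (up t y) (uq y) (ur y) (us t y) = HForm a b c.
Proof.
move=> h.
have h' : t%:~R * t%:~R - (b * cz b - a%:~R * c%:~R) * (a%:~R * a%:~R) * (y * cz y) = 1 :> zs.
  by rewrite -!nzE -[RHS](_ : 1%:~R = _) // -h; ring.
have eD : (nz b - a * c)%:~R = b * cz b - a%:~R * c%:~R :> zs by rewrite intrB intrM nzE.
have ep : cz (up t y) = t%:~R - a%:~R * cz b * y.
  by rewrite /up rmorphB !rmorphM /= czK !cz_int.
have er : cz (ur y) = a%:~R * a%:~R * y by rewrite /ur !rmorphM /= czK !cz_int.
have es : cz (us t y) = t%:~R + a%:~R * cz b * y.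
  by rewrite /us rmorphD !rmorphM /= czK !cz_int.
have eq : cz (uq y) = (b * cz b - a%:~R * c%:~R) * cz y - cz b * cz b * y.
  by rewrite /uq eD rmorphB !rmorphM rmorphB !rmorphM /= !czK !cz_int; ring.
have d : up t y * us t y - uq y * ur y = 1.
  by rewrite /up /us /uq /ur eD -[RHS]h'; ring.
have hA : hq (HForm a b c) (up t y) (ur y) = a.
  apply: zs_intr_inj; rewrite hqE /hs /= ep er /up /ur -[RHS]mulr1 -[X in _ = _ * X]h'; ring.
have hB : hs (HForm a b c) (up t y) (ur y) (uq y) (us t y) = b.
  by rewrite /hs /= ep er /uq /us eD -[RHS]mulr1 -[X in _ = _ * X]h'; ring.
have hC : hq (HForm a b c) (uq y) (us t y) = c.
  apply: zs_intr_inj; rewrite hqE /hs /= eq es /uq /us eD -[RHS]mulr1 -[X in _ = _ * X]h'; ring.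
by split=> //; rewrite /hact hA hB hC.
Qed.

End Units.

(** The constant 9 is the norm of both 3 and 1 + 2 sqrt(-2), so each solution yields units for two
    values of y that are independent over R. *)
Lemma pell_sequence (R : archiRcfType) (D a : int) : 0 < D -> 0 < a ->
  exists th : zs, th != 0 /\ exists t s : nat -> int,
    (forall i j, (i < j)%N -> `|s i| < `|s j|) /\ (forall i, s i != 0) /\
    forall i, t i ^+ 2 - D * a ^+ 2 * (9 * nz th) * s i ^+ 2 = 1.
Proof.
move=> D0 a0; have [D' eD] : exists n : nat, D = n by exists `|D|%N; lia.
have [th hth hP] := @pell_family R D' ltac:(lia).
exists th; split; first by case: hth => ->.
have /choice[g hg] : forall n : nat, exists ts : int * int, n%:Z < `|ts.2| /\
    ts.1 ^+ 2 - D * a ^+ 2 * (9 * nz th) * ts.2 ^+ 2 = 1.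
  (* The factor 3 a is required by the equation; n + 1 is moved from the coefficient into s, which
     makes |s| exceed n. *)
  move=> n; have [t [s [s0 h]]] := hP (absz (3 * a * n.+1%:Z)) ltac:(lia).
  exists (t, n.+1%:Z * s); split; first by rewrite /= normrM; nia.
  rewrite -[RHS]h /= eD; have -> : (absz (3 * a * n.+1%:Z))%:Z = 3 * a * n.+1%:Z by lia.
  ring.
pose x k := iter k (fun x : int * int => g `|x.2|%N) (g 0%N).
have hx k : x k.+1 = g `|(x k).2|%N by [].
exists (fun k => (x k).1), (fun k => (x k).2); split; last split.
- move=> i j; elim: j => // j IH; rewrite ltnS leq_eqVlt.
  have [h1 _] := hg `|(x j).2|%N; rewrite -hx abszE in h1.
  by move=> /orP[/eqP -> //|/IH h]; exact: lt_trans h h1.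
- move=> [|i]; [have [h _] := hg 0%N; change (is_true (0 < `|(x 0%N).2|)) in h|
    have [h _] := hg `|(x i).2|%N; rewrite -hx abszE in h];
  by apply/eqP => e; move: h; rewrite e normr0 // ltNge normr_ge0.
- by move=> [|i]; [have := hg 0%N|have := hg `|(x i).2|%N] => -[].
Qed.

Section UnitsC.
Variable R : realType.
Local Notation C := (R[i]).
Local Notation conj := (@Num.conj C).
Variables (a : int) (b : zs) (c : int).
Let d : int := nz b - a * c.
Hypotheses (a0 : 0 < a) (d0 : 0 < d).
Local Notation H0 := (HForm a b c).
Local Notation umx t y := (zmx R (up a b t y) (uq a b c y) (ur a y) (us a b t y)).

Let al0 : (a%:~R : C) != 0. Proof. by rewrite intr_eq0 gt_eqF. Qed.
Let S : C := sqrtm2 R.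
Let S0 : S != 0.
Proof.
apply/eqP => h; have := sqrtm2_sqr R; rewrite -/S h mul0r => /eqP.
by rewrite eq_sym oppr_eq0 pnatr_eq0.
Qed.
Let eZ : zsC R (ZS 1 2) = 1 + 2 * S. Proof. by rewrite /zsC /zsqrtm2 /= -/S; ring. Qed.
Let cS : conj (1 + 2 * S) = 1 - 2 * S.
Proof. by rewrite conjD conjM conj_1 rmorph_nat [conj S]conj_sqrtm2 mulrN. Qed.
Let zsC_neq0 x : x != 0 -> zsC R x != 0.
Proof. by rewrite -(rmorph0 (zsC R)) (inj_eq (@zsC_inj R)). Qed.

Let zD x y : zsC R (x + y) = zsC R x + zsC R y. Proof. exact: rmorphD. Qed.
Let zB x y : zsC R (x - y) = zsC R x - zsC R y. Proof. exact: rmorphB. Qed.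
Let zN x : zsC R (- x) = - zsC R x. Proof. exact: rmorphN. Qed.
Let zM x y : zsC R (x * y) = zsC R x * zsC R y. Proof. exact: rmorphM. Qed.
Let dE : (d%:~R : C) = zsC R b * conj (zsC R b) - a%:~R * c%:~R.
Proof. by rewrite /d intrB intrM -zsC_cz -zM -nzE zsC_int. Qed.

Let zup t y : zsC R (up a b t y) = t%:~R - a%:~R * zsC R b * conj (zsC R y).
Proof. by rewrite zB !zM zsC_cz !zsC_int. Qed.
Let zuq y : zsC R (uq a b c y) = d%:~R * zsC R y - zsC R b * zsC R b * conj (zsC R y).
Proof. by rewrite zB !zM zsC_cz !zsC_int. Qed.
Let zur y : zsC R (ur a y) = a%:~R * a%:~R * conj (zsC R y).
Proof. by rewrite !zM zsC_cz !zsC_int. Qed.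
Let zus t y : zsC R (us a b t y) = t%:~R + a%:~R * zsC R b * conj (zsC R y).
Proof. by rewrite zD !zM zsC_cz !zsC_int. Qed.

Let pellC t y : t ^+ 2 - d * a ^+ 2 * nz y = 1 ->
  (t%:~R * t%:~R : C) = 1 + d%:~R * (a%:~R * a%:~R) * (zsC R y * conj (zsC R y)).
Proof.
by move=> h; rewrite -zsC_cz -zM -nzE zsC_int -[X in X + _](_ : 1%:~R = _) // -h; ring.
Qed.

Lemma unit_stabO t y : t ^+ 2 - d * a ^+ 2 * nz y = 1 ->
  exists A : SL2 C, stabO H0 (pcl A) /\ SLmx A = umx t y.
Proof.
move=> /unit_stab[h1 h2]; exists (MkSL2 (zmx_det R h1)); split=> //.
by do 4![eexists]; exists (MkSL2 (zmx_det R h1)); split; [| |exact: h2].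
Qed.

(** An invariant form of the units is a multiple of [H0], so the units preserve one circle only. A
    single Pell solution suffices, used with two independent y and their negatives. *)
Lemma units_determine (h : cform R) (th : zs) (t s : int) : creal h -> th != 0 -> s != 0 ->
  t ^+ 2 - d * a ^+ 2 * (9 * nz th) * s ^+ 2 = 1 ->
  (forall t y, t ^+ 2 - d * a ^+ 2 * nz y = 1 -> cact h (umx t y) = h) ->
  exists2 k, conj k = k & h = scform k (cform_of R H0).
Proof.
case: h => al be ga [/= ral rga] th0 s0 hts hh.
(* In the basis (1, 0), (- b/a, 1), which is orthogonal for [H0], the coefficients of h are al, e
   and g. Proportionality to [H0] means e = 0 and al d + g a^2 = 0. *)
have [e [eE ee]] : exists e, e = be - al * zsC R b / a%:~R /\
    conj e = conj be - al * conj (zsC R b) / a%:~R.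
  by eexists; split=> //; rewrite !conjE fmorphV /= conjI ral.
have [g gE] : exists g, g = al * (zsC R b * conj (zsC R b)) / (a%:~R * a%:~R)
    - be * conj (zsC R b) / a%:~R - conj be * zsC R b / a%:~R + ga by eexists.
have key t' y : t' ^+ 2 - d * a ^+ 2 * nz y = 1 ->
    (al * d%:~R + g * (a%:~R * a%:~R)) * (zsC R y * conj (zsC R y))
      + t'%:~R * (e * conj (zsC R y) + conj e * zsC R y) = 0.
  move=> hy; have := congr1 (@ca R) (hh _ _ hy); rewrite /= /zmx !mx2E zup zur.
  have := pellC hy; rewrite /cv [ca _]/= [cb _]/= [cc _]/= ee eE gE.
  move: (zsC R y) (zsC R b) => Y B; rewrite !conjE.
  move: (conj Y) (conj B) (t'%:~R) (d%:~R) (conj be) => Y' B' T d' be' e1 e2.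
  apply: (mulfI (mulf_neq0 al0 al0)); rewrite mulr0.
  pose gg := al * (B * B') / (a%:~R * a%:~R) - be * B' / a%:~R - be' * B / a%:~R + ga.
  rewrite -[RHS](subrr al) -[X in _ = X - _]e2.
  transitivity ((al * (T * T) + T * (a%:~R * a%:~R) * ((be - al * B / a%:~R) * Y' + (be' - al * B' / a%:~R) * Y)
    + gg * (a%:~R * a%:~R * (a%:~R * a%:~R)) * (Y * Y')) - al).
    by rewrite e1 /gg; field.
  by rewrite /gg; field.
pose Th := zsC R th.
have Th0 : Th != 0 by exact: zsC_neq0.
have sC0 : (s%:~R : C) != 0 by rewrite intr_eq0.
have tC0 : (t%:~R : C) != 0.
  rewrite intr_eq0; apply/eqP => t0; move: hts; rewrite t0.
  have := nz_ge0 th; have : 0 < a ^+ 2 * s ^+ 2 by apply: mulr_gt0; [exact: exprn_gt0|rewrite exprn_even_gt0].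
  move: d d0 (nz th) => d' d'0 n h1 h2 h3.
  have : 0 <= d' * (9 * n) * (a ^+ 2 * s ^+ 2) by apply: mulr_ge0; [apply: mulr_ge0; [exact: ltW|exact: mulr_ge0]|exact: ltW].
  lia.
(* Both y and - y occur with the same t, so the even and the odd part of [key] vanish separately. *)
have two (y0 : zs) : nz y0 = 9 * nz th ->
    (al * d%:~R + g * (a%:~R * a%:~R)) * (zsC R y0 * conj (zsC R y0)) = 0 /\
    e * conj (zsC R y0) + conj e * zsC R y0 = 0.
  move=> hn; have u1 : t ^+ 2 - d * a ^+ 2 * nz (s%:~R * y0) = 1.
    by rewrite -[RHS]hts nzM nz_int hn; ring.
  have u2 : t ^+ 2 - d * a ^+ 2 * nz (- (s%:~R * y0)) = 1 by rewrite nzN.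
  have := key _ _ u1; have := key _ _ u2; rewrite zN zM zsC_int.
  move: (zsC R y0) (al * _ + _) => Y X; rewrite !conjE.
  move: (conj Y) (conj e) => Y' E k2 k1.
  have p1 : s%:~R * t%:~R * (e * Y' + E * Y) = 0.
    apply: (mulfI (_ : (2 : C) != 0)); first by rewrite pnatr_eq0.
    by rewrite mulr0 -[RHS](subrr 0) -[X in _ = X - _]k1 -[X in _ = _ - X]k2; ring.
  have p2 : e * Y' + E * Y = 0 by apply: (mulfI (mulf_neq0 sC0 tC0)); rewrite p1 mulr0.
  split=> //; apply: (mulfI (mulf_neq0 sC0 sC0)); rewrite mulr0.
  by rewrite -[RHS]k1 -[X in _ = X]addr0 -[X in _ = _ + X](oppr0) -[X in _ = _ - X]p1; ring.
have [k1 k2] := two (3%:~R * th) ltac:(by rewrite nzM nz_int).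
have [_ k3] := two (ZS 1 2 * th) ltac:(by rewrite nzM).
(* Re(e conj(y)) vanishes for two values of y independent over R. *)
have e0 : e = 0.
  move: k2 k3; rewrite !zM zsC_int eZ -/Th.
  rewrite !conjM conjI cS => k2 k3.
  apply: (mulIf (_ : conj Th != 0)); first by rewrite conjC_eq0.
  apply: (mulfI (_ : 12 * S != 0)); first by rewrite mulf_neq0 // pnatr_eq0.
  transitivity ((1 + 2 * S) * (e * (3%:~R * conj Th) + conj e * (3%:~R * Th))
    - 3 * (e * ((1 - 2 * S) * conj Th) + conj e * ((1 + 2 * S) * Th))); first by ring.
  by rewrite k2 k3; ring.
have g0 : al * d%:~R + g * (a%:~R * a%:~R) = 0.
  have Y0 : zsC R (3%:~R * th) != 0 by rewrite zM zsC_int mulf_neq0 // intr_eq0.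
  have Y0' : conj (zsC R (3%:~R * th)) != 0 by rewrite conjC_eq0.
  by apply: (mulIf (mulf_neq0 Y0 Y0')); rewrite k1 mul0r.
exists (al / a%:~R); first by rewrite conjM fmorphV /= conjI ral.
have eb : be = al * zsC R b / a%:~R by apply/eqP; rewrite -subr_eq0 -eE e0.
rewrite /scform /=; congr CForm; [by field|by rewrite eb; field|].
move: g0; rewrite gE eb dE.
have -> : conj (al * zsC R b / a%:~R) = al * conj (zsC R b) / a%:~R.
  by rewrite !conjM fmorphV /= conjI ral.
move=> g0; apply: (mulfI (mulf_neq0 al0 al0)); rewrite -[LHS]addr0 -[X in _ + X = _]oppr0 -[X in _ - X = _]g0.
by field.
Qed.


Lemma pigeonhole (T : eqType) (A : set T) (f : nat -> T) : finite_set A ->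
  (forall k, A (f k)) -> exists i j, (i < j)%N /\ f i = f j.
Proof.
move=> /finite_seqP[l ->] hf.
have [hu|/(uniqPn (f 0%N))[i [j [ij]]]] := boolP (uniq [seq f k | k <- iota 0 (size l).+1]).
  suff /(uniq_leq_size hu) : {subset [seq f k | k <- iota 0 (size l).+1] <= l} by rewrite size_map size_iota ltnn.
  by move=> x /mapP[k _ ->]; exact: hf.
rewrite size_map size_iota => hj e; exists i, j; split=> //.
by move: e; rewrite !(nth_map 0%N) ?size_iota ?(ltn_trans ij) // !nth_iota // (ltn_trans ij).
Qed.

Lemma proj_cross (u v u' v' : C) : ~~ ((u == 0) && (v == 0)) -> ~~ ((u' == 0) && (v' == 0)) ->
  hproj u v = hproj u' v' -> u * v' = u' * v.
Proof.
rewrite /hproj; have [->|v0] := eqVneq v 0; have [->|v'0] := eqVneq v' 0 => //.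
  by rewrite !mulr0.
move=> _ _ [e]; apply: (mulIf (mulf_neq0 (invr_neq0 v0) (invr_neq0 v'0))).
transitivity (u / v); first by field; rewrite v0 v'0.
by rewrite e; field; rewrite v0 v'0.
Qed.

Variables (th : zs) (t s : nat -> int).
Hypotheses (th0 : th != 0) (s_inc : forall i j, (i < j)%N -> `|s i| < `|s j|)
  (hts : forall i, t i ^+ 2 - d * a ^+ 2 * (9 * nz th) * s i ^+ 2 = 1).

Let unit_k y0 k : nz y0 = 9 * nz th ->
  t k ^+ 2 - d * a ^+ 2 * nz ((s k)%:~R * y0) = 1.
Proof. by move=> hn; rewrite -[RHS](hts k) nzM nz_int hn; ring. Qed.

(** Units with parallel y commute and have the same fixed points on the sphere. A finite orbit makes
    two of them agree at the point; the resulting relation is the fixed point equation times t_i s_j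
    - t_j s_i, nonzero because |s| increases. *)
Let fixed_point (y0 : zs) (u v : C) : nz y0 = 9 * nz th -> ~~ ((u == 0) && (v == 0)) ->
  finite_set [set act g (hproj u v) | g in @stabO R H0] ->
  a%:~R * a%:~R * conj (zsC R y0) * (u + zsC R b / a%:~R * v) ^+ 2 = d%:~R * zsC R y0 * v ^+ 2.
Proof.
move=> hn uv fin.
have /choice[g hg] k := unit_stabO (unit_k k hn).
have [i [j [ij e]]] := pigeonhole fin (fun k => ex_intro2 _ _ (pcl (g k)) (hg k).1 erefl).
move: e; rewrite !act_pcl !mobius_proj // => e.
have := proj_cross (SL2_mx_neq0 _ uv) (SL2_mx_neq0 _ uv) e.
rewrite (hg i).2 (hg j).2 /zmx !mx2E !(zup, zuq, zur, zus) !zM !zsC_int.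
move: (zsC R y0) (zsC R b) (t i) (s i) (t j) (s j) (s_inc ij) (hts i) (hts j).
move=> Y B ti si tj sj hij hi hj; rewrite !conjE => h.
have n0 : ti * sj - tj * si != 0.
  apply/eqP => h0; have h1 : si ^+ 2 < sj ^+ 2 by rewrite -(real_normK (num_real si)) -(real_normK (num_real sj)) ltrXn2r.
  move: hi hj h0; move: (d * a ^+ 2 * _) => N hi hj h0.
  have : ti ^+ 2 * sj ^+ 2 = tj ^+ 2 * si ^+ 2 by rewrite -!exprMn; congr (_ ^+ 2); lia.
  have -> : ti ^+ 2 = 1 + N * si ^+ 2 by lia.
  have -> : tj ^+ 2 = 1 + N * sj ^+ 2 by lia.
  by rewrite !mulrDl !mul1r mulrAC => /addIr h2; rewrite h2 ltxx in h1.
have n0C : (ti%:~R * sj%:~R - tj%:~R * si%:~R : C) != 0 by rewrite -!intrM -intrB intr_eq0.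
apply/eqP; rewrite -subr_eq0; apply/eqP; apply: (mulfI n0C).
move/eqP: h; rewrite -subr_eq0 => /eqP h; rewrite mulr0 -[RHS]h.
by field.
Qed.

(** On the sphere, the fixed point equations for two y independent over R have no common nonzero
    solution. In H^3, the heights of the images of a point tend to 0 along the units, since the
    lower left entries are unbounded. *)
Lemma stabO_nonelementary : ~ elementary (@stabO R H0).
Proof.
case=> [[p]|[[z tau] /= tau0 fin]].
  have [u [v [uv ->]]] := proj_surj p => fin.
  have := fixed_point (_ : nz (3%:~R * th) = 9 * nz th) uv fin; rewrite nzM nz_int => /(_ erefl).
  have := fixed_point (_ : nz (ZS 1 2 * th) = 9 * nz th) uv fin; rewrite nzM => /(_ erefl).
  set w := u + _.
  have Th0 := zsC_neq0 th0.
  rewrite !zM zsC_int eZ !conjM conjI cS => k1 k2.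
  have dC0 : (d%:~R : C) != 0 by rewrite intr_eq0 gt_eqF.
  have v0 : v = 0.
    suff : (12 * S * zsC R th * d%:~R) * v ^+ 2 = 0.
      move/eqP; rewrite mulf_eq0 expf_eq0 /= => /orP[|/eqP //].
      by rewrite mulf_eq0 (negbTE dC0) orbF mulf_eq0 (negbTE Th0) orbF mulf_eq0 (negbTE S0) orbF pnatr_eq0.
    transitivity (3 * (d%:~R * ((1 + 2 * S) * zsC R th) * v ^+ 2) - (1 - 2 * S) * (d%:~R * (3%:~R * zsC R th) * v ^+ 2)); first by ring.
    by rewrite -k1 -k2; ring.
  have : u = 0.
    move: k2; rewrite /w v0 expr0n !mulr0 addr0 => /eqP; rewrite mulf_eq0 expf_eq0 /= => /orP[|/eqP //].
    by rewrite !mulf_eq0 (negbTE al0) conjC_eq0 (negbTE Th0) orbF intr_eq0.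
  by move=> u0; move: uv; rewrite u0 v0 eqxx.
have hn : nz (3%:~R * th) = 9 * nz th by rewrite nzM nz_int.
(* The ratio tau / q.2 is the denominator in the Poincare extension; it is bounded on a finite
   orbit. *)
have [M hM] : exists M : R, forall q, [set act_H3 g (z, tau) | g in @stabO R H0] q -> tau / q.2 <= M.
  have /finite_seqP[l ->] := fin; elim: l => [|q l [M hM]]; first by exists 0.
  exists (Num.max (tau / q.2) M) => q'; rewrite /= in_cons => /orP[/eqP ->|/hM h]; rewrite le_max ?lexx //.
  by rewrite h orbT.
have sk k : k%:Z <= `|s k|.
  elim: k => // k IH; have := s_inc (ltnSn k); lia.
pose k := Num.bound (`|M| / tau ^+ 2).
have hk : `|M| / tau ^+ 2 < k%:R by apply: archi_boundP; rewrite divr_ge0 // sqr_ge0.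
have [A [hA eA]] := unit_stabO (unit_k k hn).
have := hM _ (ex_intro2 _ _ (pcl A) hA erefl); rewrite act_H3_pcl /=.
set n := sqnorm _ + _ => hle.
have hsq x : sqnorm (zsC R x) = (nz x)%:~R.
  apply: (@complexI R); rewrite (rmorph_int (real_complex R)) -(zsC_int R) nzE zM zsC_cz.
  case: (zsC R x) => x1 x2; apply/eqP; rewrite eq_complex /sqnorm /= !expr2.
  by apply/andP; split; apply/eqP; ring.
have hn' : k%:R * tau ^+ 2 <= n.
  rewrite /n; apply: (@le_trans _ _ (sqnorm (A 1 0) * tau ^+ 2)); last by rewrite lerDr addr_ge0 // sqr_ge0.
  rewrite ler_pM2r ?exprn_gt0 // eA /zmx !mx2E hsq -[k%:R]/((k%:Z)%:~R) ler_int.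
  have -> : nz (ur a ((s k)%:~R * (3%:~R * th))) = 9 * (a ^+ 2 * a ^+ 2 * nz th) * s k ^+ 2.
    by rewrite /ur !nzM nz_cz !nzM !nz_int; ring.
  apply: le_trans (sk k) _.
  have := nz_gt0 th0; have : 0 < a ^+ 2 * a ^+ 2 by rewrite mulr_gt0 ?exprn_gt0.
  move: (a ^+ 2 * a ^+ 2) (nz th) (s k) => P n' s' P0 n'0.
  apply: (@le_trans _ _ (s' ^+ 2)); first by nia.
  have : 0 <= s' ^+ 2 by exact: sqr_ge0.
  have : 1 <= P * n' by nia.
  by move: (s' ^+ 2) (P * n') => x y *; nia.
have n0 : 0 < n by apply: lt_le_trans hn'; rewrite ltr_pdivrMr ?exprn_gt0 // in hk; apply: le_lt_trans hk.
move: hle; rewrite invf_div mulrCA divff ?gt_eqF // mulr1 => hle.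
have := le_trans hn' hle; rewrite leNgt => /negP; apply.
rewrite ltr_pdivrMr ?exprn_gt0 // in hk; apply: le_lt_trans hk; exact: ler_norm.
Qed.

End UnitsC.

(** * Base forms give F-subgroups *)

Section BaseForms.
Variable R : realType.
Local Notation C := (R[i]).
Local Notation conj := (@Num.conj C).

Lemma cnull_scform (k : C) (h : cform R) : k != 0 -> conj k = k -> cnull (scform k h) = cnull h.
Proof.
by move=> k0 rk; apply/seteqP; split=> p; rewrite /cnull /= sv_scform // => /eqP; rewrite ?mulf_eq0 ?(negbTE k0) => /eqP // ->; rewrite mulr0.
Qed.

(** A Fuchsian group containing the stabilizer preserves a circle whose form is fixed by all Pell
    units, hence is a nonzero multiple of [H0]. The circle is therefore the same one, and the group
    lies in the stabilizer. *)
Lemma stabO_F_subgroup (a c : int) (b : zs) : 0 < a -> 0 < nz b - a * c ->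
  F_subgroup (@Bianchi2 R) (stabO (HForm a b c)).
Proof.
move=> a0 d0; pose H0 := HForm a b c.
have [th [th0 [t [s [s_inc [s0 hts]]]]]] := pell_sequence R d0 a0.
have hc : is_circle (cnull (cform_of R H0)).
  apply: is_circle_cnull; [exact: creal_of|by rewrite cdisc_of ltr0z|].
  by rewrite /= intr_eq0 gt_eqF.
have fuchs : Fuchsian (@Bianchi2 R) (stabO H0) by exact: stabO_Fuchsian.
split=> //; first exact: (stabO_nonelementary (t:=t) (s:=s) a0 d0 th0 s_inc hts).
move=> G [Gs GB [S hS pS]] _ sub.
have [h [hr hd eS]] := circle_cform hS.
rewrite eS in pS; have pS' := (preservesP G hr hd).1 pS.
have [k rk ek] : exists2 k, conj k = k & h = scform k (cform_of R H0).
  apply: (units_determine a0 d0 hr th0 (s0 0%N) (hts 0%N)) => t' y hy.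
  have [A [hA eA]] := unit_stabO R hy.
  by rewrite -eA; apply: pS'; exact: sub.
have k0 : k != 0.
  apply/eqP => k0; move: hd; rewrite ek k0 /cdisc /= !mul0r subrr ltxx //.
rewrite ek cnull_scform // in pS.
by apply/seteqP; split=> //; apply/stabO_preserves.
Qed.

Lemma base_form_F_disc (D : nat) (a c : int) (b : zs) : (0 < D)%N -> base_form D a b ->
  nz b - a * c = D -> F_disc (@stabO R (HForm a b c)) D.
Proof.
move=> D0 hb hD; pose H0 := HForm a b c.
have [a0 _ _] := base_form_data hb.
have HD : 0 < hdisc H0 by rewrite [hdisc H0]hD.
exists (cnull (cform_of R H0)); split.
- apply: is_circle_cnull; [exact: creal_of|by rewrite cdisc_of ltr0z|].
  by rewrite /= intr_eq0 gt_eqF.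
- by apply/stabO_preserves => //; exact: (stabO_subgroup R H0).2.
exists a, (zre b), (zim b), c; split; last by rewrite -hD /nz.
  have -> : gcdz (gcdz a (zre b)) (zim b) = 1 by case: hb.
  exact: gcd1z.
by rewrite circle_locusE /H0; case: (b).
Qed.

Lemma listed_order_represented (D : nat) (M : set (Qalg D)) : (0 < D)%N -> listed_order M ->
  exists F : set (PSL2 C), [/\ F_subgroup (@Bianchi2 R) F, F_disc F (Posz D) & represented_by F M].
Proof.
move=> D0 /listed_ordset[[a b] /= hb ->].
have [a0 [c hc] _] := base_form_data hb.
exists (stabO (HForm a b (a * c))); split.
- by apply: stabO_F_subgroup => //; rewrite hc.
- exact: base_form_F_disc.
have [rho [bij e]] := base_form_stabO R D0 hb (or_introl erefl) hc.
exists rho; split=> //; rewrite -e; exists 1%g.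
  by apply: (stabO_subgroup R (HForm a b (a * c))).2; exact: (stabO_subgroup R (HForm a b (a * c))).1.1.
by apply/seteqP; split=> g; [move=> hg; exists g|move=> [x hx <-]]; rewrite ?conjg1.
Qed.

End BaseForms.

Theorem theorem2 (R : realType) (D : nat) (D_gt0 : (0 < D)%N) :
  [/\ forall M : set (Qalg D), listed_order M -> is_Zorder M,
      forall F : set (PSL2 (complex R)),
        F_subgroup (@Bianchi2 R) F -> F_disc F (Posz D) ->
        exists2 M : set (Qalg D), listed_order M & represented_by F M
    & forall M : set (Qalg D), listed_order M ->
        exists F : set (PSL2 (complex R)),
          [/\ F_subgroup (@Bianchi2 R) F, F_disc F (Posz D)
            & represented_by F M]].
Proof.
split; first exact: listed_Zorder.
  by move=> F; exact: F_subgroup_represented.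
by move=> M; exact: listed_order_represented.
Qed.
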